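(* Consider the $m$-agent Limited Sensing DTRP on the environment $\mathcal{Q}$ of area $A$ with target density $\varphi$, maximum agent speed $v$ and sensing radius $r$. The optimal system time satisfies $$\lim_{r \rightarrow 0^+}\overline{T}_{\mathrm{opt}}\, r \ \ge\ \frac{A}{4mv}$$ within the class of spatially unbiased policies, and $$\lim_{r \rightarrow 0^+}\overline{T}_{\mathrm{opt}}\, r \ \ge\ \frac{1}{4mv}\left(\int_{\mathcal{Q}}\sqrt{\varphi(q)}\,dq\right)^2$$ within the class of spatially biased policies.
   Context: Limited Sensing DTRP (Dynamic Traveling Repairman Problem). The environment $\mathcal{Q}\subset\mathbb{R}^2$ is convex, compact, with nonempty interior and area $A$. Targets are generated by a spatio-temporal Poisson point process with temporal intensity $\lambda>0$; target locations are i.i.d. with an absolutely continuous distribution of density $\varphi:\mathcal{Q}\to\mathbb{R}_+$, where $\int_{\mathcal{Q}}\varphi=1$, $\varphi$ is Lipschitz, and $0<\underline{\varphi}\le\varphi(q)\le\overline{\varphi}<\infty$ on $\mathcal{Q}$. There are $m$ (finite) identical point agents with positions $p_i(t)\in\mathcal{Q}$ and dynamics $\dot p_i=u_i$, $\|u_i\|\le v$. A target is fulfilled (and removed) when an agent moves to its location. Limited sensing: agents are not told of targets on arrival; agent $i$ detects only targets lying in its sensing disk $d(p_i)=\{q\in\mathbb{R}^2:\|p_i-q\|\le r\}$ (with $r$ small enough that the disk is contained in $\mathcal{Q}$ for at least one position). A target must be detected before it is serviced. A policy $\pi$ determines the agents' velocity commands over time from locally available information. With $n(t)$ the number of outstanding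 targets at time $t$, $\pi$ is stabilizing if $\lim_{t\to\infty}\mathrm{E}[n(t)]<\infty$ under $\pi$. With $T_j$ the time elapsed between generation and fulfillment of the $j$-th target, the system time is $\overline{T}_\pi=\lim_{j\to\infty}\mathrm{E}[T_j]$. A policy is spatially unbiased if under its action a target's expected waiting time is independent of its location, and spatially biased otherwise. $\overline{T}_{\mathrm{opt}}$ within a class is the infimum of $\overline{T}_\pi$ over stabilizing policies $\pi$ in that class; ''the class of spatially biased policies'' means that the spatial-unbiasedness constraint is not imposed. The limit $r\to0^+$ is taken with $\mathcal{Q},\lambda,\varphi,m,v$ fixed. *)

(* Defs.v *)
From HB Require Import structures.
From mathcomp Require Import all_boot all_order all_algebra.
From mathcomp Require Import all_classical all_reals all_analysis.

Set Implicit Arguments.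
Unset Strict Implicit.
Unset Printing Implicit Defensive.

Import Order.TTheory GRing.Theory Num.Theory.
Import numFieldNormedType.Exports.

Local Open Scope classical_set_scope.
Local Open Scope ring_scope.

Notation plane R := (Real.sort R * Real.sort R)%type.

(* The library's norm on a product is the sup norm. *)
Definition enorm {R : realType} (x : plane R) : R :=
  Num.sqrt (x.1 ^+ 2 + x.2 ^+ 2).

Definition disk {R : realType} (r : R) (x : plane R) : set (plane R) :=
  [set q | enorm (x - q) <= r].

Notation area := (@lebesgue_measure _ \x @lebesgue_measure _)%E.

(* A realization of the target process: [(c j).1] is the generation time and
   [(c j).2] the location of the j-th target, in order of generation. *)
Definition targets (R : realType) : Type := nat -> R * plane R.

Definition target_cylinders (R : realType) : set (set (targets R)) :=
  [set C | exists j (B : set (R * plane R)%type),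
             measurable B /\ C = [set c | B (c j)]].

Definition target_space (R : realType) :=
  g_sigma_algebraType (@target_cylinders R).

(* Holds almost surely for the target process below. *)
Definition regular {R : realType} (Q : set (plane R)) : set (targets R) :=
  [set c | [/\ forall j, 0 <= (c j).1,
               forall j, (c j).1 < (c j.+1).1,
               (fun j => (c j).1) @ \oo --> +oo
             & forall j, Q (c j).2]].

Definition paths (R : realType) (m : nat) : Type := 'I_m -> R -> plane R.

(* An agent standing on a target has it in its (closed) sensing disk, so that a
   target is always detected by the time it is fulfilled. *)
Definition fulfilled {R : realType} {m : nat} (c : targets R) (p : paths R m)
    (j : nat) (t : R) : Prop :=
  exists i s, (c j).1 <= s <= t /\ p i s = (c j).2.

Definition outstanding {R : realType} {m : nat} (c : targets R) (p : paths R m)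
    (j : nat) (t : R) : Prop :=
  (c j).1 <= t /\ ~ fulfilled c p j t.

Definition detected {R : realType} {m : nat} (r : R) (c : targets R)
    (p : paths R m) (k : 'I_m) (t : R) : set (plane R) :=
  [set q | disk r (p k t) q /\ exists2 j, outstanding c p j t & (c j).2 = q].

(* What each agent perceives over time: its position, and the locations of the
   outstanding targets in its sensing disk. *)
Definition readings (R : realType) (m : nat) : Type :=
  'I_m -> R -> plane R * set (plane R).

Definition readings_of {R : realType} {m : nat} (r : R) (c : targets R)
    (p : paths R m) : readings R m :=
  fun k t => (p k t, detected r c p k t).

(* [command pi i t h] is the velocity of agent [i] at time [t] when the readings
   have been [h]; [start pi] are the initial positions. *)
Record policy (R : realType) (m : nat) := Policy {
  start : 'I_m -> plane R ;
  command : 'I_m -> R -> readings R m -> plane R }.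

(* [shares i k] means that agent [i] has access to the readings of agent [k].
   With [shares i k := i == k] each agent only uses its own sensor; with
   [shares := fun _ _ => true] the agents pool everything they detect. *)
Definition locally_informed {R : realType} {m : nat} (shares : rel 'I_m)
    (pi : policy R m) : Prop :=
  forall i t (h h' : readings R m),
    (forall k s, shares i k -> 0 <= s <= t -> h k s = h' k s) ->
    command pi i t h = command pi i t h'.

(* On [0, T], p stays in Q and solves p_i' = u_i, p_i(0) = start_i, in the sense
   of Caratheodory, u_i being the commands of pi in closed loop. *)
Definition closed_loop {R : realType} {m : nat} (Q : set (plane R)) (r : R)
    (pi : policy R m) (c : targets R) (T : R) (p : paths R m) : Prop :=
  forall i, let u := fun s => command pi i s (readings_of r c p) in
  measurable_fun `[0, T] u /\
  forall t : R, 0 <= t <= T ->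
    Q (p i t) /\
    p i t = start pi i + (\int[lebesgue_measure]_(s in `[0, t]) (u s).1,
                          \int[lebesgue_measure]_(s in `[0, t]) (u s).2).

Definition admissible {R : realType} {m : nat} (Q : set (plane R)) (v : R)
    (shares : rel 'I_m) (pi : policy R m) : Prop :=
  [/\ forall i, Q (start pi i),
      forall i t h, enorm (command pi i t h) <= v
    & locally_informed shares pi].

(* [p c] is the motion that the policy produces on the targets [c].  Uniqueness
   on every [0, T] is what makes the closed loop causal: were several solutions
   allowed, the choice among them could depend on undetected targets, since an
   agent's own past positions are part of its readings. *)
Definition produces {R : realType} {m : nat} (Q : set (plane R)) (r : R)
    (pi : policy R m) (p : targets R -> paths R m) : Prop :=
  (forall c, regular Q c -> forall T : R, 0 <= T ->
     closed_loop Q r pi c T (p c) /\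
     forall q, closed_loop Q r pi c T q ->
       forall i (t : R), 0 <= t <= T -> q i t = p c i t) /\
  (forall i (t : R), 0 <= t ->
     measurable_fun (regular Q : set (target_space R)) (fun c => p c i t)).

Definition nb_arrivals {R : realType} (c : targets R) (s t : R) : \bar R :=
  (\sum_(0 <= j <oo) ((s <= (c j).1 < t)%R%:R : R)%:E)%E.

(* Poisson process of intensity lambda on [0, +oo[ (independent Poisson counts
   on consecutive intervals) with independent marks of density phi on Q. *)
Definition target_process {R : realType} {d : measure_display}
    {Om : measurableType d} (P : probability Om R) (lambda : R)
    (Q : set (plane R)) (phi : plane R -> R)
    (X : nat -> {RV P >-> (R * plane R)%type}) : Prop :=
  [/\ forall j w, 0 <= (X j w).1,
      forall j w, (X j w).1 <= (X j.+1 w).1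
    & forall (n l : nat) (t : nat -> R) (k : nat -> nat)
             (B : nat -> set (plane R)),
        0 <= t 0%N -> (forall i, t i < t i.+1) ->
        (forall j, measurable (B j)) ->
        P (\bigcap_(i in `I_n)
             [set w | nb_arrivals (X ^~ w) (t i) (t i.+1) = (k i)%:R%:E] `&`
           \bigcap_(j in `I_l) [set w | B j (X j w).2]) =
        (\prod_(i < n) poisson_pmf (lambda * (t i.+1 - t i)) (k i) *
         \prod_(j < l) \int[area]_(q in Q `&` B j) phi q)%:E].

(* Time from generation to fulfillment of target j; +oo if never fulfilled. *)
Definition system_time {R : realType} {m : nat} (c : targets R) (p : paths R m)
    (j : nat) : \bar R :=
  ereal_inf [set s%:E | s in
    [set s : R | 0 <= s /\ exists i, p i ((c j).1 + s) = (c j).2]].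

Definition nb_outstanding {R : realType} {m : nat} (c : targets R)
    (p : paths R m) (t : R) : \bar R :=
  (\sum_(0 <= j <oo) (`[< outstanding c p j t >]%:R : R)%:E)%E.

Section performance.
Context {R : realType} {m : nat} {d : measure_display} {Om : measurableType d}.
Context (P : probability Om R) (X : nat -> {RV P >-> (R * plane R)%type}).
Implicit Types (Q : set (plane R)) (p : targets R -> paths R m).

Let motion p w := p (X ^~ w).

Definition stabilizing p : Prop :=
  exists N : R,
    (fun t : R => \int[P]_w nb_outstanding (X ^~ w) (motion p w) t)%E @ +oo
      --> N%:E.

Definition mean_system_time p (j : nat) : \bar R :=
  (\int[P]_w system_time (X ^~ w) (motion p w) j)%E.

(* E[T_j | the j-th target is in S] *)
Definition mean_system_time_in p (S : set (plane R)) (j : nat) : \bar R :=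
  let inS := [set w | S (X j w).2] in
  ((\int[P]_(w in inS) system_time (X ^~ w) (motion p w) j) *
   (fine (P inS))^-1%:E)%E.

(* In steady state, the expected waiting time of a target given that it lies in
   a region of Q does not depend on the region. *)
Definition spatially_unbiased Q p : Prop :=
  exists tau : \bar R, forall S, measurable S -> S `<=` Q -> (0 < area S)%E ->
    mean_system_time_in p S @ \oo --> tau.

(* Infimum of the (existing) limits of E[T_j] over the stabilizing policies in
   the class described by the constraint C on the motion. *)
Definition optimal_system_time Q (v r : R) (shares : rel 'I_m)
    (C : (targets R -> paths R m) -> Prop) : \bar R :=
  ereal_inf [set tau | exists (pi : policy R m) p,
    [/\ admissible Q v shares pi,
        produces Q r pi p,
        stabilizing p,
        C p
      & mean_system_time p @ \oo --> tau]].

End performance.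

(* Main.v *)
Require Import Defs.
From HB Require Import structures.
From mathcomp Require Import all_boot all_order all_algebra.
From mathcomp Require Import all_classical all_reals all_analysis.
From mathcomp Require Import measurable_realfun.
From mathcomp Require Import ring lra zify.

Set Implicit Arguments.
Unset Strict Implicit.
Unset Printing Implicit Defensive.

Import Order.TTheory GRing.Theory Num.Theory.
Import numFieldNormedType.Exports.

Local Open Scope classical_set_scope.
Local Open Scope ring_scope.

(* Until an agent comes within [r] of a target [q], the agents move as if [q] did
   not exist, and [q] is independent of the other targets (a Palm formula for the
   Poisson process, obtained from its counts on a grid of windows of length
   [dt]).  During one window the agents only come within [r] of a set of area
   about [2 m r v dt], hence within [L] windows of a set of area about
   [2 m r v L dt].  So, capping the wait of a target at [q] by [kappa * sigma q]
   and averaging with weights [wt], the mean wait is at least about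
     [kappa * gamma - m r v kappa ^ 2 * alpha],
   where [gamma] is the integral of [wt * phi * sigma] and [alpha] bounds
   [wt * phi * sigma ^ 2]; the best [kappa] gives [gamma ^ 2 / (4 m v alpha r)].
   In the biased case take [wt = 1] and [sigma = 1 / sqrt phi].  An unbiased
   policy has the same limiting wait on all level sets of [phi], so that the
   targets can be reweighted to be uniform on [Q]: take [wt = 1 / (A phi)] and
   [sigma = 1]. *)

(** System times are indexed by targets, whereas the search is bounded per unit of time. A target
    that is alone in its window has as its index the number of earlier arrivals, which involves only
    the other targets. So only such targets are counted, at the cost of the factor
    [expR (- (lambda * dt))], which forces [dt] to tend to 0. But each window charges every agent a
    full disk, of area of order [r ^ 2], besides the swept strip of area about [2 * r * v * dt], so
    [r / dt] must tend to 0 too: [dt] will be the square root of [r]. The term in [kappa ^ 2] arises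
    by charging the region searched in one window to all windows whose test targets it may spoil: a
    point [q] is charged about [(kappa * sigma q) ^ 2 / (2 * dt)]. As the agents choose where to
    search, only a uniform bound [alpha] on the weighted charges helps. For [wt = 1], the largest
    [sigma] with [phi * sigma ^ 2 <= 1] is [1 / sqrt phi], the origin of the square root in the
    biased bound. *)

(** * Area swept by a moving disk *)

Lemma lebesgue_measure_translate (R : realType) (a : R) (B : set R) :
  measurable B ->
  lebesgue_measure ((fun y => y + a) @^-1` B) = lebesgue_measure B.
Proof.
move=> mB; rewrite -[LHS]/(pushforward lebesgue_measure
  ((fun y => y + a) : _ -> measurableTypeR R) B).
have mD : measurable_fun [set: measurableTypeR R]
    (fun y : measurableTypeR R => (y + a) : measurableTypeR R).
  exact: measurable_funD.
apply/esym; apply: lebesgue_measure_unique => // _ [[u w]] _ <-.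
rewrite [RHS](_ : _ = lebesgue_measure [set` `](u - a), (w - a)]%R]); last first.
  congr (lebesgue_measure _).
  by apply/seteqP; split => y /=; rewrite !in_itv/= ltrBlDr lerBrDr.
by rewrite !lebesgue_measure_itv/= !lte_fin ltrD2r -!EFinB opprB addrA subrK.
Qed.

Section plane_measure.
Context {R : realType}.
Implicit Types (A : set (plane R)) (l h t rho : R) (a b : plane R).

Lemma lebesgue_measure_diam (B : set R) l : 0 <= l -> measurable B ->
  (forall x y, B x -> B y -> y - x <= l) -> (lebesgue_measure B <= l%:E)%E.
Proof.
move=> l0 mB Bl.
have [->|/set0P[x0 Bx0]] := eqVneq B set0; first by rewrite measure0 lee_fin.
have Bub : has_lbound B.
  by exists (x0 - l) => y By; have := Bl _ _ By Bx0; rewrite lerBlDr lerBlDl.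
have Binf : has_inf B by split => //; exists x0.
apply: (@le_trans _ _ (lebesgue_measure [set` `[inf B, inf B + l]%R])).
  apply: le_measure; rewrite ?inE//.
  move=> y By /=; rewrite in_itv/= ge_inf//=.
  rewrite -lerBlDr; apply: lb_le_inf; first by exists x0.
  by move=> z Bz; have := Bl _ _ Bz By; rewrite lerBlDr lerBlDl addrC.
rewrite lebesgue_measure_itv/= lte_fin; case: ifPn => _; last by rewrite lee_fin.
by rewrite -EFinB lee_fin addrAC subrr add0r.
Qed.

(** Cavalieri's principle. Only the diameter of each section matters, not its position, which suits
    a crescent. *)
Lemma area_xsection_le A l h c : 0 <= l -> 0 <= h -> measurable A ->
  (forall x y y', A (x, y) -> A (x, y') -> y' - y <= l) ->
  (forall x y, A (x, y) -> `|x - c| <= h) ->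
  (area A <= (l * (2 * h))%:E)%E.
Proof.
move=> l0 h0 mA Al Ah.
have mI : measurable (`[c - h, c + h]%classic : set R) by [].
rewrite [leLHS](_ : _ = \int[lebesgue_measure]_(x in `[(c - h)%R, (c + h)%R])
    lebesgue_measure (xsection A x))%E; last first.
  rewrite integral_mkcond; apply: eq_integral => x _ /=.
  rewrite patchE; case: ifPn => // xI.
  rewrite (_ : xsection A x = set0) ?measure0//.
  rewrite -subset0 => y; rewrite /xsection/= inE => /Ah.
  rewrite ler_distl => xh; move: xI; rewrite notin_setE /= in_itv/=; exact.
apply: (@le_trans _ _ (\int[lebesgue_measure]_(x in `[(c - h)%R, (c + h)%R]) (cst l%:E x))%E).
  apply: ge0_le_integral => //=.
  - by apply: measurable_funTS; exact: measurable_fun_xsection.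
  - move=> x _; apply: lebesgue_measure_diam => //; first exact: measurable_xsection.
    by move=> y y'; rewrite /xsection/= !inE; exact: Al.
rewrite integral_cst//= lebesgue_measure_itv/= lte_fin; case: ifPn => _.
  by rewrite -EFinB -EFinM lee_fin ler_wpM2l// opprD opprK addrACA subrr add0r mulr2n mulrDl mul1r.
by rewrite mule0 lee_fin !mulr_ge0.
Qed.

Lemma area_swap A : measurable A -> area ((fun z : plane R => (z.2, z.1)) @^-1` A) = area A.
Proof.
move=> mA.
have -> : area A = (@lebesgue_measure R \x^ @lebesgue_measure R)%E A.
  by apply: product_measure_unique => //= *; rewrite product_measure2E.
by apply: eq_integral => x _ /=; congr (lebesgue_measure _).
Qed.

Lemma measurable_shear t :
  measurable_fun [set: plane R] (fun z : plane R => (z.1, z.2 + z.1 * t)).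
Proof.
apply: measurable_fun_pair => //=.
by apply: measurable_funD => //; apply: measurable_funM.
Qed.

(** A shear replaces the rotation that one would expect: it translates each section, so its
    invariance is immediate from the definition of the product measure. *)
Lemma area_shear A t : measurable A ->
  area ((fun z => (z.1, z.2 + z.1 * t)) @^-1` A) = area A.
Proof.
move=> mA; apply: eq_integral => x _ /=.
rewrite -(lebesgue_measure_translate (x * t) (measurable_xsection x mA)).
by congr (lebesgue_measure _).
Qed.

Lemma measurable_enorm : measurable_fun [set: plane R] enorm.
Proof.
apply: (measurable_comp (F := setT)) => //.
- by apply: nondecreasing_measurable => // x y; exact: ler_wsqrtr.
- by apply: measurable_funD; exact: measurable_funX.
Qed.

Lemma measurable_disk rho a : measurable (disk rho a).
Proof.
have mf : measurable_fun [set: plane R] (fun q => enorm (a - q)).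
  apply: (measurableT_comp measurable_enorm).
  apply: (eq_measurable_fun (fun q : plane R => (a.1 - q.1, a.2 - q.2))) => //.
  by apply: measurable_fun_pair; exact: measurable_funB.
have := mf measurableT `]-oo, rho]%classic (measurable_itv _).
by rewrite setTI; congr (measurable _); apply/seteqP; split => q /=; rewrite in_itv.
Qed.

Lemma enorm_ge0 a : 0 <= enorm a. Proof. exact: sqrtr_ge0. Qed.

Lemma enormN a : enorm (- a) = enorm a.
Proof. by rewrite /enorm /= !sqrrN. Qed.

Lemma enorm_le a rho : 0 <= rho -> (enorm a <= rho) = (a.1 ^+ 2 + a.2 ^+ 2 <= rho ^+ 2).
Proof.
move=> r0; rewrite /enorm -(ler_pXn2r (n := 2))// ?nnegrE ?sqrtr_ge0//.
by rewrite sqr_sqrtr// addr_ge0// sqr_ge0.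
Qed.

Lemma sqr_enorm a : enorm a ^+ 2 = a.1 ^+ 2 + a.2 ^+ 2.
Proof. by rewrite /enorm sqr_sqrtr// addr_ge0// sqr_ge0. Qed.

End plane_measure.

Section crescent.
Context {R : realType}.
Implicit Types (A : set (plane R)) (rho : R) (a b : plane R).

(** Convexity of a disk along a line; the defect of convexity of the squared norm is a nonnegative
    multiple of [e1 ^ 2 + e2 ^ 2]. *)
Lemma sqr_norm_line_convex (p1 p2 e1 e2 c s1 s s2 : R) : s1 < s -> s < s2 ->
  (p1 + s1 * e1) ^+ 2 + (p2 + s1 * e2) ^+ 2 <= c ->
  (p1 + s2 * e1) ^+ 2 + (p2 + s2 * e2) ^+ 2 <= c ->
  (p1 + s * e1) ^+ 2 + (p2 + s * e2) ^+ 2 <= c.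
Proof.
move=> s1s ss2 h1 h2.
have s12 : 0 < s2 - s1 by lra.
rewrite -(ler_pM2l s12) -subr_ge0.
have -> : (s2 - s1) * c - (s2 - s1) * ((p1 + s * e1) ^+ 2 + (p2 + s * e2) ^+ 2) =
   (s2 - s) * (c - ((p1 + s1 * e1) ^+ 2 + (p2 + s1 * e2) ^+ 2)) +
   (s - s1) * (c - ((p1 + s2 * e1) ^+ 2 + (p2 + s2 * e2) ^+ 2)) +
   (s2 - s1) * (s - s1) * (s2 - s) * (e1 ^+ 2 + e2 ^+ 2) by ring.
have [g1 g2] : 0 <= s2 - s /\ 0 <= s - s1 by split; rewrite subr_ge0 ltW.
rewrite -subr_ge0 in h1; rewrite -subr_ge0 in h2.
apply: addr_ge0; last by rewrite mulr_ge0 ?addr_ge0 ?sqr_ge0// !mulr_ge0// ltW.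
by apply: addr_ge0; apply: mulr_ge0.
Qed.

Lemma diskE rho a q : 0 <= rho -> disk rho a q <->
  (q.1 - a.1) ^+ 2 + (q.2 - a.2) ^+ 2 <= rho ^+ 2.
Proof.
by move=> r0; rewrite /disk/= enorm_le//= -(sqrrN (_ - _)) opprB -(sqrrN (q.2 - _)) opprB.
Qed.

(** On the line, parameter [s] is in the disk around [b] iff [s - k] is in the disk around [a]. If
    [s' - s] exceeded [|k|], then [s] or [s'], according to the sign of [k], would lie between
    [s - k] and [s' - k], hence in the disk around [a] by convexity. *)
Lemma crescent_chord rho a b (z e : plane R) (k s s' : R) : 0 <= rho ->
  b.1 = a.1 + k * e.1 -> b.2 = a.2 + k * e.2 ->
  (disk rho b `\` disk rho a) (z.1 + s * e.1, z.2 + s * e.2) ->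
  (disk rho b `\` disk rho a) (z.1 + s' * e.1, z.2 + s' * e.2) ->
  s' - s <= `|k|.
Proof.
move=> r0 b1 b2 [/(diskE _ _ r0) h1 n1] [/(diskE _ _ r0) h2 n2].
rewrite leNgt; apply/negP => ks.
have {}h1 : ((z.1 - a.1) + (s - k) * e.1) ^+ 2 +
            ((z.2 - a.2) + (s - k) * e.2) ^+ 2 <= rho ^+ 2.
  apply: le_trans h1; rewrite b1 b2 /= le_eqVlt; apply/orP; left; apply/eqP; ring.
have {}h2 : ((z.1 - a.1) + (s' - k) * e.1) ^+ 2 +
            ((z.2 - a.2) + (s' - k) * e.2) ^+ 2 <= rho ^+ 2.
  apply: le_trans h2; rewrite b1 b2 /= le_eqVlt; apply/orP; left; apply/eqP; ring.
have [k0|k0|k0] := ltrgtP k 0.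
- rewrite ltr0_norm// in ks; apply: n2; apply/diskE => //=.
  rewrite addrAC (addrAC z.2).
  by apply: sqr_norm_line_convex h1 h2; lra.
- rewrite gtr0_norm// in ks; apply: n1; apply/diskE => //=.
  rewrite addrAC (addrAC z.2).
  by apply: sqr_norm_line_convex h1 h2; lra.
- apply: n1; apply/diskE => //=; rewrite addrAC (addrAC z.2).
  by rewrite k0 subr0 in h1.
Qed.

(* Shearing the direction [b - a] onto a coordinate axis preserves areas and
   makes the crescent a union of chords of length at most [enorm (b - a)]. *)
Lemma area_crescent_le rho a b : 0 <= rho ->
  (area (disk rho b `\` disk rho a) <= (2 * rho * enorm (b - a))%:E)%E.
Proof.
move=> r0.
have mD : measurable (disk rho b `\` disk rho a).
  by apply: measurableD; exact: measurable_disk.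
(* A vertical displacement has no slope to shear away, but its chords are already vertical. *)
have [u0|u0] := eqVneq (b.1 - a.1) 0.
  have -> : enorm (b - a) = `|b.2 - a.2|.
    by rewrite /enorm/= u0 expr0n add0r sqrtr_sqr.
  rewrite mulrC; apply: (area_xsection_le (c := b.1)) => //.
    move=> x y y' h h'.
    apply: (crescent_chord (a := a) (b := b) (z := (x, 0)) (e := (0, 1)) r0) => /=.
    + by rewrite mulr0 addr0; apply/eqP; rewrite -subr_eq0 u0.
    + by rewrite mulr1 addrC subrK.
    + by rewrite mulr0 addr0 add0r mulr1; exact: h.
    + by rewrite mulr0 addr0 add0r mulr1; exact: h'.
  move=> x y [/(diskE _ _ r0)/= h _].
  rewrite -(ler_pXn2r (n := 2))// ?nnegrE// real_normK ?num_real//.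
  by apply: le_trans h; rewrite lerDl sqr_ge0.
(* After the shear of slope [t] the chords are horizontal of length at most [|u|], and the crescent
   has height at most [2 * rho * sqrt (1 + t ^ 2)]; the product is the announced bound. *)
set u := b.1 - a.1 in u0 *; set w := b.2 - a.2; pose t := w / u.
have wE : w = u * t by rewrite /t mulrCA mulfV// mulr1.
have -> : enorm (b - a) = `|u| * Num.sqrt (1 + t ^+ 2).
  rewrite -sqrtr_sqr -sqrtrM ?sqr_ge0// /enorm/= -/u -/w wE.
  by congr (Num.sqrt _); ring.
rewrite -(area_shear t mD) -area_swap; last first.
  rewrite -[X in measurable X]setTI; exact: measurable_shear.
rewrite mulrCA (_ : 2 * rho * _ = 2 * (rho * Num.sqrt (1 + t ^+ 2))); last by rewrite mulrA.
apply: (area_xsection_le (c := b.2 - b.1 * t)) => //.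
- by rewrite mulr_ge0// sqrtr_ge0.
- have m1 : measurable_fun [set: plane R] (fun z : plane R => (z.2, z.1)).
    exact: measurable_fun_pair.
  rewrite -[X in measurable X]setTI; apply: m1 => //.
  rewrite -[X in measurable X]setTI; exact: measurable_shear.
- move=> y x x'; rewrite /preimage/= => h h'.
  apply: (crescent_chord (a := a) (b := b) (z := (0, y)) (e := (1, t)) r0) => /=.
  + by rewrite mulr1 addrC subrK.
  + by rewrite -wE addrC subrK.
  + by rewrite add0r mulr1; exact: h.
  + by rewrite add0r mulr1; exact: h'.
- move=> y x; rewrite /preimage/= => -[/(diskE _ _ r0)/= h _].
  rewrite -(ler_pXn2r (n := 2))// ?nnegrE ?mulr_ge0 ?sqrtr_ge0//.
  rewrite real_normK ?num_real// exprMn sqr_sqrtr ?addr_ge0 ?sqr_ge0//.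
  (* Cauchy-Schwarz for the vectors [(x - b.1, y + x * t - b.2)] and [(- t, 1)]. *)
  apply: (@le_trans _ _ (((x - b.1) ^+ 2 + (y + x * t - b.2) ^+ 2) * (1 + t ^+ 2))).
    rewrite -subr_ge0.
    have -> : ((x - b.1) ^+ 2 + (y + x * t - b.2) ^+ 2) * (1 + t ^+ 2) -
        (y - (b.2 - b.1 * t)) ^+ 2 =
        ((x - b.1) + t * (y + x * t - b.2)) ^+ 2 by ring.
    exact: sqr_ge0.
  by rewrite ler_wpM2r// addr_ge0// sqr_ge0.
Qed.

(** The bounding square is good enough, since the initial disk is negligible against the swept strip
    in the limit. *)
Lemma area_disk_le rho a : 0 <= rho -> (area (disk rho a) <= (4 * rho ^+ 2)%:E)%E.
Proof.
move=> r0; rewrite (_ : 4 * rho ^+ 2 = (2 * rho) * (2 * rho)); last by ring.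
apply: (area_xsection_le (c := a.1)) => //; rewrite ?mulr_ge0//.
- exact: measurable_disk.
- move=> x y y' /(diskE _ _ r0)/= h /(diskE _ _ r0)/= h'.
  have k : forall q, (x - a.1) ^+ 2 + (q - a.2) ^+ 2 <= rho ^+ 2 -> `|q - a.2| <= rho.
    move=> q hq; rewrite -(ler_pXn2r (n := 2))// ?nnegrE// real_normK ?num_real//.
    by apply: le_trans hq; rewrite lerDr sqr_ge0.
  by move: (k _ h) (k _ h'); rewrite !ler_distl; lra.
- move=> x y /(diskE _ _ r0)/= h.
  rewrite -(ler_pXn2r (n := 2))// ?nnegrE// real_normK ?num_real//.
  by apply: le_trans h; rewrite lerDl sqr_ge0.
Qed.

(** Each new disk adds at most the crescent that it forms with its predecessor. *)
Lemma area_sausage_le rho (l : R) (z : nat -> plane R) (n : nat) : 0 <= rho ->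
  (forall i, (i < n)%N -> enorm (z i.+1 - z i) <= l) ->
  (area (\bigcup_(i in `I_n.+1) disk rho (z i)) <=
    (4 * rho ^+ 2 + n%:R * (2 * rho * l))%:E)%E.
Proof.
move=> r0; elim: n => [|n ih] zl.
  rewrite mul0r addr0 (_ : \bigcup_(i in _) _ = disk rho (z 0%N)); first exact: area_disk_le.
  by rewrite II1 bigcup_set1.
have mU k : measurable (\bigcup_(i in `I_k) disk rho (z i)).
  by apply: bigcup_measurable => i _; exact: measurable_disk.
have -> : \bigcup_(i in `I_n.+2) disk rho (z i) =
    (\bigcup_(i in `I_n.+1) disk rho (z i)) `|`
    (disk rho (z n.+1) `\` \bigcup_(i in `I_n.+1) disk rho (z i)).
  rewrite setDE setUIr setUv setIT IIS bigcup_setU.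
  by congr (_ `|` _); rewrite bigcup_set1.
have mD k : measurable (disk rho (z n.+1) `\` \bigcup_(i in `I_k) disk rho (z i)).
  by apply: measurableD; [exact: measurable_disk|exact: mU].
rewrite measureU; last 3 first.
- exact: mU.
- exact: mD.
- by rewrite setDE setICA setICr setI0.
rewrite (_ : _ + _ * _ = (4 * rho ^+ 2 + n%:R * (2 * rho * l)) + 2 * rho * l); last first.
  by rewrite -[n.+1%:R]natr1; ring.
rewrite EFinD; apply: leeD.
  by apply: ih => i ni; apply: zl; rewrite ltnS ltnW.
apply: (@le_trans _ _ (area (disk rho (z n.+1) `\` disk rho (z n)))).
  apply: le_measure; rewrite ?inE.
  - exact: mD.
  - by apply: measurableD; exact: measurable_disk.
  - move=> q [q1 q2]; split => // q3; apply: q2.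
    by exists n => //=.
apply: (le_trans (area_crescent_le _ _ r0)).
by rewrite lee_fin ler_wpM2l// ?mulr_ge0// zl.
Qed.

End crescent.

(** * Removal of a target from the closed loop *)

Section motion.
Context {R : realType} {m : nat}.
Implicit Types (Q : set (plane R)) (c : targets R) (pi : policy R m)
  (p q : paths R m).

Lemma dot_le_enorm (a b : plane R) : a.1 * b.1 + a.2 * b.2 <= enorm a * enorm b.
Proof.
apply: (le_trans (ler_norm _)).
rewrite -(ler_pXn2r (n := 2))// ?nnegrE ?mulr_ge0 ?enorm_ge0//.
rewrite real_normK ?num_real// exprMn !sqr_enorm -subr_ge0.
have -> : (a.1 ^+ 2 + a.2 ^+ 2) * (b.1 ^+ 2 + b.2 ^+ 2) - (a.1 * b.1 + a.2 * b.2) ^+ 2 =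
  (a.1 * b.2 - a.2 * b.1) ^+ 2 by ring.
exact: sqr_ge0.
Qed.

Lemma normr_coord_le_enorm (a : plane R) : `|a.1| <= enorm a /\ `|a.2| <= enorm a.
Proof.
by rewrite /enorm -!sqrtr_sqr !ler_wsqrtr// ?lerDl ?lerDr ?sqr_ge0.
Qed.

(** Bounding the coordinates separately would spoil the constant. Pairing [u] with its integral [z]
    gives [|z| ^ 2], the integral of the inner products of [z] and [u x], which is at most
    [|z| * v * (t - s)]. *)
Lemma enorm_integral_le (u : R -> plane R) (v s t : R) : 0 <= v -> s <= t ->
  measurable_fun `]s, t] u -> (forall x, enorm (u x) <= v) ->
  enorm (\int[lebesgue_measure]_(x in `]s, t]) (u x).1,
         \int[lebesgue_measure]_(x in `]s, t]) (u x).2) <= v * (t - s).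
Proof.
move=> v0 st mu ub; set z := (X in enorm X).
have muI : lebesgue_measure (`]s, t]%classic : set R) = (t - s)%:E.
  rewrite lebesgue_measure_itv/= lte_fin; case: ltP => // ts.
  by have -> : t - s = 0 by apply/eqP; rewrite subr_eq0 eq_le ts st.
have int k (f : R -> R) : measurable_fun `]s, t] f -> (forall x, `|f x| <= k) ->
    lebesgue_measure.-integrable `]s, t] (EFin \o f).
  move=> mf fk; apply: measurable_bounded_integrable => //.
    by rewrite /= muI ltry.
  exists k; split; rewrite ?num_real// => M kM x _ /=.
  by rewrite (le_trans (fk _))// ltW.
have m1 : measurable_fun `]s, t] (fun x => (u x).1) by exact: measurableT_comp.
have m2 : measurable_fun `]s, t] (fun x => (u x).2) by exact: measurableT_comp.
have i1 := int v _ m1 (fun x => le_trans (normr_coord_le_enorm _).1 (ub x)).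
have i2 := int v _ m2 (fun x => le_trans (normr_coord_le_enorm _).2 (ub x)).
have [z0|z0] := eqVneq (enorm z) 0.
  by rewrite z0 mulr_ge0// subr_ge0.
have zgt0 : 0 < enorm z by rewrite lt_neqAle eq_sym z0 enorm_ge0.
rewrite -(ler_pM2l zgt0) -expr2 sqr_enorm !expr2.
have j1 : lebesgue_measure.-integrable `]s, t] (EFin \o (fun x => z.1 * (u x).1)).
  apply: (int (`|z.1| * v)); first exact: measurable_funM.
  by move=> x; rewrite normrM ler_wpM2l// (le_trans (normr_coord_le_enorm _).1 (ub x)).
have j2 : lebesgue_measure.-integrable `]s, t] (EFin \o (fun x => z.2 * (u x).2)).
  apply: (int (`|z.2| * v)); first exact: measurable_funM.
  by move=> x; rewrite normrM ler_wpM2l// (le_trans (normr_coord_le_enorm _).2 (ub x)).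
have -> : z.1 * z.1 + z.2 * z.2 = \int[lebesgue_measure]_(x in `]s, t])
    (z.1 * (u x).1 + z.2 * (u x).2).
  by rewrite RintegralD// !RintegralZl.
have -> : enorm z * (v * (t - s)) =
    \int[lebesgue_measure]_(x in `]s, t]) (enorm z * v).
  by rewrite /Rintegral integral_cst//= muI/= mulrA.
apply: le_Rintegral => //.
- apply: (int (`|z.1| * v + `|z.2| * v)).
    by apply: measurable_funD; exact: measurable_funM.
  move=> x; apply: (le_trans (ler_normD _ _)); rewrite !normrM.
  apply: lerD; apply: ler_wpM2l => //.
    by rewrite (le_trans (normr_coord_le_enorm _).1 (ub x)).
  by rewrite (le_trans (normr_coord_le_enorm _).2 (ub x)).
- by apply: (int `|enorm z * v|).
- move=> x _; apply: (le_trans (dot_le_enorm z (u x))).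
  by rewrite ler_wpM2l// enorm_ge0.
Qed.

Lemma closed_loop_lipschitz Q (v r : R) (shares : rel 'I_m) pi c (T : R) p i s t :
  0 <= v -> admissible Q v shares pi -> closed_loop Q r pi c T p ->
  0 <= s -> s <= t -> t <= T -> enorm (p i t - p i s) <= v * (t - s).
Proof.
move=> v0 [_ pv _] /(_ i) [mu pE] s0 st tT.
have t0 := le_trans s0 st; have sT := le_trans st tT.
rewrite (pE t _).2 ?t0// (pE s _).2 ?s0//.
pose u s := command pi i s (readings_of r c p); rewrite -/u in mu *.
have -> : (start pi i + (\int[lebesgue_measure]_(s in `[0, t]) (u s).1,
                  \int[lebesgue_measure]_(s in `[0, t]) (u s).2)) -
   (start pi i + (\int[lebesgue_measure]_(s in `[0, s]) (u s).1,
                  \int[lebesgue_measure]_(s in `[0, s]) (u s).2)) =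
   (\int[lebesgue_measure]_(s in `]s, t]) (u s).1,
         \int[lebesgue_measure]_(s in `]s, t]) (u s).2).
  rewrite opprD addrACA subrr add0r.
  have int (f : R -> R) : measurable_fun `[0, T] f -> (forall x, `|f x| <= v) ->
      lebesgue_measure.-integrable `[0, t] (EFin \o f).
    move=> mf fk; apply: measurable_bounded_integrable => //.
    - by rewrite /= lebesgue_measure_itv/=; case: ifP => _; rewrite ?ltry// -EFinB ltry.
    - by apply: measurable_funS mf => //; apply: subset_itvl; rewrite bnd_simp.
    - exists v; split; rewrite ?num_real// => M kM x _ /=.
      by rewrite (le_trans (fk _))// ltW.
  apply/pair_equal_spec; split=> /=; rewrite -(Rintegral_itvB (a := BLeft 0) (x := s)) ?bnd_simp//.
    apply: int; first exact: measurableT_comp.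
    by move=> x; exact: (le_trans (normr_coord_le_enorm _).1 (pv _ _ _)).
  apply: int; first exact: measurableT_comp.
  by move=> x; exact: (le_trans (normr_coord_le_enorm _).2 (pv _ _ _)).
apply: enorm_integral_le => //; last by move=> x; exact: pv.
apply: measurable_funS mu => //; apply: subset_itv; rewrite ?bnd_simp//.
Qed.

Definition remove (j : nat) c : targets R := fun i => c (bump j i).

Lemma regular_lt Q c i j : regular Q c -> (i < j)%N -> (c i).1 < (c j).1.
Proof.
move=> [_ h _ _]; elim: j => // j ih; rewrite ltnS leq_eqVlt => /predU1P[->//|].
by move/ih/lt_trans; apply.
Qed.

Lemma regular_remove Q c j : regular Q c -> regular Q (remove j c).
Proof.
move=> rc; have [c0 cS coo cQ] := rc; split => [i|i||i]; rewrite /remove//.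
- by apply: (regular_lt rc); rewrite /bump; case: leqP; case: leqP; lia.
- apply: (cvg_comp (bump j) (fun i => (c i).1) _ coo).
  move=> A [N _ NA]; exists N => // k /= Nk; apply: NA => /=.
  by rewrite (leq_trans Nk)// leq_addl.
Qed.

Lemma bumpP j j' : j' = j \/ exists i, j' = bump j i.
Proof.
have [->|jj'] := eqVneq j' j; [by left|right].
by exists (unbump j j'); rewrite unbumpKcond (negbTE jj').
Qed.

(* As long as the agents, moving as if target [j] did not exist, stay more
   than [r] away from it, their readings are the same as if it did. *)
Lemma readings_of_remove (r : R) c p j (T : R) :
  (forall i t, (c j).1 <= t <= T -> r < enorm (p i t - (c j).2)) ->
  forall i t, t <= T -> readings_of r c p i t = readings_of r (remove j c) p i t.
Proof.
move=> far i t tT; congr (_, _); apply/seteqP; split => q [dq [j' [tj' oj'] qE]].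
  have [jj'|[k jk]] := bumpP j j'; last by subst j'; split => //; exists k.
  exfalso; subst j' q; move: dq; rewrite /disk/= leNgt => /negP; apply.
  by apply: far; rewrite tj'.
by split => //; exists (bump j j').
Qed.

(** The readings agree up to time [T], and a command at time [s] depends only on readings up to [s];
    so the motion computed without target [j] also solves the equation with it. *)
Lemma closed_loop_remove Q (v r : R) (shares : rel 'I_m) pi c p j (T : R) :
  admissible Q v shares pi ->
  (forall i t, (c j).1 <= t <= T -> r < enorm (p i t - (c j).2)) ->
  closed_loop Q r pi (remove j c) T p -> closed_loop Q r pi c T p.
Proof.
move=> [_ _ loc] far cl i.
have cE s : 0 <= s <= T -> command pi i s (readings_of r (remove j c) p) =
    command pi i s (readings_of r c p).
  move=> /andP[s0 sT]; apply: loc => k s' _ /andP[_ s's].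
  by rewrite (readings_of_remove far)// (le_trans s's).
have [mu pE] := cl i; split.
  by apply: eq_measurable_fun mu => s; rewrite inE/= in_itv/=; exact: cE.
move=> t /andP[t0 tT]; have [|Qp pit] := pE t; first by rewrite t0.
split=> //; rewrite pit; congr (_ + _); apply/pair_equal_spec; split; apply: eq_Rintegral => s;
  by rewrite inE/= in_itv/= => /andP[s0 st]; rewrite cE// s0 (le_trans st).
Qed.

(** Uniqueness of the closed loop identifies the true motion with the one computed without target
    [j]. The wait is thereby bounded through a motion that does not depend on target [j] at all. *)
Lemma system_time_ge Q (v r : R) (shares : rel 'I_m) pi (p : targets R -> paths R m)
    c j (T : R) : 0 < r ->
  admissible Q v shares pi -> produces Q r pi p -> regular Q c -> 0 <= T ->
  (forall i t, (c j).1 <= t <= T ->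
     r < enorm (p (remove j c) i t - (c j).2)) ->
  ((T - (c j).1)%:E <= system_time c (p c) j)%E.
Proof.
move=> r0 adm [prod _] rc T0 far.
have [cl' _] := prod _ (regular_remove j rc) _ T0.
have [_ uniq] := prod _ rc _ T0.
have pE := uniq _ (closed_loop_remove adm far cl').
apply: le_ereal_inf_tmp => _ [s [s0 [i pi_s]] <-]; rewrite lee_fin leNgt.
apply/negP => sT.
have t0 : 0 <= (c j).1 by case: rc.
have hs : 0 <= (c j).1 + s <= T by rewrite addr_ge0//=; lra.
have := far i ((c j).1 + s); rewrite pE// pi_s subrr.
rewrite /enorm/= expr0n addr0 sqrtr0 => /(_ _)/wrap[]; first by lra.
by move=> /(lt_trans r0); rewrite ltxx.
Qed.

End motion.

(** * Arrival times and counts *)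

Section counting.
Context {R : realType}.
Implicit Types (c : targets R) (a s t u : R) (i j k n : nat).

(** The part of regularity that [target_process] grants for every outcome, not only almost
    surely. *)
Definition chronological : set (targets R) :=
  [set c | (forall j, 0 <= (c j).1) /\ (forall j, (c j).1 <= (c j.+1).1)].

Lemma chronological_le c i j : chronological c -> (i <= j)%N -> (c i).1 <= (c j).1.
Proof.
move=> [_ h]; elim: j => [|j ih]; first by rewrite leqn0 => /eqP ->.
by rewrite leq_eqVlt => /predU1P[->//|]; rewrite ltnS => /ih/le_trans; apply.
Qed.

Lemma chronological_remove c j : chronological c -> chronological (remove j c).
Proof.
move=> cc; split=> i; first by case: cc => h _; exact: h.
by rewrite /remove; apply: (chronological_le cc); rewrite /bump; case: leqP; case: leqP; lia.
Qed.

Lemma nb_arrivals_ge0 c s t : (0 <= nb_arrivals c s t)%E.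
Proof. by apply: nneseries_ge0 => i _ _; rewrite lee_fin. Qed.

Lemma nb_arrivalsD c s t u : s <= t -> t <= u ->
  nb_arrivals c s u = (nb_arrivals c s t + nb_arrivals c t u)%E.
Proof.
move=> st tu; rewrite /nb_arrivals -nneseriesD; last 2 first.
- by move=> i _ _; rewrite lee_fin.
- by move=> i _ _; rewrite lee_fin.
apply: eq_eseriesr => i _; rewrite -EFinD -natrD; congr ((_%:R)%:E).
case: (leP s (c i).1) => h1; case: (ltP (c i).1 t) => h2;
  case: (leP t (c i).1) => h3; case: (ltP (c i).1 u) => h4 //=; exfalso; lra.
Qed.

Lemma nb_arrivals_same c s : nb_arrivals c s s = 0%E.
Proof.
by apply: eseries0 => i _ _; case: (leP s (c i).1).
Qed.

Lemma nb_arrivals_sum c (t : nat -> R) n : (forall i, (i < n)%N -> t i <= t i.+1) ->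
  nb_arrivals c (t 0%N) (t n) = (\sum_(i < n) nb_arrivals c (t i) (t i.+1))%E.
Proof.
move=> ti; have ti0 k : (k <= n)%N -> t 0%N <= t k.
  by elim: k => // k ih kn; rewrite (le_trans (ih (ltnW kn)))// ti.
elim: n ti ti0 => [|n ih] ti ti0; first by rewrite big_ord0 nb_arrivals_same.
rewrite big_ord_recr/= -ih; last 2 first.
- by move=> i ni; apply: ti; rewrite ltnS ltnW.
- by move=> k kn; apply: ti0; rewrite leqW.
by rewrite -nb_arrivalsD// ?ti// ti0.
Qed.

(** The duality between arrival times and counts: it transfers to arrival times the law of the
    process, which is prescribed through counts. *)
Lemma arrival_ltP c j a : chronological c ->
  (c j).1 < a <-> (j.+1%:R%:E <= nb_arrivals c 0 a)%E.
Proof.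
move=> cc; have ge0 i : 0 <= (c i).1 by case: cc => h _; exact: h.
have u0 i : (0 <= (((0 <= (c i).1 < a)%R%:R : R)%:E))%E by rewrite lee_fin.
split => [cja|].
  apply: (@le_trans _ _ (\sum_(0 <= i < j.+1) (((0 <= (c i).1 < a)%R%:R : R)%:E))%E).
    rewrite big_mkord (eq_bigr (fun=> 1%E)); last first.
      move=> i _; rewrite ge0/= (le_lt_trans _ cja)//.
      by apply: chronological_le => //; rewrite -ltnS.
    by rewrite sumEFin sumr_const card_ord.
  exact: nneseries_lim_ge.
move=> h; rewrite ltNge; apply/negP => acj; move: h; rewrite leNgt => /negP; apply.
rewrite /nb_arrivals (nneseries_split 0 j)//= eseries0 ?adde0; last first.
  move=> i ji _; rewrite ltNge (le_trans acj) ?andbF//.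
  exact: chronological_le.
apply: (@le_lt_trans _ _ (\sum_(0 <= i < 0 + j) 1%E)%E).
  by apply: lee_sum => i _; rewrite lee_fin; case: (_ && _).
by rewrite big_mkord sumEFin sumr_const card_ord lte_fin ltr_nat.
Qed.

(** The complement of the previous event is a finite union of exact count events, the only ones
    whose probabilities are given. *)
Lemma arrival_ge_count c j a : chronological c -> a <= (c j).1 ->
  exists2 q, (q < j.+1)%N & nb_arrivals c 0 a = q%:R%:E.
Proof.
move=> cc acj; exists (\sum_(i < j) (0 <= (c i).1 < a)%R)%N.
  rewrite ltnS -[leqRHS]card_ord -sum1_card.
  by apply: leq_sum => i _; case: (_ && _).
rewrite /nb_arrivals (nneseries_split 0 j) ?eseries0 ?adde0//.
  by rewrite add0n big_mkord sumEFin natr_sum.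
by move=> i; rewrite add0n => ji _; rewrite ltNge (le_trans acj) ?andbF// chronological_le.
Qed.

Lemma nb_arrivals_remove c j s t :
  nb_arrivals c s t =
  (nb_arrivals (remove j c) s t + ((s <= (c j).1 < t)%R%:R : R)%:E)%E.
Proof.
pose f i : \bar R := (((s <= (c i).1 < t)%R%:R : R)%:E).
have f0 i : (0 <= f i)%E by rewrite lee_fin.
have g0 i : (0 <= f (bump j i))%E by [].
have -> : nb_arrivals (remove j c) s t = (\sum_(0 <= i <oo) f (bump j i))%E by [].
rewrite -/(f j) /nb_arrivals (nneseries_split 0 j.+1)// (nneseries_split 0 j (fun i _ => g0 i)).
rewrite !add0n big_nat_recr//= -!/(f _) -(nneseries_addn j.+1 f0) -(nneseries_addn j g0).
rewrite addeAC; congr (_ + _ + _)%E.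
  rewrite big_nat_cond [RHS]big_nat_cond; apply: eq_bigr => i; rewrite andbT => /andP[_ ij].
  by rewrite -/(f i) /bump leqNgt ij.
by apply: eq_eseriesr => i _; rewrite -/(f (i + j.+1)%N) /bump leq_addl add1n addnS.
Qed.


End counting.

(** * Poisson counts and locations *)

Section target_space_measurability.
Context {R : realType}.
Implicit Types (c : targets R) (j : nat).

Lemma measurable_target j : measurable_fun [set: target_space R] (fun c => c j).
Proof.
move=> _ B mB; rewrite setTI; apply: sub_sigma_algebra.
by exists j, B.
Qed.

Lemma measurable_fun_targets d (T : measurableType d) (F : T -> target_space R) :
  (forall j, measurable_fun [set: T] (fun w => F w j)) ->
  measurable_fun [set: T] F.
Proof.
move=> mF.
apply: (@measurability _ _ T (target_space R) setT F (@target_cylinders R) erefl).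
move=> _ [_ [j [B [mB ->]]] <-]; exact: mF.
Qed.

Lemma measurable_remove j :
  measurable_fun [set: target_space R] (fun c => remove j c : target_space R).
Proof. by apply: measurable_fun_targets => i; exact: measurable_target. Qed.

Lemma measurable_arrival j : measurable_fun [set: target_space R] (fun c => (c j).1).
Proof. exact: (measurableT_comp measurable_fst (measurable_target j)). Qed.

Lemma measurable_location j : measurable_fun [set: target_space R] (fun c => (c j).2).
Proof. exact: (measurableT_comp measurable_snd (measurable_target j)). Qed.

Lemma measurable_nb_arrivals (s t : R) :
  measurable_fun [set: target_space R] (fun c => nb_arrivals c s t).
Proof.
apply: ge0_emeasurable_sum => [k c _ _|k _]; first by rewrite lee_fin.
apply/measurable_EFinP.
have -> : (fun c : target_space R => (s <= (c k).1 < t)%R%:R : R) =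
    \1_((fun c : target_space R => (c k).1) @^-1` `[s, t[%classic).
  by apply/funext => c; rewrite indicE; congr ((nat_of_bool _)%:R); apply/idP/idP;
    rewrite inE/= in_itv.
apply: measurable_indic; rewrite -[X in measurable X]setTI.
exact: measurable_arrival.
Qed.

Lemma measurable_nb_arrivals_eq (s t : R) (x : \bar R) :
  measurable ([set c | nb_arrivals c s t = x] : set (target_space R)).
Proof.
have := measurable_nb_arrivals s t measurableT (emeasurable_set1 x).
by rewrite setTI.
Qed.

Lemma measurable_arrival_lt j (a : R) :
  measurable ([set c | (c j).1 < a] : set (target_space R)).
Proof.
have := measurable_arrival j measurableT (measurable_itv `]-oo, a[).
by rewrite setTI; congr (measurable _); apply/seteqP; split => c /=; rewrite in_itv.
Qed.

Lemma measurable_arrival_le i j :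
  measurable ([set c | (c i).1 <= (c j).1] : set (target_space R)).
Proof.
have := measurable_fun_ler (measurable_arrival i) (measurable_arrival j)
  measurableT (Y := [set true]) Logic.I.
by rewrite setTI.
Qed.

Lemma measurable_chronological :
  measurable (chronological : set (target_space R)).
Proof.
have -> : chronological =
    \bigcap_j [set c : targets R | 0 <= (c j).1] `&`
    \bigcap_j [set c : targets R | (c j).1 <= (c j.+1).1].
  apply/seteqP; split => c [c1 c2]; split; by
    [move=> j _; exact: c1 |move=> j _; exact: c2|
     move=> j; exact: c1|move=> j; exact: c2].
apply: measurableI; apply: bigcap_measurable => // j _.
  rewrite (_ : mkset _ = ~` [set c : targets R | (c j).1 < 0]).
    by apply: measurableC; exact: measurable_arrival_lt.
  by apply/seteqP; split => c /=; rewrite leNgt => /negP.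
exact: measurable_arrival_le.
Qed.

Lemma measurable_regular (Q : set (plane R)) : measurable Q ->
  measurable (regular Q : set (target_space R)).
Proof.
move=> mQ.
have -> : regular Q = chronological `&`
    \bigcap_j ~` [set c : targets R | (c j.+1).1 <= (c j).1] `&`
    \bigcap_j [set c : targets R | Q (c j).2] `&`
    \bigcap_n \bigcup_j ~` [set c : targets R | (c j).1 < n%:R].
  apply/seteqP; split => c.
    move=> rc; have [c0 cS coo cQ] := rc; split; [split; [split|]|].
    - by split => // j; exact: ltW.
    - by move=> j _ /=; apply/negP; rewrite -ltNge.
    - by move=> j _; exact: cQ.
    - move=> n _; have /cvgryPge/(_ n%:R)[j _ jn] := coo.
      by exists j => //=; apply/negP; rewrite -leNgt; exact: (jn j (leqnn j)).
  move=> [[[cc cS] cQ] coo]; split.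
  - by case: cc.
  - by move=> j; rewrite ltNge; apply/negP; exact: cS.
  - apply/cvgryPge => A.
    have [j _ /negP] := coo (Num.truncn `|A|).+1 Logic.I.
    rewrite -leNgt => jA; exists j => // k /= jk.
    rewrite (le_trans (ler_norm A))// (le_trans (ltW (truncnS_gt _)))//.
    by rewrite (le_trans jA)//; exact: chronological_le.
  - by move=> j; exact: cQ.
apply: measurableI; [apply: measurableI; [apply: measurableI|]|].
- exact: measurable_chronological.
- by apply: bigcap_measurable => // j _; apply: measurableC; exact: measurable_arrival_le.
- apply: bigcap_measurable => // j _; rewrite -[X in measurable X]setTI.
  exact: measurable_location.
- apply: bigcap_measurable => // n _; apply: bigcup_measurable => j _.
  by apply: measurableC; exact: measurable_arrival_lt.
Qed.

End target_space_measurability.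

Definition cell_counts {R : realType} (t : nat -> R) (n : nat) (k : nat -> nat) :
    set (targets R) :=
  [set c | forall i, (i < n)%N -> nb_arrivals c (t i) (t i.+1) = (k i)%:R%:E].

Definition locations_in {R : realType} (B : nat -> set (plane R)) : set (targets R) :=
  [set c | forall i, B i (c i).2].

Section poisson_grid.
Context {R : realType}.

Lemma measurable_cell_counts (t : nat -> R) n k :
  measurable (cell_counts t n k : set (target_space R)).
Proof.
rewrite (_ : cell_counts t n k = \bigcap_(i in `I_n)
  [set c | nb_arrivals c (t i) (t i.+1) = (k i)%:R%:E]).
  by apply: bigcap_measurableType => i _; exact: measurable_nb_arrivals_eq.
by apply/seteqP; split => c h i; exact: h.
Qed.

Lemma measurable_locations_in (B : nat -> set (plane R)) :
  (forall i, measurable (B i)) -> measurable (locations_in B : set (target_space R)).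
Proof.
move=> mB; rewrite (_ : locations_in B = \bigcap_i [set c | B i (c i).2]).
  apply: bigcap_measurableType => i _.
  by rewrite -[X in measurable X]setTI; apply: measurable_location.
by apply/seteqP; split => c h i; [move=> _|]; exact: h.
Qed.

Lemma cell_counts_partial (t : nat -> R) n k c b : (forall i, t i < t i.+1) ->
  (b <= n)%N -> cell_counts t n k c ->
  nb_arrivals c (t 0%N) (t b) = (\sum_(i < b) k i)%N%:R%:E.
Proof.
move=> tS bn ck; rewrite nb_arrivals_sum; last by move=> i _; exact: ltW.
rewrite natr_sum -sumEFin; apply: eq_bigr => i _.
by rewrite ck// (leq_trans _ bn).
Qed.

Lemma strict_incr_lt (t : nat -> R) : (forall i, t i < t i.+1) ->
  forall a b, (t a < t b) = (a < b)%N.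
Proof.
by move=> /increasing_seqP tS a b; rewrite (leW_mono tS).
Qed.

Lemma in_cell (t : nat -> R) x a b : (forall i, t i < t i.+1) ->
  t a <= x < t a.+1 -> t b <= x < t b.+1 -> a = b.
Proof.
move=> tS /andP[a1 a2] /andP[b1 b2].
have ab : (a < b.+1)%N by rewrite -(strict_incr_lt tS) (le_lt_trans a1 b2).
have ba : (b < a.+1)%N by rewrite -(strict_incr_lt tS) (le_lt_trans b1 a2).
by apply/eqP; rewrite eqn_leq; apply/andP; split.
Qed.

(** For a Poisson law, one arrival is [mu] times as likely as none. This is the source of the factor
    [lambda * (s1 - s0)] in the Palm formula. *)
Lemma poisson_pmf_bump (mu : nat -> R) (k : nat -> nat) n b :
  (forall i, 0 < mu i) -> (b < n)%N -> k b = 0%N ->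
  \prod_(i < n) poisson_pmf (mu i) (k i + (i == b :> nat))%N =
  mu b * \prod_(i < n) poisson_pmf (mu i) (k i).
Proof.
move=> mu0 bn kb.
rewrite (bigD1 (Ordinal bn))//= [in RHS](bigD1 (Ordinal bn))//= mulrA.
congr (_ * _); last first.
  by apply: eq_bigr => i ib; rewrite (negbTE (_ : i != b :> nat)%N) ?addn0.
by rewrite kb eqxx /poisson_pmf mu0 expr1 expr0 fact0 !(divr1, invr1, mulr1, mul1r).
Qed.

End poisson_grid.

Section target_law.
Context {R : realType} {d : measure_display} {Om : measurableType d}.
Context {P : probability Om R} {lambda : R} {Q : set (plane R)} {phi : plane R -> R}.
Context {X : nat -> {RV P >-> (R * plane R)%type}}.
Context (lambda0 : 0 < lambda).
Context (HX : target_process lambda Q phi X).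

Local Notation T w := (X ^~ w : target_space R).
Let Phi (B : set (plane R)) : R := \int[area]_(q in Q `&` B) phi q.

Lemma measurable_targets : measurable_fun [set: Om] (fun w => T w).
Proof. by apply: measurable_fun_targets => j. Qed.

Lemma measurable_targets_preimage (U : set (target_space R)) : measurable U ->
  measurable [set w | U (T w)].
Proof.
by move=> mU; rewrite -[X in measurable X]setTI; exact: measurable_targets.
Qed.

Lemma chronological_targets w : chronological (T w).
Proof. by case: HX => h1 h2 _; split. Qed.

Lemma location_law (j : nat) B : measurable B -> P [set w | B (X j w).2] = (Phi B)%:E.
Proof.
move=> mB; have [_ _ /(_ 0%N j.+1 (fun i => i%:R) (fun=> 0%N))] := HX.
move=> /(_ (fun i => if i == j then B else setT)).
rewrite big_ord0 mul1r => h.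
(* Trivial events yield [Phi setT = 1], which erases the factors of the targets before [j]. *)
have Phi1 : forall l, P [set: Om] = (\prod_(j < l) Phi setT)%:E.
  move=> l; have [_ _ /(_ 0%N l (fun i => i%:R) (fun=> 0%N) (fun=> setT))] := HX.
  rewrite big_ord0 mul1r => <- //; last by move=> i; rewrite ltr_nat.
  by congr (P _); apply/esym/seteqP; split => // w _; split.
have PhiT : Phi setT = 1.
  by have := Phi1 1%N; rewrite probability_setT big_ord1 => -[].
rewrite (_ : [set w | _] = \bigcap_(i in `I_0)
    [set w | nb_arrivals (X ^~ w) (i%:R) (i.+1%:R) = 0%:R%:E] `&`
  \bigcap_(i in `I_j.+1) [set w | (if i == j then B else setT) (X i w).2]).
  rewrite h//; last 2 first.
  - by move=> i; rewrite ltr_nat.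
  - by move=> i; case: ifP.
  congr (_%:E); rewrite big_ord_recr/= eqxx big1 ?mul1r// => i _.
  by rewrite ltn_eqF.
apply/seteqP; split => w /=.
  by move=> Bw; split => // i /= _; case: eqP => // ->.
by case=> _ /(_ j (ltnSn j)); rewrite /= eqxx.
Qed.

Lemma grid_law (t : nat -> R) n k (B : nat -> set (plane R)) l :
  t 0%N = 0 -> (forall i, t i < t i.+1) -> (forall i, measurable (B i)) ->
  (forall i, (l <= i)%N -> B i = setT) ->
  P [set w | cell_counts t n k (T w) /\ locations_in B (T w)] =
  (\prod_(i < n) poisson_pmf (lambda * (t i.+1 - t i)) (k i) *
   \prod_(i < l) Phi (B i))%:E.
Proof.
move=> t0 tS mB lB; have [_ _ h] := HX.
rewrite -h ?t0//; congr (P _); apply/seteqP; split => w.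
  by move=> [ck cB]; split => i /= hi; [exact: ck|exact: cB].
move=> [ck cB]; split => i; first exact: ck.
by have [il|li] := ltnP i l; [exact: cB|rewrite lB].
Qed.

Section palm_grid.
Variables (t : nat -> R) (n p : nat) (k : nat -> nat) (j l : nat).
Variables (B : nat -> set (plane R)) (B0 : set (plane R)).
Hypotheses (t0 : t 0%N = 0) (tS : forall i, t i < t i.+1).
Hypotheses (mB : forall i, measurable (B i)) (lB : forall i, (l <= i)%N -> B i = setT).
Hypotheses (mB0 : measurable B0) (jl : (j <= l)%N).
Hypothesis kj : (\sum_(i < p) k i)%N = j.

Let rest w := cell_counts t n k (remove j (T w)) /\
  locations_in B (remove j (T w)) /\ B0 (X j w).2.

Let B' i := if i == j then B0 else B (unbump j i).

Let locations_inE c : locations_in B' c <->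
  locations_in B (remove j c) /\ B0 (c j).2.
Proof.
rewrite /locations_in/remove/B' /=; split.
  move=> h; split; last by have := h j; rewrite eqxx.
  by move=> i; have := h (bump j i); rewrite eq_sym (negbTE (neq_bump _ _)) bumpK.
move=> [h1 h2] i; case: eqP => [->//|ij].
have [//|[i' i'E]] := bumpP j i.
by rewrite i'E bumpK; exact: h1.
Qed.

(** Adding one arrival in cell [b] to the counts [k] creates the target of index exactly [j]: by
    [kj] there are [j] arrivals before cell [p], and the cells from [p] to [b] contain no other
    one. *)
Let cell_eq b w : (p <= b)%N -> (b < n)%N ->
    (forall i, (p <= i)%N -> (i <= b)%N -> k i = 0%N) ->
  (t b <= (X j w).1 < t b.+1 /\ rest w) <->
  (cell_counts t n (fun i => k i + (i == b))%N (T w) /\ locations_in B' (T w)).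
Proof.
move=> pb bn k0; split.
  move=> [tb [ck cB]]; split; last exact/locations_inE.
  move=> i ni; rewrite (nb_arrivals_remove _ j) ck// -EFinD -natrD.
  congr ((_ + nat_of_bool _)%:R%:E); apply/idP/eqP.
    by move=> ti; exact: (in_cell tS ti tb).
  by move=> ->.
move=> [ck /locations_inE cB].
have jE : (\sum_(i < b) (k i + (i == b :> nat)))%N = j.
  rewrite -kj (big_ord_widen_cond _ xpredT _ pb) [LHS](bigID (fun i : 'I_b => i < p)%N)/=.
  rewrite [X in (_ + X)%N]big1 ?addn0; last first.
    by move=> i; rewrite -leqNgt => pi; rewrite k0 ?(ltnW (ltn_ord i))// ltn_eqF.
  by apply: eq_bigr => i _; rewrite ltn_eqF// addn0.
have tb : t b <= (X j w).1 < t b.+1.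
  have cc := chronological_targets w.
  apply/andP; split.
    rewrite leNgt; apply/negP => /(arrival_ltP _ _ cc).
    rewrite -{1}t0 (cell_counts_partial tS (ltnW bn) ck) jE.
    by rewrite lee_fin ler_nat ltnn.
  apply/(arrival_ltP _ _ cc); rewrite -{1}t0 (cell_counts_partial tS bn ck).
  by rewrite lee_fin ler_nat big_ord_recr/= jE eqxx -[X in (X <= _)%N]addn1 leq_add2l leq_addl.
split => //; split => // i ni.
have := ck i ni; rewrite (nb_arrivals_remove _ j).
have -> : (t i <= (X j w).1 < t i.+1) = (i == b).
  by apply/idP/eqP => [ti|->//]; exact: (in_cell tS ti tb).
rewrite natrD EFinD => /(congr1 (fun z => (z - ((i == b)%:R : R)%:E)%E)).
by rewrite !addeK.
Qed.

(** Induction on [p'], one cell at a time. By [cell_eq], the event that target [j] is in the new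
    cell is again a grid event; [poisson_pmf_bump] compares its probability with that of [k], and
    the cell lengths add up. *)
Lemma palm_grid p' : (p <= p')%N -> (p' <= n)%N ->
  (forall i, (p <= i)%N -> (i < p')%N -> k i = 0%N) ->
  P [set w | t p <= (X j w).1 < t p' /\ rest w] =
  ((lambda * (t p' - t p) * Phi B0)%:E *
   P [set w | cell_counts t n k (T w) /\ locations_in B (T w)])%E.
Proof.
have mrest e : measurable [set w | t p <= (X j w).1 < t e /\ rest w].
  rewrite (_ : mkset _ = [set w |
    ([set c : target_space R | t p <= (c j).1 < t e] `&`
     ((remove j) @^-1` (cell_counts t n k `&` locations_in B)) `&`
     [set c | B0 (c j).2]) (T w)]).
    apply: measurable_targets_preimage; apply: measurableI; [apply: measurableI|].
    - have := measurable_arrival j measurableT (measurable_itv `[t p, t e[).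
      by rewrite setTI; congr (measurable _); apply/seteqP; split => c /=; rewrite in_itv.
    - rewrite -[X in measurable X]setTI; apply: measurable_remove => //.
      by apply: measurableI; [exact: measurable_cell_counts|exact: measurable_locations_in].
    - by rewrite -[X in measurable X]setTI; apply: measurable_location.
  by apply/seteqP; split => w; rewrite /rest/=; tauto.
elim: p' => [|e ih].
  rewrite leqn0 => /eqP -> _ _; rewrite subrr mulr0 mul0r mul0e.
  rewrite (_ : mkset _ = set0) ?measure0// -subset0 => w [/andP[h1 h2] _].
  by move: (le_lt_trans h1 h2); rewrite ltxx.
rewrite leq_eqVlt => /predU1P[<- _ _|].
  rewrite subrr mulr0 mul0r mul0e.
  rewrite (_ : mkset _ = set0) ?measure0// -subset0 => w [/andP[h1 h2] _].
  by move: (le_lt_trans h1 h2); rewrite ltxx.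
rewrite ltnS => pe en k0.
pose k' i := (k i + (i == e))%N.
have ceq w := @cell_eq e w pe en k0.
have -> : [set w | t p <= (X j w).1 < t e.+1 /\ rest w] =
    [set w | t p <= (X j w).1 < t e /\ rest w] `|`
    [set w | cell_counts t n k' (T w) /\ locations_in B' (T w)].
  apply/seteqP; split => w.
    move=> [/andP[h1 h2] hr]; have [h3|h3] := ltP (X j w).1 (t e).
      by left; rewrite /= h1 h3.
    by right; apply/ceq; rewrite h3 h2.
  case=> [[/andP[h1 h2] hr]|/ceq [/andP[h1 h2] hr]].
    by split => //; rewrite h1 (lt_trans h2).
  split => //; rewrite h2 andbT (le_trans _ h1)//.
  by rewrite leNgt (strict_incr_lt tS) -leqNgt.
have mB' i : measurable (B' i) by rewrite /B'; case: ifP.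
(* Inserting target [j] shifts the later constraints by one; as [j <= l], its own constraint is
   among the first [l.+1]. *)
have lB' i : (l.+1 <= i)%N -> B' i = setT.
  move=> li; rewrite /B' ifN; last by rewrite gtn_eqF// (leq_ltn_trans jl).
  by apply: lB; rewrite /unbump; lia.
rewrite measureU//; first last.
- rewrite -subset0 => w [[/andP[_ h1] _] /ceq [/andP[h2 _] _]].
  by move: (lt_le_trans h1 h2); rewrite ltxx.
- rewrite (_ : mkset _ = [set w | (cell_counts t n k' `&` locations_in B') (T w)])//.
  by apply: measurable_targets_preimage; apply: measurableI;
    [exact: measurable_cell_counts|exact: measurable_locations_in].
pose G := \prod_(i < n) poisson_pmf (lambda * (t i.+1 - t i)) (k i).
pose H := \prod_(i < l) Phi (B i).
have GE : P [set w | cell_counts t n k (T w) /\ locations_in B (T w)] = (G * H)%:E.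
  exact: (grid_law _ _ t0 tS mB lB).
have ihE : P [set w | t p <= (X j w).1 < t e /\ rest w] =
    (lambda * (t e - t p) * Phi B0 * (G * H))%:E.
  rewrite ih ?GE -?EFinM//; first exact: ltnW.
  by move=> i ? ?; apply: k0 => //; rewrite ltnW.
have newE : P [set w | cell_counts t n k' (T w) /\ locations_in B' (T w)] =
    (lambda * (t e.+1 - t e) * G * (Phi B0 * H))%:E.
  rewrite (grid_law _ _ t0 tS mB' lB'); congr (_ * _)%:E.
    apply: (poisson_pmf_bump (mu := fun i => lambda * (t i.+1 - t i)) (k := k)) => //.
      by move=> i; rewrite mulr_gt0// subr_gt0.
    exact: k0.
  rewrite (bigD1_ord (Ordinal (jl : (j < l.+1)%N)))//= {1}/B' eqxx; congr (_ * _).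
  by apply: eq_bigr => i _; rewrite /B' eq_sym (negbTE (neq_bump _ _)) bumpK.
rewrite GE -EFinM [LHS](_ : _ = (lambda * (t e - t p) * Phi B0 * (G * H))%:E +
  (lambda * (t e.+1 - t e) * G * (Phi B0 * H))%:E)%E; last by congr (_ + _)%E.
by rewrite -EFinD; congr (_%:E); ring.
Qed.

End palm_grid.
End target_law.

(** Cumulative counts at arbitrary times: unlike the counts on the cells of a grid, these are closed
    under intersection by mere concatenation. *)
Definition count_constraints {R : realType} (s : seq (R * nat)) : set (targets R) :=
  [set c | forall x, x \in s -> nb_arrivals c 0 x.1 = x.2%:R%:E].

(** * Palm formula *)

Section constraint_grid.
Context {R : realType}.
Implicit Types (s : seq (R * nat)) (c : targets R).

Lemma count_constraints_cat s1 s2 :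
  count_constraints (s1 ++ s2) = count_constraints s1 `&` count_constraints s2.
Proof.
apply/seteqP; split => c.
  by move=> h; split => x xs; apply: h; rewrite mem_cat xs ?orbT.
by move=> [h1 h2] x; rewrite mem_cat => /orP[|]; [exact: h1|exact: h2].
Qed.

Lemma measurable_count_constraints s :
  measurable (count_constraints s : set (target_space R)).
Proof.
elim: s => [|x s ih].
  rewrite (_ : count_constraints [::] = setT)//.
  by apply/seteqP; split => // c _ x.
rewrite -cat1s count_constraints_cat; apply: measurableI => //.
rewrite (_ : count_constraints [:: x] = [set c | nb_arrivals c 0 x.1 = x.2%:R%:E]).
  exact: measurable_nb_arrivals_eq.
apply/seteqP; split => c /=; first by apply; rewrite mem_head.
by move=> h y; rewrite inE => /eqP ->.
Qed.

Lemma grid_of_seq (s : seq R) : (forall x, x \in s -> 0 <= x) ->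
  exists (t : nat -> R) (n : nat), [/\ t 0%N = 0, forall i, t i < t i.+1,
    forall i, (i <= n)%N -> t i = 0 \/ t i \in s &
    forall x, x \in s -> exists2 i, (i <= n)%N & t i = x].
Proof.
move=> s0; pose g := sort <=%O (undup (0 :: s)).
have gs : sorted <%O g by rewrite sort_lt_sorted undup_uniq.
have memg x : (x \in g) = (x == 0) || (x \in s) by rewrite mem_sort mem_undup inE.
have g_ge0 x : x \in g -> 0 <= x by rewrite memg => /orP[/eqP->//|/s0].
case gE : g => [|g0 g'].
  by have := memg 0; rewrite gE eqxx.
pose n := size g'.
have sz : size g = n.+1 by rewrite gE.
(* Past the last point the grid goes on by unit steps, to be strictly increasing on all of [nat]. *)
pose t i := nth 0 g (minn i n) + (i - n)%:R.
have tle i : (i <= n)%N -> t i = nth 0 g i.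
  by move=> ni; rewrite /t (minn_idPl ni) (eqP (_ : i - n == 0)%N) ?subn_eq0// addr0.
have lt_nth i k : (i < k)%N -> (k <= n)%N -> nth 0 g i < nth 0 g k.
  move=> ik kn; apply: (sorted_ltn_nth lt_trans) => //; rewrite inE sz ltnS//.
  exact: ltnW (leq_trans ik kn).
exists t, n; split.
- have /(nthP 0)[[|i] ig gi] : 0 \in g by rewrite memg eqxx.
    by rewrite tle.
  have := lt_nth 0%N i.+1 (ltn0Sn _); rewrite -ltnS -sz gi ig => /(_ isT).
  by rewrite ltNge g_ge0// mem_nth// sz.
- move=> i; have [ni|ni] := ltnP i n.
    by rewrite !tle ?(ltnW ni)// lt_nth.
  rewrite /t !(minn_idPr _) ?(leqW ni)// ltrD2l ltr_nat ltn_sub2r//.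
- move=> i ni; have : nth 0 g i \in g by rewrite mem_nth// sz ltnS.
  by rewrite tle// memg => /orP[/eqP ->|]; [left|right].
- move=> x xs; have /(nthP 0)[i ig gi] : x \in g by rewrite memg xs orbT.
  by exists i; [rewrite -ltnS -sz|rewrite tle// -ltnS -sz].
Qed.

Lemma strict_incr_ge0 (t : nat -> R) : t 0%N = 0 -> (forall i, t i < t i.+1) ->
  forall i, 0 <= t i.
Proof.
by move=> t0 tS i; rewrite -t0 leNgt (strict_incr_lt tS).
Qed.

(** Every grid point is 0 or a constrained time, so the cumulative counts on the grid are those of
    [c0], and the cell counts are their increments. The witness [c0] excludes contradictory
    constraints. *)
Lemma count_constraints_cells s c0 : (forall x, x \in s -> 0 <= x.1) ->
  count_constraints s c0 ->
  exists (t : nat -> R) (n : nat) (k : nat -> nat),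
    [/\ t 0%N = 0, forall i, t i < t i.+1,
    forall x, x \in s -> exists2 i, (i <= n)%N & t i = x.1 &
    count_constraints s = cell_counts t n k].
Proof.
move=> s0 sc0.
have s0' x : x \in map fst s -> 0 <= x by move=> /mapP[y ys ->]; exact: s0.
have [t [n [t0 tS tin tex]]] := grid_of_seq s0'.
have tE c i : count_constraints s c -> (i <= n)%N ->
    nb_arrivals c 0 (t i) = nb_arrivals c0 0 (t i).
  move=> sc /tin[->|/mapP[x xs ->]]; first by rewrite !nb_arrivals_same.
  by rewrite sc// sc0.
have /choice[N NE] : forall i, exists k : nat, (i <= n)%N ->
    nb_arrivals c0 0 (t i) = k%:R%:E.
  move=> i; have [ni|ni] := leqP i n; last by exists 0%N.
  have [->|/mapP[x xs ->]] := tin _ ni; first by exists 0%N; rewrite nb_arrivals_same.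
  by exists x.2 => _; rewrite sc0.
have addN c i : nb_arrivals c 0 (t i.+1) =
    (nb_arrivals c 0 (t i) + nb_arrivals c (t i) (t i.+1))%E.
  by rewrite -nb_arrivalsD ?(strict_incr_ge0 t0 tS)// ltW.
have sk c : count_constraints s c -> cell_counts t n (fun i => N i.+1 - N i)%N c.
  move=> sc i ni; have := addN c i; rewrite !tE ?(ltnW ni)// !NE ?(ltnW ni)//.
  move=> h; have Nle : (N i <= N i.+1)%N.
    by rewrite -(ler_nat R) -lee_fin h leeDl// nb_arrivals_ge0.
  rewrite natrB// EFinB h addeAC.
  by rewrite subee// add0e.
exists t, n, (fun i => N i.+1 - N i)%N; split => //.
  by move=> x xs; apply: tex; exact: map_f.
apply/seteqP; split => c; first exact: sk.
move=> ck x xs; have [|i ni ti] := tex x.1; first exact: map_f.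
rewrite -ti -t0 (cell_counts_partial tS ni ck) -(cell_counts_partial tS ni (sk _ sc0)).
by rewrite t0 ti sc0.
Qed.

End constraint_grid.

Lemma leq_sum_ord (k : nat -> nat) a b : (a <= b)%N ->
  (\sum_(i < a) k i <= \sum_(i < b) k i)%N.
Proof.
move=> ab; rewrite (big_ord_widen _ k ab) [leqRHS](bigID (fun i : 'I_b => i < a)%N)/=.
exact: leq_addr.
Qed.

Lemma image_measure_exists d1 d2 (T1 : measurableType d1) (T2 : measurableType d2)
    (R : realType) (mu : {measure set T1 -> \bar R}) (f : T1 -> T2) :
  measurable_fun [set: T1] f ->
  exists nu : {measure set T2 -> \bar R}, forall A, nu A = mu (f @^-1` A).
Proof.
by move=> mf; exists (measure_function_pushforward__canonical__measure_function_Measure mu mf).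
Qed.

Section palm.
Context {R : realType} {d : measure_display} {Om : measurableType d}.
Context {P : probability Om R} {lambda : R} {Q : set (plane R)} {phi : plane R -> R}.
Context {X : nat -> {RV P >-> (R * plane R)%type}}.
Context (lambda0 : 0 < lambda).
Context (HX : target_process lambda Q phi X).

Local Notation T w := (X ^~ w : target_space R).
Let Phi (B : set (plane R)) : R := \int[area]_(q in Q `&` B) phi q.

(** Exactly [j] arrivals before [s0] and none in [[s0, s1[]: a target inserted in this window
    receives the index [j]. *)
Definition vacant (s0 s1 : R) (j : nat) : set (targets R) :=
  count_constraints [:: (s0, j); (s1, j)].

Lemma measurable_vacant s0 s1 j : measurable (vacant s0 s1 j : set (target_space R)).
Proof. exact: measurable_count_constraints. Qed.

Lemma palm_constraints (s0 s1 : R) j (s : seq (R * nat)) (B : nat -> set (plane R)) l B0 :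
  0 <= s0 -> s0 < s1 -> (forall x, x \in s -> 0 <= x.1) ->
  (forall i, measurable (B i)) -> (forall i, (l <= i)%N -> B i = setT) ->
  measurable B0 -> (j <= l)%N ->
  let E := vacant s0 s1 j `&` count_constraints s in
  P [set w | s0 <= (X j w).1 < s1 /\ (E (remove j (T w)) /\
    locations_in B (remove j (T w)) /\ B0 (X j w).2)] =
  ((lambda * (s1 - s0) * Phi B0)%:E *
   P [set w | E (T w) /\ locations_in B (T w)])%E.
Proof.
move=> s00 s01 sge0 mB lB mB0 jl E.
pose s' := [:: (s0, j); (s1, j)] ++ s.
have {E}-> : E = count_constraints s' by rewrite /E /vacant -count_constraints_cat.
have s'0 x : x \in s' -> 0 <= x.1.
  by rewrite !inE => /or3P[/eqP->|/eqP->|/sge0]//=; rewrite (le_trans s00)// ltW.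
(* With contradictory constraints both events are empty. *)
have [[c0 sc0]|no] := pselect (exists c0, count_constraints s' c0); last first.
  rewrite [X in P X](_ : _ = set0); last first.
    by rewrite -subset0 => w [_ [h _]]; apply: no; eexists; exact: h.
  rewrite [X in (_ * P X)%E](_ : _ = set0); last first.
    by rewrite -subset0 => w [h _]; apply: no; eexists; exact: h.
  by rewrite !measure0 mule0.
have [t [n [k [t0 tS tex sE]]]] := count_constraints_cells s'0 sc0.
have [/= p pn tp] := tex (s0, j) (mem_head _ _).
have [/= p' p'n tp'] : exists2 i, (i <= n)%N & t i = s1.
  by apply: (tex (s1, j)); rewrite !inE eqxx orbT.
have pp' : (p < p')%N by rewrite -(strict_incr_lt tS) tp tp'.
have ck0 : cell_counts t n k c0 by rewrite -sE.
have sumE q a : (q <= n)%N -> t q = a -> (a, j) \in s' -> (\sum_(i < q) k i)%N = j.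
  move=> qn tq /sc0/=; rewrite -{1}t0 -tq (cell_counts_partial tS qn ck0).
  by move=> [] /eqP; rewrite eqr_nat => /eqP.
have kp : (\sum_(i < p) k i)%N = j by apply: (sumE _ _ pn tp); rewrite mem_head.
have kp' : (\sum_(i < p') k i)%N = j.
  by apply: (sumE _ _ p'n tp'); rewrite !inE eqxx orbT.
rewrite sE -tp -tp'; apply: (palm_grid lambda0 HX t0 tS mB lB mB0 jl kp (ltnW pp') p'n).
move=> i pi ip'.
have := leq_sum_ord k pi; have := leq_sum_ord k ip'.
by rewrite big_ord_recr/= kp kp'; lia.
Qed.

(* The constraints on the counts, together with all measurable sets that the
   chronological configurations avoid, generate the product sigma-algebra,
   since arrival times of chronological configurations can be read off the
   counts. *)
Let generators l : set (set (target_space R)) :=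
  [set C : set (target_space R) | (exists s B, [/\ (forall x, x \in s -> 0 <= x.1),
      (forall i, measurable (B i)),
      (exists2 l', (l <= l')%N & forall i, (l' <= i)%N -> B i = setT) &
      C = count_constraints s `&` locations_in B]) \/
    (measurable C /\ C `&` chronological = set0)].

Let measurable_generators l (C : set (target_space R)) : generators l C -> measurable C.
Proof.
case=> [[s [B [_ mB _ ->]]]|[]//].
by apply: measurableI; [exact: measurable_count_constraints|exact: measurable_locations_in].
Qed.

Let generatorsI l : setI_closed (generators l).
Proof.
move=> C C' gC gC'; have mC := measurable_generators gC.
have mC' := measurable_generators gC'.
case: gC => [[s [B [s0 mB [l1 ll1 lB] CE]]]|[_ C0]]; last first.
  by right; split; [exact: measurableI|rewrite setIAC C0 set0I].
case: gC' => [[s' [B' [s0' mB' [l1' _ lB'] CE']]]|[_ C0]]; last first.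
  by right; split; [exact: measurableI|rewrite -setIA C0 setI0].
left; exists (s ++ s'), (fun i => B i `&` B' i); split.
- by move=> x; rewrite mem_cat => /orP[/s0|/s0'].
- by move=> i; exact: measurableI.
- exists (maxn l1 l1'); first by rewrite (leq_trans ll1)// leq_maxl.
  by move=> i; rewrite geq_max => /andP[i1 i2]; rewrite lB// lB'// setTI.
- rewrite CE CE' count_constraints_cat setIACA; congr (_ `&` _).
  apply/seteqP; split => c.
    by move=> [h1 h2] i; split; [exact: h1|exact: h2].
  by move=> h; split => i; case: (h i).
Qed.

Let generate l (U : set (target_space R)) : measurable U -> <<s generators l >> U.
Proof.
have loc j B : measurable B -> generators l [set c | B (c j).2].
  move=> mB; left; exists [::], (fun i => if i == j then B else setT); split => //.
  - by move=> i; case: ifP.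
  - exists (maxn l j.+1); first exact: leq_maxl.
    by move=> i; rewrite geq_max => /andP[_ ji]; rewrite gtn_eqF.
  - rewrite (_ : count_constraints _ = setT) ?setTI; last first.
      by apply/seteqP; split.
    apply/seteqP; split => c /=.
      by move=> Bc i; case: eqP => [->|].
    by move=> /(_ j); rewrite eqxx.
pose GT := g_sigma_algebraType (generators l).
have mO : measurable (chronological : set GT).
  rewrite -[chronological]setCK; apply: measurableC; apply: sub_sigma_algebra.
  by right; split; [apply: measurableC; exact: measurable_chronological|rewrite setICl].
have arr j a : measurable ([set c : targets R | (c j).1 < a] : set GT).
  rewrite [X in measurable X](_ : _ =
    (chronological `&` [set c : targets R | (c j).1 < a]) `|`
    (~` chronological `&` [set c : targets R | (c j).1 < a])); last first.
    by rewrite -setIUl setUv setTI.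
  apply: measurableU; last first.
    apply: sub_sigma_algebra; right; split; last by rewrite setIAC setICl set0I.
    apply: measurableI; last exact: measurable_arrival_lt.
    by apply: measurableC; exact: measurable_chronological.
  have [a0|a0] := ltP a 0.
    rewrite (_ : _ `&` _ = set0)// -subset0 => c [[c0 _] /= ca].
    by have := lt_trans ca a0; rewrite ltNge c0.
  (* A chronological target [j] arrives at or after [a] exactly when the count before [a] is one of
     [0, ..., j]. *)
  rewrite (_ : _ `&` _ = chronological `&`
     ~` \bigcup_(q in `I_j.+1) (count_constraints [:: (a, q)])).
    apply: measurableI => //; apply: measurableC.
    apply: bigcup_measurable => q _; apply: sub_sigma_algebra; left.
    exists [:: (a, q)], (fun=> setT); split => //.
    - by move=> x; rewrite inE => /eqP ->.
    - by exists l.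
    - by rewrite (_ : locations_in _ = setT) ?setIT//; apply/seteqP; split.
  apply/seteqP; split => c [cc]; split => //.
    move=> [q /= qj /(_ (a, q) (mem_head _ _))/= ca].
    have /(arrival_ltP _ _ cc) := b; rewrite ca lee_fin ler_nat.
    by rewrite leqNgt qj.
  rewrite /= ltNge; apply/negP => /(arrival_ge_count cc)[q qj qE]; apply: b.
  by exists q => //= x; rewrite inE => /eqP ->.
move=> mU.
have mid : measurable_fun [set: GT] (fun c : GT => c : target_space R).
  apply: measurable_fun_targets => j.
  apply/measurable_fun_pairP; split.
    apply: (measurability _ (RGenInftyO.measurableE R)) => _ [_ [a ->] <-].
    rewrite setTI (_ : _ @^-1` _ = [set c : targets R | (c j).1 < a])//.
  by move=> _ B mB; rewrite setTI; apply: sub_sigma_algebra; exact: loc.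
by have := mid measurableT _ mU; rewrite setTI.
Qed.

(** Both sides are finite measures in [U]. They agree on the generators: by [palm_constraints], or
    because both vanish on sets that chronological configurations avoid. *)
Lemma palm_location (s0 s1 : R) j B0 (U : set (target_space R)) :
  0 <= s0 -> s0 < s1 -> measurable B0 -> measurable U ->
  P [set w | s0 <= (X j w).1 < s1 /\
             ((vacant s0 s1 j `&` U) (remove j (T w)) /\ B0 (X j w).2)] =
  ((lambda * (s1 - s0) * Phi B0)%:E * P [set w | (vacant s0 s1 j `&` U) (T w)])%E.
Proof.
move=> s00 s01 mB0 mU.
have c0 : 0 <= lambda * (s1 - s0) * Phi B0.
  apply: mulr_ge0; first by rewrite mulr_ge0 ?subr_ge0// ltW.
  by rewrite -lee_fin -(location_law HX 0 mB0).
have mrem : measurable_fun [set: Om] (fun w => remove j (T w) : target_space R).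
  exact: (measurableT_comp (measurable_remove j) measurable_targets).
have mA1 : measurable [set w | s0 <= (X j w).1 < s1 /\
    (vacant s0 s1 j (remove j (T w)) /\ B0 (X j w).2)].
  rewrite (_ : mkset _ = [set w |
    ([set c : target_space R | s0 <= (c j).1 < s1] `&`
     (remove j) @^-1` vacant s0 s1 j `&` [set c | B0 (c j).2]) (T w)]); last first.
    by apply/seteqP; split => w /=; tauto.
  apply: measurable_targets_preimage; apply: measurableI; [apply: measurableI|].
  - have := measurable_arrival j measurableT (measurable_itv `[s0, s1[).
    by rewrite setTI; congr (measurable _); apply/seteqP; split => c /=; rewrite in_itv.
  - rewrite -[X in measurable X]setTI; apply: measurable_remove => //.
    exact: measurable_vacant.
  - by rewrite -[X in measurable X]setTI; apply: measurable_location.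
have mA0 : measurable [set w | vacant s0 s1 j (T w)].
  by apply: measurable_targets_preimage; exact: measurable_vacant.
have [m1 m1E] := image_measure_exists (mrestr P mA1) mrem.
have [m2 m2E] := image_measure_exists (mrestr P mA0) (measurable_targets (X := X)).
have m1U V : P [set w | s0 <= (X j w).1 < s1 /\
    ((vacant s0 s1 j `&` V) (remove j (T w)) /\ B0 (X j w).2)] = m1 V.
  rewrite m1E/= /mrestr; congr (P _).
  by apply/seteqP; split => w /=; rewrite /setI/=; tauto.
have m2U V : P [set w | (vacant s0 s1 j `&` V) (T w)] = m2 V.
  rewrite m2E/= /mrestr; congr (P _).
  by apply/seteqP; split => w /=; rewrite /setI/=; tauto.
rewrite m1U m2U -[RHS]/(mscale (NngNum c0) m2 U).
apply: (g_sigma_algebra_measure_unique (generators j) _ (fun=> setT)).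
- exact: measurable_generators.
- move=> _; left; exists [::], (fun=> setT); split => //; first by exists j.
  by apply/esym/seteqP; split.
- by rewrite bigcup_const.
- exact: generatorsI.
- move=> C; case=> [[s [B [s'0 mB [l jl lB] ->]]]|[mC C0]].
    have := palm_constraints s00 s01 s'0 mB lB mB0 jl.
    rewrite /= /mscale/= -m1U -m2U => h.
    rewrite (_ : [set w | _] = [set w | s0 <= (X j w).1 < s1 /\
      ((vacant s0 s1 j `&` count_constraints s) (remove j (T w)) /\
       locations_in B (remove j (T w)) /\ B0 (X j w).2)]); last first.
      by apply/seteqP; split => w /=; rewrite /setI/=; tauto.
    rewrite h; congr (_ * P _)%E.
    by apply/seteqP; split => w /=; rewrite /setI/=; tauto.
  have noC c : chronological c -> ~ C c.
    by move=> cc Cc; have : (C `&` chronological) c by []; rewrite C0.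
  rewrite /= /mscale/= -m1U -m2U.
  rewrite [X in P X](_ : _ = set0); last first.
    rewrite -subset0 => w [_ [[_ /noC h] _]]; apply: h.
    exact/chronological_remove/(chronological_targets HX).
  rewrite [X in (_ * P X)%E](_ : _ = set0) ?measure0 ?mule0// -subset0 => w [_ /noC].
  by apply; exact: (chronological_targets HX).
- move=> _; rewrite -m1U; apply: (le_lt_trans (probability_le1 P _)); last by rewrite ltry.
  by have := mA1; congr (measurable _); apply/seteqP; split => w /=; rewrite /setI/=; tauto.
- exact: generate.
Qed.

End palm.

(** * Almost sure regularity of the target process *)

Section almost_sure.
Context {R : realType} {d : measure_display} {Om : measurableType d}.
Context {P : probability Om R} {lambda : R} {Q : set (plane R)} {phi : plane R -> R}.
Context {X : nat -> {RV P >-> (R * plane R)%type}}.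
Context (lambda0 : 0 < lambda).
Context (HX : target_process lambda Q phi X).

Local Notation T w := (X ^~ w : target_space R).

Lemma interval_law (s0 s1 : R) (k : nat) : 0 <= s0 -> s0 < s1 ->
  P [set w | nb_arrivals (T w) s0 s1 = k%:R%:E] =
  (poisson_pmf (lambda * (s1 - s0)) k)%:E.
Proof.
move=> s00 s01; have [_ _ h] := HX.
pose t i := s0 + i%:R * (s1 - s0).
have t0 : t 0%N = s0 by rewrite /t mul0r addr0.
have t1 : t 1%N = s1 by rewrite /t mul1r addrC subrK.
have := h 1%N 0%N t (fun=> k) (fun=> setT).
rewrite big_ord1 big_ord0 mulr1/= t0 t1.
move=> <- //; last by move=> i; rewrite /t ltrD2l ltr_pM2r ?subr_gt0// ltr_nat.
congr (P _); apply/seteqP; split => w /=.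
  by move=> ww; split => // i /=; rewrite ltnS leqn0 => /eqP ->; rewrite t0 t1.
by move=> [/(_ 0%N isT)] /=; rewrite t0 t1.
Qed.

Lemma measurable_interval_count (s0 s1 : R) x :
  measurable [set w | nb_arrivals (T w) s0 s1 = x].
Proof. exact: (measurable_targets_preimage (measurable_nb_arrivals_eq _ _ _)). Qed.

Lemma ae_finite_count (a : R) : 0 < a ->
  {ae P, forall w, exists k : nat, nb_arrivals (T w) 0 a = k%:R%:E}.
Proof.
move=> a0; pose A k := [set w | nb_arrivals (T w) 0 a = k%:R%:E].
have mA k : measurable (A k) by exact: measurable_interval_count.
have PA : P (\bigcup_k A k) = 1%E.
  rewrite measure_bigcup//; last first.
    apply/trivIsetP => i k _ _ ik; rewrite -subset0 => w [].
    by rewrite /A/= => -> [] /eqP; rewrite eqr_nat (negbTE ik).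
  have : poisson_prob (lambda * a) 0%N setT = 1%E by exact: probability_setT.
  rewrite /poisson_prob/= mulr_gt0// -nneseries_esumT; last first.
    by move=> k; rewrite lee_fin poisson_pmf_ge0.
  move=> <-; transitivity (\sum_(k <oo) P (A k))%E.
    by apply: eq_eseriesl => k; rewrite in_setT.
  apply: eq_eseriesr => k _.
  by rewrite /A interval_law// subr0.
have : P.-negligible (~` \bigcup_k A k).
  apply/negligibleP; first by apply: measurableC; exact: bigcup_measurable.
  have mU : measurable (\bigcup_k A k) by exact: bigcup_measurable.
  by apply: (eq_trans (probability_setC P mU)); rewrite PA subee.
by apply: negligibleS => w h [k _ kw]; apply: h; exists k.
Qed.

Lemma poisson_multiple_le (mu : R) : 0 < mu ->
  1 - mu ^+ 2 <= poisson_pmf mu 0 + poisson_pmf mu 1.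
Proof.
move=> mu0; rewrite /poisson_pmf mu0 fact0 (_ : 1`! = 1)%N//.
rewrite expr0 expr1 !(divr1, invr1, mulr1, mul1r).
have := expR_ge1Dx (- mu) => h.
have -> : expR (- mu) + mu * expR (- mu) = (1 + mu) * expR (- mu) by ring.
have -> : 1 - mu ^+ 2 = (1 + mu) * (1 - mu) by ring.
by rewrite ler_wpM2l// addr_ge0// ltW.
Qed.

Lemma multiple_arrivals_le (s0 s1 : R) : 0 <= s0 -> s0 < s1 ->
  (P (~` ([set w | nb_arrivals (T w) s0 s1 = 0%:R%:E] `|`
          [set w | nb_arrivals (T w) s0 s1 = 1%:R%:E])) <=
  ((lambda * (s1 - s0)) ^+ 2)%:E)%E.
Proof.
move=> s00 s01.
have m0 k : measurable [set w | nb_arrivals (T w) s0 s1 = k%:R%:E].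
  exact: measurable_interval_count.
rewrite (probability_setC P (measurableU _ _ (m0 0%N) (m0 1%N))).
rewrite measureU//; last first.
  by rewrite -subset0 => w [/= -> []] /eqP; rewrite eqr_nat.
rewrite [X in (_ - X)%E](_ : _ = (poisson_pmf (lambda * (s1 - s0)) 0 +
   poisson_pmf (lambda * (s1 - s0)) 1)%:E); last first.
  by rewrite EFinD; congr (_ + _)%E; exact: interval_law.
have := @poisson_multiple_le (lambda * (s1 - s0)).
rewrite mulr_gt0 ?subr_gt0// => /(_ isT) h.
by rewrite -EFinB lee_fin; lra.
Qed.

Lemma nb_arrivals_ge2 (c : targets R) j s t :
  s <= (c j).1 < t -> s <= (c j.+1).1 < t -> (2%:R%:E <= nb_arrivals c s t)%E.
Proof.
move=> h1 h2.
apply: (@le_trans _ _ (\sum_(0 <= i < j.+2) (((s <= (c i).1 < t)%R%:R : R)%:E))%E).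
  rewrite !big_nat_recr//= h1 h2 -addeA -[leLHS]add0e leeD//.
  by apply: sume_ge0 => i _; rewrite lee_fin.
by apply: nneseries_lim_ge => i _ _; rewrite lee_fin.
Qed.

(** Cut [[0, n + 1[] into [N + 1] equal cells. A coincidence before time [n] puts two arrivals into
    one cell for every [N], while by the union bound this has probability at most
    [(lambda * a) ^ 2 / (N + 1)]. *)
Lemma ae_strict_arrivals (n : nat) :
  {ae P, forall w, forall j, (X j w).1 < n%:R -> (X j w).1 < (X j.+1 w).1}.
Proof.
pose a := n.+1%:R : R.
pose h (N : nat) : R := a / N.+1%:R.
have h0 N : 0 < h N by rewrite divr_gt0.
pose bad N i := ~` ([set w | nb_arrivals (T w) (i%:R * h N) (i.+1%:R * h N) = 0%:R%:E] `|`
          [set w | nb_arrivals (T w) (i%:R * h N) (i.+1%:R * h N) = 1%:R%:E]).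
have mbad N i : measurable (bad N i).
  by apply: measurableC; apply: measurableU; exact: measurable_interval_count.
pose Bad N := \big[setU/set0]_(i < N.+1) bad N i.
have mBad N : measurable (Bad N) by exact: bigsetU_measurable.
have Pbad N : (P (Bad N) <= ((lambda * a) ^+ 2 / N.+1%:R)%:E)%E.
  apply: (le_trans (Boole_inequality _ _)) => //.
  apply: (@le_trans _ _ (\sum_(i < N.+1) ((lambda * h N) ^+ 2)%:E)%E).
    apply: lee_sum => i _.
    have := @multiple_arrivals_le (i%:R * h N) (i.+1%:R * h N).
    rewrite -mulrBl -natrB// subSnn mul1r; apply.
      by rewrite mulr_ge0// ltW.
    by rewrite ltr_pM2r// ltr_nat.
  rewrite sumEFin sumr_const card_ord -mulr_natl lee_fin /h.
  rewrite le_eqVlt; apply/orP; left; apply/eqP.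
  by field.
exists (\bigcap_N Bad N); split.
- exact: bigcap_measurable.
- apply/eqP; rewrite eq_le measure_ge0 andbT; apply/lee_addgt0Pr => e e0.
  rewrite add0e.
  pose N := Num.truncn ((lambda * a) ^+ 2 / e).
  apply: (@le_trans _ _ (P (Bad N))).
    apply: le_measure; rewrite ?inE//; first exact: bigcap_measurable.
    exact: bigcap_inf.
  apply: (le_trans (Pbad N)); rewrite lee_fin ler_pdivrMr// [leRHS]mulrC -ler_pdivrMr//.
  by apply/ltW; exact: truncnS_gt.
- move=> w /existsNP[j /not_implyP[jn /negP]]; rewrite -leNgt => jj N _.
  have cc := chronological_targets HX w.
  have eq_t : (X j.+1 w).1 = (X j w).1.
    by apply/eqP; rewrite eq_le jj; case: cc => _; apply.
  have t0 : 0 <= (X j w).1 by case: cc => h' _; exact: h'.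
  pose i := Num.truncn ((X j w).1 / h N).
  have iP : i%:R * h N <= (X j w).1 < i.+1%:R * h N.
    have := truncn_itv (divr_ge0 t0 (ltW (h0 N))); rewrite -/i.
    by rewrite ler_pdivlMr// ltr_pdivrMr.
  have iN : (i < N.+1)%N.
    have /andP[iP1 _] := iP; rewrite -(ltr_nat R) -(ltr_pM2r (h0 N)).
    apply: (le_lt_trans iP1); rewrite /h mulrCA divff ?mulr1; last by rewrite pnatr_eq0.
    by apply: (lt_trans jn); rewrite ltr_nat.
  rewrite /Bad (bigD1 (Ordinal iN))//=; left.
  have h2 : (2%:R%:E <= nb_arrivals (T w) (i%:R * h N) (i.+1%:R * h N))%E.
    by apply: (nb_arrivals_ge2 (j := j)); rewrite ?eq_t.
  by case=> /= hh; move: h2; rewrite hh lee_fin ler_nat.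
Qed.

(** [produces] describes the motion on regular configurations only. Arrival times are unbounded
    because the counts up to integer times are finite. *)
Lemma ae_regular : measurable Q -> {ae P, forall w, regular Q (T w)}.
Proof.
move=> mQ.
have ae1 : {ae P, forall w, forall n : nat, forall j, (X j w).1 < n%:R ->
    (X j w).1 < (X j.+1 w).1}.
  by apply/ae_foralln => n; exact: ae_strict_arrivals.
have ae2 : {ae P, forall w, forall n : nat, exists k : nat,
    nb_arrivals (T w) 0 n.+1%:R = k%:R%:E}.
  by apply/ae_foralln => n; exact: ae_finite_count.
have ae3 : {ae P, forall w, forall j, Q (X j w).2}.
  apply/ae_foralln => j.
  have mC : measurable (~` Q) by exact: measurableC.
  exists [set w | (~` Q) (X j w).2]; split => //.
  - rewrite -[X in measurable X]setTI.
    by apply: (measurableT_comp measurable_snd (measurable_funPT (X j))).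
  - by apply: (eq_trans (location_law HX j mC)); rewrite setICr Rintegral_set0.
apply: filterS3 ae1 ae2 ae3 => w h1 h2 h3.
have cc := chronological_targets HX w; split => //.
- by case: cc.
- by move=> j; apply: (h1 (Num.truncn (X j w).1).+1); rewrite truncnS_gt.
- apply/cvgryPge => A.
  have [k kE] := h2 (Num.truncn `|A|).
  exists k => // j /= kj.
  rewrite (le_trans (ler_norm A))// (le_trans (ltW (truncnS_gt _)))//.
  rewrite leNgt; apply/negP => /(arrival_ltP _ _ cc); rewrite kE lee_fin ler_nat.
  by rewrite ltnNge kj.
Qed.

End almost_sure.

(** * Palm formula for integrals *)

Lemma ge0_integral_mrestr d (T : measurableType d) (R : realType)
    (mu : {measure set T -> \bar R}) (D : set T) (mD : measurable D) (f : T -> \bar R) :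
  measurable_fun [set: T] f -> (forall x, 0 <= f x)%E ->
  (\int[mrestr mu mD]_x f x = \int[mu]_(x in D) f x)%E.
Proof.
move=> mf f0.
have mDC : measurable (~` D) by exact: measurableC.
have m0 : mrestr mu mD (~` D) = 0%E by rewrite /mrestr setICl measure0.
rewrite (ge0_negligible_integral mDC measurableT mf (fun x _ => f0 x) m0).
rewrite setTD setCK; apply: eq_measure_integral => A mA AD.
by rewrite /= /mrestr setIidl.
Qed.

Section palm_integral.
Context {R : realType} {d : measure_display} {Om : measurableType d}.
Context {P : probability Om R} {lambda : R} {Q : set (plane R)} {phi : plane R -> R}.
Context {X : nat -> {RV P >-> (R * plane R)%type}}.

Local Notation T w := (X ^~ w : target_space R).

Definition targets_rv : {mfun Om >-> target_space R} :=
  mfun_Sub (mem_set (measurable_targets (X := X))).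

Lemma measurable_location_rv j : measurable_fun [set: Om] (fun w => (X j w).2).
Proof. exact: (measurableT_comp measurable_snd (measurable_funPT (X j))). Qed.

(** All locations have the same law; target 0 represents it. *)
Definition location_rv : {mfun Om >-> plane R} :=
  mfun_Sub (mem_set (measurable_location_rv 0)).

Local Notation PT := (distribution P targets_rv).
Local Notation PL := (distribution P location_rv).

Context (lambda0 : 0 < lambda).
Context (HX : target_process lambda Q phi X).

Lemma location_lawE B : measurable B ->
  PL B = (\int[area]_(q in Q `&` B) phi q)%:E.
Proof. by move=> mB; rewrite -(location_law HX 0 mB). Qed.

Definition palm_event (s0 s1 : R) j : set Om :=
  [set w | s0 <= (X j w).1 < s1 /\ vacant s0 s1 j (remove j (T w))].

Lemma measurable_palm_event s0 s1 j : measurable (palm_event s0 s1 j).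
Proof.
rewrite (_ : palm_event _ _ _ = [set w |
  ([set c : target_space R | s0 <= (c j).1 < s1] `&`
   (remove j) @^-1` vacant s0 s1 j) (T w)])//.
apply: measurable_targets_preimage; apply: measurableI.
- have := measurable_arrival j measurableT (measurable_itv `[s0, s1[).
  by rewrite setTI; congr (measurable _); apply/seteqP; split => c /=; rewrite in_itv.
- rewrite -[X in measurable X]setTI; apply: measurable_remove => //.
  exact: measurable_vacant.
Qed.

Lemma palm_measure (s0 s1 : R) j (U : set (target_space R * plane R)) :
  0 <= s0 -> s0 < s1 -> measurable U ->
  P [set w | s0 <= (X j w).1 < s1 /\ vacant s0 s1 j (remove j (T w)) /\
             U (remove j (T w), (X j w).2)] =
  ((lambda * (s1 - s0))%:E * (PT \x PL) (U `&` (vacant s0 s1 j `*` setT)))%E.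
Proof.
move=> s00 s01 mU.
have c0 : 0 <= lambda * (s1 - s0) by rewrite mulr_ge0 ?subr_ge0// ltW.
have mrem : measurable_fun [set: Om] (fun w => remove j (T w) : target_space R).
  exact: (measurableT_comp (measurable_remove j) measurable_targets).
pose Y w : target_space R * plane R := (remove j (T w), (X j w).2).
have mY : measurable_fun [set: Om] Y.
  by apply: measurable_fun_pair => //; exact: measurable_location_rv.
have mA := measurable_palm_event s0 s1 j.
have mE : measurable (vacant s0 s1 j `*` setT : set (target_space R * plane R)).
  by apply: measurableX => //; exact: measurable_vacant.
have [m1 m1E] := image_measure_exists (mrestr P mA) mY.
have m1U V : P [set w | s0 <= (X j w).1 < s1 /\ vacant s0 s1 j (remove j (T w)) /\
             V (remove j (T w), (X j w).2)] = m1 V.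
  rewrite m1E/= /mrestr; congr (P _).
  by apply/seteqP; split => w; rewrite /setI/Y/palm_event/=; tauto.
rewrite m1U -[RHS]/(mscale (NngNum c0) (mrestr (PT \x PL)%E mE) U).
pose C : set (set (target_space R * plane R)) :=
  [set C | exists A, measurable A /\ exists B, measurable B /\ C = A `*` B].
apply: (measure_unique C (fun=> setT)) => //.
- rewrite measurable_prod_measurableType //; congr (<<s _ >>).
  rewrite predeqE; split => [[A mA' [B mB <-]]|[A [mA' [B [mB ->]]]]].
    by exists A; split => //; exists B.
  by exists A => //; exists B.
- move=> _ _ [X1 [mX1 [X2 [mX2 ->]]]] [Y1 [mY1 [Y2 [mY2 ->]]]].
  rewrite -setXI; exists (X1 `&` Y1); split; first exact: measurableI.
  by exists (X2 `&` Y2); split => //; exact: measurableI.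
- move=> _; exists setT; split => //; exists setT; split => //.
  by rewrite setXTT.
- by rewrite bigcup_const.
- move=> _ [A [mA' [B [mB ->]]]].
  have e : (PT \x PL)%E ((A `*` B) `&` (vacant s0 s1 j `*` setT)) =
      (PT (vacant s0 s1 j `&` A) * (\int[area]_(q in Q `&` B) phi q)%:E)%E.
    rewrite -setXI setIT setIC product_measure1E//; last first.
      by apply: measurableI => //; exact: measurable_vacant.
    by congr (_ * _)%E; exact: location_lawE.
  rewrite -m1U; apply/esym;
  apply: (eq_trans (congr1 (fun z : \bar R => (lambda * (s1 - s0))%:E * z)%E e)).
  rewrite [X in (_ * X)%E]muleC muleA -EFinM.
  rewrite -[LHS](palm_location lambda0 HX j s00 s01 mB mA'); congr (P _).
  by apply/seteqP; split => w; rewrite /setI/=; tauto.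
- move=> _; rewrite -m1U; apply: (le_lt_trans (probability_le1 P _)); last by rewrite ltry.
  by have := mA; congr (measurable _); apply/seteqP; split => w; rewrite /palm_event/=; tauto.
Qed.

(** A Mecke-type formula: when target [j] is alone in the window, the rest of the configuration and
    its location behave like an unconditioned configuration, restricted to [vacant], and an
    independent location. It extends [palm_measure] from sets to nonnegative functions. *)
Lemma palm_integral (s0 s1 : R) j (F : target_space R * plane R -> \bar R) :
  0 <= s0 -> s0 < s1 -> measurable_fun [set: _] F -> (forall z, 0 <= F z)%E ->
  (\int[P]_(w in palm_event s0 s1 j) F (remove j (T w), (X j w).2) =
   (lambda * (s1 - s0))%:E *
   \int[PT \x PL]_(z in vacant s0 s1 j `*` setT) F z)%E.
Proof.
move=> s00 s01 mF F0.
have c0 : 0 <= lambda * (s1 - s0) by rewrite mulr_ge0 ?subr_ge0// ltW.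
have mrem : measurable_fun [set: Om] (fun w => remove j (T w) : target_space R).
  exact: (measurableT_comp (measurable_remove j) measurable_targets).
pose Y w : target_space R * plane R := (remove j (T w), (X j w).2).
have mY : measurable_fun [set: Om] Y.
  by apply: measurable_fun_pair => //; exact: measurable_location_rv.
have mA := measurable_palm_event s0 s1 j.
have mE : measurable (vacant s0 s1 j `*` setT : set (target_space R * plane R)).
  by apply: measurableX => //; exact: measurable_vacant.
rewrite -(ge0_integral_mrestr _ mA (measurableT_comp mF mY))//; last by move=> w; exact: F0.
rewrite -[LHS](ge0_integral_pushforward mY _ measurableT mF)//.
rewrite -(ge0_integral_mrestr _ mE mF F0)//.
rewrite -[RHS](ge0_integral_mscale _ measurableT (NngNum c0) mF (fun x _ => F0 x)).
apply: eq_measure_integral => U mU _.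
rewrite [RHS]/(mscale _ _ _)/= /mscale/= /mrestr.
rewrite -[RHS](palm_measure j s00 s01 mU) /pushforward; congr (P _).
by apply/seteqP; split => w; rewrite /setI/Y/palm_event/=; tauto.
Qed.

End palm_integral.

(** The true values form an initial segment, so their number is itself a place where [b] holds. Thus
    the number of windows waited is a length for which the target stays uncovered. *)
Lemma sum_antitone_bool (b : nat -> bool) (n : nat) :
  (forall l, b l.+1 -> b l) ->
  let q := (\sum_(l < n) b l.+1)%N in q = 0%N \/ b q.
Proof.
move=> bS /=; elim: n => [|n ih]; first by left; rewrite big_ord0.
rewrite big_ord_recr/=; case bn: (b n.+1); last by rewrite addn0.
right; have bl l : (l <= n)%N -> b l.+1.
  move=> ln; have -> : l = (n - (n - l))%N by rewrite subKn.
  elim: (n - l)%N => [|i ihi]; first by rewrite subn0.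
  have [ni|ni] := leqP n i.
    by rewrite (eqP (_ : n - i.+1 == 0)%N) ?subn_eq0 ?leqW// in ihi *; rewrite (eqP (_ : n - i == 0)%N) ?subn_eq0// in ihi.
  by apply: bS; rewrite subnSK.
rewrite (eq_bigr (fun=> 1%N)) ?sum1_card ?card_ord ?addn1//.
by move=> i _; rewrite bl// ltnW.
Qed.

Lemma enormD {R : realType} (a b : plane R) : enorm (a + b) <= enorm a + enorm b.
Proof.
rewrite enorm_le ?addr_ge0 ?enorm_ge0// [leRHS]sqrrD !sqr_enorm /=.
have := dot_le_enorm a b.
rewrite -subr_ge0 => h.
rewrite -subr_ge0.
rewrite (_ : _ - _ = 2 * (enorm a * enorm b - (a.1 * b.1 + a.2 * b.2))); last by ring.
by rewrite mulr_ge0.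
Qed.

Lemma measure_bigsetU_le d (T : measurableType d) (R : realType)
    (mu : {measure set T -> \bar R}) (I : Type) (s : seq I) (F : I -> set T) (x : R) :
  (forall i, measurable (F i)) -> (forall i, mu (F i) <= x%:E)%E ->
  (mu (\big[setU/set0]_(i <- s) F i) <= ((size s)%:R * x)%:E)%E.
Proof.
move=> mF Fx; elim: s => [|i s ih]; first by rewrite big_nil measure0 mul0r.
have mU : measurable (\big[setU/set0]_(i <- s) F i) by exact: bigsetU_measurable.
rewrite big_cons /= -natr1 mulrDl mul1r addrC EFinD.
by apply: (le_trans (measureU2 _ (mF i) mU)); apply: leeD; [exact: Fx|exact: ih].
Qed.

(** * Waiting of a test target *)

Section waiting.
Context {R : realType}.
Implicit Types (G : nat -> set (target_space R * plane R)).

Definition uncovered_for G (k L : nat) : set (target_space R * plane R) :=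
  ~` \bigcup_(l in `I_L.+1) G (k + l)%N.

Lemma measurable_uncovered_for G k L : (forall k, measurable (G k)) ->
  measurable (uncovered_for G k L).
Proof. by move=> mG; apply: measurableC; apply: bigcup_measurable. Qed.

(* When [G k] is the region that the agents come close to during the [k]-th
   time window: the number of full windows, capped by [M q], that a test
   target at [q] generated in window [k] has to wait. *)
Definition waiting_windows G (M : plane R -> nat) (Mb k : nat)
    (z : target_space R * plane R) : nat :=
  \sum_(L < Mb) ((L.+1 <= M z.2)%N && (z \in uncovered_for G k L.+1)).

End waiting.

Section covering.
Context {R : realType} {m : nat} {Q : set (plane R)} {v r : R} {shares : rel 'I_m}.
Context {pol : policy R m} {p : targets R -> paths R m}.
Context (r_gt0 : 0 < r) (v_gt0 : 0 < v) (mQ : measurable Q).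
Context (adm : admissible Q v shares pol) (prod : produces Q r pol p).
Context (dt : R) (N : nat) (dt_gt0 : 0 < dt) (N_gt0 : (0 < N)%N).

(** Set to the default point off the regular configurations, so as to be measurable and Lipschitz in
    time on the whole space. *)
Definition regular_motion (c : target_space R) (i : 'I_m) (t : R) : plane R :=
  ((fun c => p c i t) \_ (regular Q)) c.

Lemma regular_motionE c i t : regular Q c -> regular_motion c i t = p c i t.
Proof. by move=> rc; rewrite /regular_motion patchE mem_set. Qed.

Lemma measurable_regular_motion i t : 0 <= t ->
  measurable_fun [set: target_space R] (fun c => regular_motion c i t).
Proof.
move=> t0; have [_ /(_ i t t0) mp] := prod.
exact/(measurable_restrictT _ (measurable_regular mQ)).
Qed.

Lemma regular_motion_lipschitz c i s t : 0 <= s -> s <= t ->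
  enorm (regular_motion c i t - regular_motion c i s) <= v * (t - s).
Proof.
move=> s0 st; rewrite /regular_motion !patchE; case: ifPn => cr; last first.
  rewrite subrr /enorm/= expr0n addr0 sqrtr0.
  by rewrite mulr_ge0 ?subr_ge0// ltW.
have [/(_ c (set_mem cr) t (le_trans s0 st)) [cl _] _] := prod.
exact: (closed_loop_lipschitz _ (ltW v_gt0) adm cl).
Qed.

Definition sample_time (k l : nat) : R := k%:R * dt + l%:R * (dt / N%:R).

Lemma sample_time_ge0 k l : 0 <= sample_time k l.
Proof. by rewrite addr_ge0// mulr_ge0// ?divr_ge0// ltW. Qed.

(** Enlarging [r] by the distance travelled between two samples lets finitely many disks cover all
    that comes within [r] of an agent during the window. *)
Definition cover_radius : R := r + v * (dt / N%:R).

Lemma cover_radius_ge0 : 0 <= cover_radius.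
Proof. by rewrite addr_ge0// ?mulr_ge0// ?divr_ge0// ltW. Qed.

Definition cover_set (k : nat) : set (target_space R * plane R) :=
  [set z | exists i l, (l <= N)%N /\
     disk cover_radius (regular_motion z.1 i (sample_time k l)) z.2].

Lemma measurable_cover_set k : measurable (cover_set k).
Proof.
rewrite (_ : cover_set k = \bigcup_(i in [set: 'I_m]) \bigcup_(l in `I_N.+1)
  [set z | disk cover_radius (regular_motion z.1 i (sample_time k l)) z.2]); last first.
  apply/seteqP; split => z.
    by move=> [i [l [lN h]]]; exists i => //; exists l.
  by move=> [i _ [l lN h]]; exists i, l.
apply: fin_bigcup_measurable => // i _; apply: fin_bigcup_measurable => // l _.
have mrm := measurable_regular_motion i (sample_time_ge0 k l).
have mf : measurable_fun [set: target_space R * plane R]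
    (fun z => enorm (regular_motion z.1 i (sample_time k l) - z.2)).
  apply: (measurableT_comp measurable_enorm).
  have m1 := measurableT_comp mrm (@measurable_fst _ _ (target_space R) (plane R)).
  apply: (eq_measurable_fun (fun z : target_space R * plane R =>
    ((regular_motion z.1 i (sample_time k l)).1 - z.2.1,
     (regular_motion z.1 i (sample_time k l)).2 - z.2.2))) => //.
  apply: measurable_fun_pair.
    apply: measurable_funB; first exact: (measurableT_comp measurable_fst m1).
    exact: (measurableT_comp measurable_fst measurable_snd).
  apply: measurable_funB; first exact: (measurableT_comp measurable_snd m1).
  exact: (measurableT_comp measurable_snd measurable_snd).
have := mf measurableT `]-oo, cover_radius]%classic (measurable_itv _).
by rewrite setTI; congr (measurable _); apply/seteqP; split => q /=; rewrite in_itv.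
Qed.

Definition cover_area : R :=
  m%:R * (4 * cover_radius ^+ 2 + 2 * cover_radius * v * dt).

Lemma area_cover_set_le k c : (area (xsection (cover_set k) c) <= cover_area%:E)%E.
Proof.
pose D i := \bigcup_(l in `I_N.+1)
  disk cover_radius (regular_motion c i (sample_time k l)).
have mD i : measurable (D i).
  by apply: bigcup_measurable => l _; exact: measurable_disk.
have -> : xsection (cover_set k) c = \big[setU/set0]_(i < m) D i.
  rewrite -bigcup_seq; apply/seteqP; split => q; rewrite /xsection/= inE/=.
    by move=> [i [l [lN h]]]; exists i; [exact: mem_index_enum|exists l].
  by move=> [i _ [l lN h]]; exists i, l.
have Dle i : (area (D i) <= (4 * cover_radius ^+ 2 + 2 * cover_radius * v * dt)%:E)%E.
  have -> : 4 * cover_radius ^+ 2 + 2 * cover_radius * v * dt =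
      4 * cover_radius ^+ 2 + N%:R * (2 * cover_radius * (v * (dt / N%:R))).
    have N0 : N%:R != 0 :> R by rewrite pnatr_eq0 -lt0n.
    by field.
  apply: area_sausage_le; first exact: cover_radius_ge0.
  move=> l lN; apply: (le_trans (regular_motion_lipschitz _ _ (sample_time_ge0 _ _) _)).
    by rewrite lerD2l ler_wpM2r ?ler_nat// divr_ge0// ltW.
  rewrite ler_wpM2l ?(ltW v_gt0)// /sample_time opprD addrACA subrr add0r.
  by rewrite -mulrBl -natrB// subSnn mul1r.
apply: le_trans (measure_bigsetU_le (index_enum 'I_m) _ Dle) _; first exact: mD.
by rewrite /index_enum -enumT -cardE card_ord.
Qed.

Lemma cover_setP c k i t q : regular Q c ->
  k%:R * dt <= t <= k.+1%:R * dt -> enorm (p c i t - q) <= r -> cover_set k (c, q).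
Proof.
move=> rc /andP[kt tk] ptq.
have d0 : 0 < dt / N%:R by rewrite divr_gt0// ltr0n.
pose l := Num.truncn ((t - k%:R * dt) / (dt / N%:R)).
have /andP[l1 l2] : l%:R * (dt / N%:R) <= t - k%:R * dt < l.+1%:R * (dt / N%:R).
  rewrite -ler_pdivlMr// -ltr_pdivrMr//; apply: truncn_itv.
  by rewrite divr_ge0 ?subr_ge0// ltW.
have lN : (l <= N)%N.
  rewrite -(ler_nat R) -(ler_pM2r d0) (le_trans l1)//.
  rewrite mulrCA divff ?mulr1; last by rewrite pnatr_eq0 -lt0n.
  by rewrite lerBlDl (le_trans tk)// -natr1 mulrDl mul1r.
exists i, l; split => //; rewrite /disk/=.
have st : sample_time k l <= t by rewrite /sample_time -lerBrDl.
have := regular_motion_lipschitz c i (sample_time_ge0 k l) st.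
rewrite !(regular_motionE _ _ rc) => h.
have -> : p c i (sample_time k l) - q =
    - (p c i t - p c i (sample_time k l)) + (p c i t - q).
  by rewrite opprB addrA subrK.
apply: (le_trans (enormD _ _)); rewrite enormN addrC /cover_radius lerD//.
apply: (le_trans h); rewrite ler_wpM2l ?(ltW v_gt0)//.
rewrite -natr1 mulrDl mul1r in l2.
by rewrite /sample_time opprD addrA lerBlDl ltW.
Qed.

(** The agents stay away until [(k + L + 1) * dt], and the target was generated before
    [(k + 1) * dt]; only the [L] full windows in between are counted. *)
Lemma system_time_uncovered c j k L : regular Q c ->
  k%:R * dt <= (c j).1 < k.+1%:R * dt ->
  uncovered_for cover_set k L (remove j c, (c j).2) ->
  ((L%:R * dt)%:E <= system_time c (p c) j)%E.
Proof.
move=> rc /andP[kj jk] unc.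
have rc' := regular_remove j rc.
apply: (@le_trans _ _ ((k + L.+1)%:R * dt - (c j).1)%:E).
  by rewrite lee_fin -addSnnS natrD mulrDl; lra.
apply: (system_time_ge r_gt0 adm prod rc); first by rewrite mulr_ge0// ltW.
move=> i t /andP[jt tT]; rewrite ltNge; apply/negP => near_j.
have t0 : 0 <= t by rewrite (le_trans _ jt)//; case: rc.
(* The minimum matters only at the final instant, which belongs to the next window but is also the
   closed right end of window [k + L]. *)
pose l := minn (Num.truncn (t / dt) - k) L.
have /andP[l1 l2] : (Num.truncn (t / dt))%:R * dt <= t < (Num.truncn (t / dt)).+1%:R * dt.
  rewrite -ler_pdivlMr// -ltr_pdivrMr//; apply: truncn_itv.
  by rewrite divr_ge0// ltW.
set q := Num.truncn _ in l l1 l2.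
have kq : (k <= q)%N.
  by rewrite -ltnS -(ltr_nat R) -(ltr_pM2r dt_gt0) (le_lt_trans _ l2)// (le_trans kj).
apply: unc; exists l; first by rewrite /= ltnS geq_minr.
apply: (cover_setP (i := i) (t := t)) => //.
have [qL|qL] := leqP (q - k) L.
  by rewrite /l (minn_idPl qL) subnKC// l1 ltW.
rewrite /l (minn_idPr (ltnW qL)); apply/andP; split; last by rewrite -addnS.
rewrite (le_trans _ l1)// ler_wpM2r ?(ltW dt_gt0)// ler_nat; lia.
Qed.

Lemma waiting_windows_le_system_time M Mb c j k : regular Q c ->
  k%:R * dt <= (c j).1 < k.+1%:R * dt ->
  (((waiting_windows cover_set M Mb k (remove j c, (c j).2))%:R * dt)%:E <=
   system_time c (p c) j)%E.
Proof.
move=> rc jk; rewrite /waiting_windows /=.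
pose b L := (L <= M (c j).2)%N && ((remove j c, (c j).2) \in uncovered_for cover_set k L).
have [L|->|/andP[_]] := @sum_antitone_bool b Mb _.
- move=> /andP[LM]; rewrite !inE => h; apply/andP; split; first exact: ltnW.
  rewrite inE => -[l /= lL hl]; apply: h; exists l => //=.
  by rewrite (leq_trans lL).
- rewrite mul0r; apply: le_ereal_inf_tmp => _ [s [s0 _] <-].
  by rewrite lee_fin.
- by rewrite inE; exact: system_time_uncovered.
Qed.

End covering.


(** * Total wait of the targets generated in the first windows *)

(** For each [L], a window with [g] spoils at most [L + 2] starting windows. Summing over the
    starting windows first charges a covered point the whole sum of the [L + 2], about half the
    square of its own cap [M]. Estimating each starting window alone would give a sum of suprema
    over locations instead, too large when the cap varies. *)
Lemma sum_missed_le (g : nat -> bool) M Mb K : (M <= Mb)%N ->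
  (\sum_(k < K) \sum_(L < Mb) ((L < M)%N && [exists l : 'I_L.+2, g (k + l)%N]) <=
   (\sum_(L < M) L.+2) * \sum_(k < K + Mb) g k)%N.
Proof.
move=> MMb; rewrite exchange_big/= (big_ord_widen _ (fun L => L.+2) MMb) big_distrl/=.
rewrite [leqRHS]big_mkcond/=; apply: leq_sum => L _.
case: ifPn => LM; last first.
  by rewrite big1// => k _; rewrite ?(negbTE LM).
have shift l : (l < L.+2)%N -> (\sum_(k < K) g (k + l) <= \sum_(k < K + Mb) g k)%N.
  move=> lL; have lMb : (l <= Mb)%N by apply: leq_trans (leq_trans LM MMb).
  rewrite -(big_mkord xpredT (fun k => g (k + l)%N : nat)).
  rewrite -(big_mkord xpredT (fun k => g k : nat)).
  rewrite [leqRHS](@big_cat_nat _ _ _ l)//=; last by lia.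
  apply: leq_trans (leq_addl _ _).
  rewrite -{2}[l]add0n big_addn [leqRHS](@big_cat_nat _ _ _ K)//=; last by lia.
  exact: leq_addr.
apply: (@leq_trans (\sum_(k < K) \sum_(l < L.+2) g (k + l))%N).
  apply: leq_sum => k _; rewrite ?LM /=.
  case: existsP => [[l gl]|//]; rewrite (bigD1 l)//= gl; exact: leq_addr.
rewrite exchange_big/= -[X in (X * _)%N](card_ord L.+2) -sum_nat_const.
by apply: leq_sum => l _; exact: shift.
Qed.
Section window_estimate.
Context {R : realType} {d : measure_display} {Om : measurableType d}.
Context {P : probability Om R} {lambda : R} {Q : set (plane R)} {phi : plane R -> R}.
Context {X : nat -> {RV P >-> (R * plane R)%type}}.
Context (lambda0 : 0 < lambda) (HX : target_process lambda Q phi X).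
Context (mQ : measurable Q).
Context (G : nat -> set (target_space R * plane R)) (a : R).
Context (mG : forall k, measurable (G k)).
Context (areaG : forall k c, (area (xsection (G k) c) <= a%:E)%E).
Context (wt : plane R -> R) (mwt : measurable_fun [set: plane R] wt).
Context (wt_ge0 : forall q, 0 <= wt q).
Context (M : plane R -> nat) (Mb : nat) (mM : measurable_fun [set: plane R] M).
Context (MMb : forall q, (M q <= Mb)%N).
Context (dt : R) (dt_gt0 : 0 < dt).
Context (B C : R) (C_ge0 : 0 <= C).

Local Notation T w := (X ^~ w : target_space R).
Local Notation TX := (target_space R * plane R)%type.
Local Notation PT := (distribution P (targets_rv (X := X))).
Local Notation PL := (distribution P (location_rv (X := X))).
Local Notation Pi := (PT \x PL)%E.

Context (BE : (\int[PL]_q (wt q * ((M q)%:R * dt))%:E = B%:E)%E).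
Context (CE : forall S, measurable S ->
  (\int[PL]_(q in S) (wt q * ((\sum_(L < M q) L.+2)%N%:R * dt))%:E <= C%:E * area S)%E).

Let tau k : R := k%:R * dt.
Let V j k : set (target_space R) := vacant (tau k) (tau k.+1) j.

Let a_ge0 : 0 <= a.
Proof. by have := le_trans (measure_ge0 _ _) (areaG 0 point); rewrite lee_fin. Qed.

Let tauS k : tau k < tau k.+1.
Proof. by rewrite ltr_pM2r// ltr_nat. Qed.

Let tau_ge0 k : 0 <= tau k.
Proof. by rewrite mulr_ge0// ltW. Qed.

Let mV j k : measurable (V j k).
Proof. exact: measurable_vacant. Qed.

(** The grid is [0], [tau k], [tau k.+1], with counts [j] and 0. Its points are distinct only for
    [k > 0], so that window 0 is left out of the sums below. *)
Let vacant_law j k : (0 < k)%N ->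
  PT (V j k) = (expR (- (lambda * dt)) * poisson_pmf (lambda * tau k) j)%:E.
Proof.
move=> k0; pose t i := if i is i'.+1 then tau (k + i') else 0.
have tk0 : 0 < tau k by rewrite mulr_gt0// ltr0n.
have tS i : t i < t i.+1.
  by case: i => [|i] /=; rewrite ?addn0// addnS.
have := @grid_law _ _ _ _ _ _ _ _ HX t 2 (fun i => if i is 0%N then j else 0%N)
  (fun=> setT) 0 erefl tS (fun=> measurableT) (fun _ _ => erefl).
rewrite !big_ord_recl !big_ord0 !mulr1 /= addn0 addn1 subr0 => h.
have -> : expR (- (lambda * dt)) = poisson_pmf (lambda * (tau k.+1 - tau k)) 0.
  rewrite /tau -mulrBl -natrB// subSnn mul1r /poisson_pmf mulr_gt0//.
  by rewrite expr0 fact0 invr1 !mul1r.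
rewrite mulrC -h /distribution/pushforward; congr (P _); apply/seteqP; split => w /=.
  move=> vw; split; last by [].
  have h1 := vw (tau k, j) (mem_head _ _).
  have h2 : nb_arrivals (T w) 0 (tau k.+1) = j%:R%:E.
    by apply: (vw (tau k.+1, j)); rewrite !inE eqxx orbT.
  move=> [|[|//]] _ /=; rewrite ?addn0 ?addn1//.
  move: h2; rewrite (nb_arrivalsD _ (tau_ge0 k) (ltW (tauS k))) h1.
  by move=> /(congr1 (fun z => (z - j%:R%:E)%E)); rewrite addeAC subee// add0e.
move=> [cw _] x; rewrite !inE => /orP[|] /eqP ->.
  by have := cw 0%N isT; rewrite /= addn0.
have := cw 0%N isT; have := cw 1%N isT; rewrite /= addn0 addn1 => h1 h2.
by rewrite (nb_arrivalsD _ (tau_ge0 k) (ltW (tauS k))) h1 h2 adde0.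
Qed.

Let waiting k z := waiting_windows G M Mb k z.

Let missed k (z : TX) : nat :=
  (\sum_(L < Mb) ((L < M z.2)%N && [exists l : 'I_L.+2, z \in G (k + l)%N]))%N.

Let waiting_missed k z : (waiting k z + missed k z)%N = M z.2.
Proof.
rewrite /waiting/missed -big_split/= -[RHS]card_ord -sum1_card.
rewrite (big_ord_widen _ (fun=> 1%N) (MMb z.2)) [RHS]big_mkcond/=.
apply: eq_bigr => L _; case: ifPn => //= LM.
suff -> : (z \in uncovered_for G k L.+1) = ~~ [exists l : 'I_L.+2, z \in G (k + l)%N].
  by case: [exists _, _].
apply/idP/existsPn.
  rewrite inE => h l; apply/negP; rewrite inE => gl; apply: h.
  by exists l => //=; exact: ltn_ord.
move=> h; rewrite inE => -[l /= lL gl].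
by have := h (Ordinal lL); rewrite /= mem_set.
Qed.

Let sum_missed K z :
  (\sum_(k < K) missed k.+1 z <=
   (\sum_(L < M z.2) L.+2) * \sum_(k < K + Mb) (z \in G k.+1))%N.
Proof.
exact: (@sum_missed_le (fun k => z \in G k.+1) _ _ K (MMb z.2)).
Qed.

Let measurable_mem_nat dd (Y : measurableType dd) (A : set Y) : measurable A ->
  measurable_fun [set: Y] (fun y => (y \in A)%:R : R).
Proof. by move=> mA; exact: measurable_indic. Qed.

Let measurable_waiting k : measurable_fun [set: TX] (fun z => (waiting k z)%:R : R).
Proof.
rewrite (_ : (fun z => _) = (fun z : TX => \sum_(L < Mb)
   (z \in [set z : TX | (L.+1 <= M z.2)%N] `&` uncovered_for G k L.+1)%:R)); last first.
  apply/funext => z; rewrite /waiting/waiting_windows natr_sum.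
  by apply: eq_bigr => L _; rewrite in_setI; congr ((_ && _)%:R); apply/idP/idP; rewrite inE.
apply: measurable_sum => L; apply: measurable_mem_nat; apply: measurableI.
  have mM2 := measurableT_comp mM (@measurable_snd _ _ (target_space R) (plane R)).
  have := mM2 measurableT [set k | (L.+1 <= k)%N] Logic.I.
  by rewrite setTI.
exact: measurable_uncovered_for.
Qed.

Let F k (z : TX) : \bar R := (wt z.2 * ((waiting k z)%:R * dt))%:E.
Let H k (z : TX) : \bar R := (wt z.2 * ((missed k z)%:R * dt))%:E.

Let mwt2 : measurable_fun [set: TX] (fun z => wt z.2).
Proof. exact: (measurableT_comp mwt measurable_snd). Qed.

Let mM2 : measurable_fun [set: TX] (fun z => (M z.2)%:R : R).
Proof.
apply: (@measurableT_comp _ _ _ _ _ _ (fun n : nat => n%:R : R)) => //.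
exact: (measurableT_comp mM measurable_snd).
Qed.

Let mF k : measurable_fun [set: TX] (F k).
Proof.
by apply/measurable_EFinP; apply: measurable_funM => //; exact: measurable_funM.
Qed.

Let measurable_missed k : measurable_fun [set: TX] (fun z => (missed k z)%:R : R).
Proof.
rewrite (_ : (fun z => _) = (fun z : TX => (M z.2)%:R - (waiting k z)%:R)).
  exact: measurable_funB.
by apply/funext => z; rewrite -(waiting_missed k z) natrD addrAC subrr add0r.
Qed.

Let mH k : measurable_fun [set: TX] (H k).
Proof.
by apply/measurable_EFinP; apply: measurable_funM => //; exact: measurable_funM.
Qed.

Let F_ge0 k z : (0 <= F k z)%E.
Proof. by rewrite lee_fin !mulr_ge0// ltW. Qed.

Let H_ge0 k z : (0 <= H k z)%E.
Proof. by rewrite lee_fin !mulr_ge0// ltW. Qed.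

Let V_disjoint k : trivIset setT (V^~ k).
Proof.
apply/trivIsetP => i j _ _ ij; rewrite -subset0 => c [ci cj].
have := ci (tau k, i) (mem_head _ _); rewrite (cj (tau k, j) (mem_head _ _)).
by move=> [] /eqP; rewrite eqr_nat eq_sym (negbTE ij).
Qed.

(** The cap [M] splits into windows waited and windows missed. On the vacant events the
    configuration is independent of the test location, so the cap integrates to a product; the
    missed part is enlarged to all configurations. *)
Let window_split n k : (0 < k)%N ->
  ((\sum_(j < n) expR (- (lambda * dt)) * poisson_pmf (lambda * tau k) j)%:E * B%:E <=
   \sum_(j < n) \int[Pi]_(z in V j k `*` setT) F k z + \int[Pi]_z H k z)%E.
Proof.
move=> k0; pose W := \big[setU/set0]_(j < n) V j k.
have mW : measurable W by exact: bigsetU_measurable.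
pose VT j : set TX := V j k `*` setT.
have mVT j : measurable (VT j) by exact: measurableX.
have tVT : trivIset setT VT.
  apply/trivIsetP => i j _ _ ij; rewrite /VT -setXI setIT.
  by have /trivIsetP -> // := @V_disjoint k; rewrite set0X.
have WT : W `*` setT = \big[setU/set0]_(j < n) VT j.
  rewrite /W -!bigcup_mkord; apply/seteqP; split => z.
    by move=> [[j jn h] _]; exists j.
  by move=> [j jn [h _]]; split => //; exists j.
have <- : (\int[Pi]_(z in W `*` setT) F k z =
    \sum_(j < n) \int[Pi]_(z in V j k `*` setT) F k z)%E.
  rewrite WT -(big_mkord xpredT VT).
  rewrite -(big_mkord xpredT (fun j => \int[Pi]_(z in V j k `*` setT) F k z)%E).
  apply: ge0_integral_bigsetU => //; first exact: iota_uniq.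
  - by apply: sub_trivIset tVT.
  - by apply: measurable_funTS.
have PW : PT W = (\sum_(j < n) expR (- (lambda * dt)) * poisson_pmf (lambda * tau k) j)%:E.
  rewrite -sumEFin /W measure_bigsetU.
  - by apply: eq_bigr => j _; exact: vacant_law.
  - by move=> j; exact: mV.
  - exact: V_disjoint.
rewrite -PW.
have mWT : measurable (W `*` setT : set TX) by exact: measurableX.
have mb : measurable_fun [set: TX] (fun z : TX => (wt z.2 * ((M z.2)%:R * dt))%:E).
  by apply/measurable_EFinP; apply: measurable_funM => //; exact: measurable_funM.
have b_ge0 q : 0 <= wt q * ((M q)%:R * dt) by rewrite !mulr_ge0// ltW.
have -> : (PT W * B%:E = \int[Pi]_(z in W `*` setT) (wt z.2 * ((M z.2)%:R * dt))%:E)%E.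
  rewrite integral_mkcond fubini_tonelli1; last 2 first.
  - exact/(measurable_restrictT _ mWT)/measurable_funTS.
  - by move=> z; rewrite patchE; case: ifP => // _; rewrite lee_fin.
  rewrite (eq_integral (fun c : target_space R => B%:E * (\1_W c)%:E)%E); last first.
    move=> c _; rewrite /fubini_F indicE; have [cW|cW] := boolP (c \in W).
      rewrite mule1 -BE; apply: eq_integral => q _.
      by rewrite patchE mem_set//; split => //; exact: set_mem.
    rewrite mule0; apply: integral0_eq => q _.
    rewrite patchE; case: ifPn => //; rewrite inE => -[/= cW' _].
    by move: cW; rewrite mem_set.
  rewrite ge0_integralZl//; last 2 first.
  - exact/measurable_EFinP/measurable_indic.
  - by rewrite -BE; apply: integral_ge0 => q _; rewrite lee_fin.
  by rewrite integral_indic// setIT muleC.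
rewrite (eq_integral (fun z => F k z + H k z)%E); last first.
  move=> z _; rewrite /F/H -EFinD -(waiting_missed k z) natrD; congr (_%:E); ring.
rewrite ge0_integralD//; last 2 first.
- exact: measurable_funTS.
- exact: measurable_funTS.
by apply: leeD => //; apply: ge0_subset_integral => //.
Qed.

(** Here independence pays off: with the configuration frozen, the regions [G k] are fixed sets of
    area at most [a], and integrating the charge of a point over each costs at most [C * a]. *)
Let sum_missed_integral K :
  (\sum_(k < K) \int[Pi]_z H k.+1 z <= (C * a * (K + Mb)%:R)%:E)%E.
Proof.
pose D q : R := wt q * ((\sum_(L < M q) L.+2)%N%:R * dt).
have D_ge0 q : 0 <= D q by rewrite /D !mulr_ge0// ltW.
have mD : measurable_fun [set: plane R] D.
  apply: measurable_funM => //; apply: measurable_funM => //.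
  exact: (@measurableT_comp _ _ _ _ _ _ (fun n : nat => (\sum_(L < n) L.+2)%N%:R : R)).
have mD2 : measurable_fun [set: TX] (fun z => D z.2).
  exact: (measurableT_comp mD measurable_snd).
rewrite -ge0_integral_sum//.
apply: (@le_trans _ _ (\int[Pi]_z (\sum_(k < K + Mb) (D z.2 * (z \in G k.+1)%:R)%:E))%E).
  apply: ge0_le_integral => //.
  - by move=> z _; apply: sume_ge0 => k _; exact: H_ge0.
  - by apply: emeasurable_sum => k; exact: mH.
  - apply: emeasurable_sum => k; apply/measurable_EFinP/measurable_funM => //.
    exact: measurable_mem_nat.
  - move=> z _; rewrite !sumEFin lee_fin.
    have -> : \sum_(k < K) wt z.2 * ((missed k.+1 z)%:R * dt) =
        wt z.2 * ((\sum_(k < K) missed k.+1 z)%N%:R * dt).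
      by rewrite natr_sum mulr_suml mulr_sumr.
    have -> : \sum_(k < K + Mb) D z.2 * (z \in G k.+1)%:R =
        wt z.2 * (((\sum_(L < M z.2) L.+2) * \sum_(k < K + Mb) (z \in G k.+1))%N%:R * dt).
      by rewrite -mulr_sumr -natr_sum natrM /D; ring.
    by rewrite ler_wpM2l// ler_wpM2r ?(ltW dt_gt0)// ler_nat sum_missed.
rewrite ge0_integral_sum//; last 2 first.
- move=> k; apply/measurable_EFinP/measurable_funM => //.
  exact: measurable_mem_nat.
- by move=> k z _; rewrite lee_fin mulr_ge0.
apply: (@le_trans _ _ (\sum_(k < K + Mb) (C * a)%:E)%E).
  apply: lee_sum => k _.
  have mDG : measurable_fun [set: TX] (fun z => (D z.2 * (z \in G k.+1)%:R)%:E).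
    by apply/measurable_EFinP/measurable_funM => //; exact: measurable_mem_nat.
  rewrite fubini_tonelli1//; last by move=> z; rewrite lee_fin mulr_ge0.
  rewrite -[leRHS]mule1 -(probability_setT PT) -integral_cst//.
  apply: ge0_le_integral => //.
  - by move=> c _; apply: integral_ge0 => q _; rewrite lee_fin mulr_ge0.
  - by apply: measurable_fun_fubini_tonelli_F => // z; rewrite lee_fin mulr_ge0.
  - move=> c _; rewrite /fubini_F.
    apply: (@le_trans _ _ (C%:E * area (xsection (G k.+1) c))%E); last first.
      by rewrite EFinM lee_wpmul2l// lee_fin.
    apply: le_trans (CE (measurable_xsection c (mG k.+1))).
    rewrite [leRHS]integral_mkcond le_eqVlt; apply/orP; left; apply/eqP.
    apply: eq_integral => q _; rewrite patchE mem_xsection.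
    by case: (_ \in _); rewrite ?mulr1 ?mulr0.
by rewrite sumEFin sumr_const card_ord mulr_natr.
Qed.

Let E j k : set Om := palm_event (X := X) (tau k) (tau k.+1) j.

Let mE j k : measurable (E j k).
Proof. exact: measurable_palm_event. Qed.

Let Rg : set Om := [set w | regular Q (T w)].

Let mRg : measurable Rg.
Proof. exact: (measurable_targets_preimage (measurable_regular mQ)). Qed.

Let E_disjoint j k k' w : E j k w -> E j k' w -> k = k'.
Proof. by move=> [h _] [h' _]; exact: (@in_cell _ tau _ k k' tauS h h'). Qed.

(** A measurable lower bound for the wait of target [j], zero unless the configuration is regular
    and the target is alone in one of the windows [1, ..., K]; at most one term is nonzero. *)
Definition minorant K j w : R :=
  \sum_(k < K) (w \in E j k.+1 `&` Rg)%:R *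
    ((waiting k.+1 (remove j (T w), (X j w).2))%:R * dt).

Lemma minorant_cases K j w : minorant K j w = 0 \/
  exists2 k, (E j k `&` Rg) w &
    minorant K j w = (waiting k (remove j (T w), (X j w).2))%:R * dt.
Proof.
have [[k wk]|no] := pselect (exists k : 'I_K, (E j k.+1 `&` Rg) w); [right|left].
  exists k.+1 => //; rewrite /minorant (bigD1 k)//= mem_set// mul1r big1 ?addr0// => i ik.
  rewrite memNset ?mul0r// => -[Ei _]; case: wk => Ek _.
  by move: ik; rewrite -val_eqE/=; have [->] := E_disjoint Ei Ek; rewrite eqxx.
rewrite /minorant big1// => k _; rewrite memNset ?mul0r// => wk.
by apply: no; exists k.
Qed.

Lemma minorant_ge0 K j w : 0 <= minorant K j w.
Proof. by apply: sumr_ge0 => k _; rewrite !mulr_ge0// ltW. Qed.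

Lemma minorant_le_cap K j w : minorant K j w <= Mb%:R * dt.
Proof.
have [->|[k _ ->]] := minorant_cases K j w; first by rewrite mulr_ge0// ltW.
rewrite ler_wpM2r ?(ltW dt_gt0)// ler_nat (leq_trans _ (MMb (X j w).2))//.
by rewrite -(waiting_missed k (remove j (T w), (X j w).2)) leq_addr.
Qed.

Lemma minorant_le K j w (S : \bar R) : (0 <= S)%E ->
  (regular Q (T w) -> forall k : nat, k%:R * dt <= (X j w).1 < k.+1%:R * dt ->
    (((waiting_windows G M Mb k (remove j (T w), (X j w).2))%:R * dt)%:E <= S)%E) ->
  ((minorant K j w)%:E <= S)%E.
Proof.
move=> S0 hS; have [->//|[k [[tj _] rw] ->]] := minorant_cases K j w.
exact: hS.
Qed.

Let Y j w : TX := (remove j (T w), (X j w).2).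

Let mY j : measurable_fun [set: Om] (Y j).
Proof.
have mrem : measurable_fun [set: Om] (fun w => remove j (T w) : target_space R).
  exact: (measurableT_comp (measurable_remove j) measurable_targets).
by apply: measurable_fun_pair => //; exact: measurable_location_rv.
Qed.

Lemma measurable_minorant K j : measurable_fun [set: Om] (minorant K j).
Proof.
apply: measurable_sum => k; apply: measurable_funM.
  by apply: measurable_mem_nat; exact: measurableI.
apply: measurable_funM => //.
exact: (measurableT_comp (measurable_waiting k.+1) (mY j)).
Qed.

Let minorant_integral K j :
  (\int[P]_w (wt (X j w).2 * minorant K j w)%:E =
   \sum_(k < K) (lambda * dt)%:E * \int[Pi]_(z in V j k.+1 `*` setT) F k.+1 z)%E.
Proof.
have mEF k : measurable_fun [set: Om]
    (fun w => ((w \in E j k `&` Rg)%:R)%:E * F k (Y j w))%E.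
  apply: emeasurable_funM; last exact: (measurableT_comp (mF k) (mY j)).
  by apply/measurable_EFinP; apply: measurable_mem_nat; exact: measurableI.
transitivity (\int[P]_w \sum_(k < K) (((w \in E j k.+1 `&` Rg)%:R)%:E * F k.+1 (Y j w)))%E.
  apply: eq_integral => w _; rewrite /minorant /F mulr_sumr -sumEFin.
  by apply: eq_bigr => k _; rewrite -EFinM mulrCA.
rewrite ge0_integral_sum//; last by move=> k w _; rewrite mule_ge0.
apply: eq_bigr => k _.
have tauB : tau k.+2 - tau k.+1 = dt.
  by rewrite /tau -mulrBl -natrB// subSnn mul1r.
rewrite -[X in (lambda * X)%:E]tauB.
rewrite -(palm_integral lambda0 HX j (tau_ge0 k.+1) (tauS k.+1) (mF k.+1) (F_ge0 k.+1)).
rewrite [RHS]integral_mkcond; apply: ge0_ae_eq_integral => //.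
- apply/(measurable_restrictT _ (mE j k.+1))/measurable_funTS.
  exact: (measurableT_comp (mF k.+1) (mY j)).
- by move=> w _; rewrite mule_ge0.
- by move=> w _; rewrite patchE; case: ifP.
apply: filterS (ae_regular lambda0 HX mQ) => w rw _.
rewrite patchE in_setI (mem_set (rw : Rg w)) andbT.
by case: (w \in _); rewrite ?mul1e ?mul0e.
Qed.

(** The Poisson probabilities account for the requirement that the index of the test target be less
    than [n]. The missed waits involve up to [Mb] windows beyond the last generation window. *)
Lemma window_estimate n K :
  ((lambda * dt * (expR (- (lambda * dt)) *
      (\sum_(k < K) \sum_(j < n) poisson_pmf (lambda * (k.+1%:R * dt)) j) * B -
    C * a * (K + Mb)%:R))%:E <=
   \sum_(j < n) \int[P]_w (wt (X j w).2 * minorant K j w)%:E)%E.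
Proof.
have int_ge0 j k : (0 <= \int[Pi]_(z in V j k `*` setT) F k z)%E by exact: integral_ge0.
have -> : (\sum_(j < n) \int[P]_w (wt (X j w).2 * minorant K j w)%:E =
    (lambda * dt)%:E * \sum_(k < K) \sum_(j < n)
      \int[Pi]_(z in V j k.+1 `*` setT) F k.+1 z)%E.
  rewrite exchange_big/= ge0_sume_distrr; last by move=> j _; exact: sume_ge0.
  apply: eq_bigr => j _; rewrite minorant_integral ge0_sume_distrr//.
rewrite EFinM lee_wpmul2l//; first by rewrite lee_fin mulr_ge0// ltW.
rewrite EFinB leeBlDr//.
apply: (@le_trans _ _ (\sum_(k < K) (\sum_(j < n) \int[Pi]_(z in V j k.+1 `*` setT) F k.+1 z +
    \int[Pi]_z H k.+1 z))%E).
  rewrite mulr_sumr mulr_suml -sumEFin; apply: lee_sum => k _.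
  apply: le_trans (window_split n (ltn0Sn k)).
  by rewrite EFinM -mulr_sumr.
by rewrite big_split/= leeD2l// sum_missed_integral.
Qed.

End window_estimate.

(** * Averaging over the arrivals *)

Section poisson_tail.
Context {R : realType}.

Lemma exp_partial_sum_le (x : R) n : 0 <= x ->
  \sum_(j < n) x ^+ j / j`!%:R <= expR x.
Proof.
move=> x0; have := nondecreasing_cvgn_le _ (@is_cvg_series_exp_coeff R x) n.
rewrite /series/= /exp_coeff/= big_mkord; apply.
apply: nondecreasing_series => i _ _; exact: exp_coeff_ge0.
Qed.

(* Chernoff's method. *)
Lemma poisson_tail_le (mu theta : R) n : 0 < mu -> 0 < theta < 1 ->
  mu <= theta * n%:R ->
  1 - (theta * expR (1 - theta)) ^+ n <= \sum_(j < n) poisson_pmf mu j.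
Proof.
move=> mu0 /andP[th0 th1] mun.
pose s x k := \sum_(j < k) x ^+ j / j`!%:R : R.
have mt0 : 0 <= mu / theta by rewrite divr_ge0// ltW.
(* For [j >= n], [mu ^ j = theta ^ j * (mu / theta) ^ j] is at most
   [theta ^ n * (mu / theta) ^ j]. *)
have tail k : s mu k <= s mu n + theta ^+ n * expR (mu / theta).
  have [kn|nk] := leqP k n.
    rewrite ler_wpDr ?mulr_ge0 ?exprn_ge0 ?expR_ge0 ?(ltW th0)//.
    rewrite /s (big_ord_widen _ (fun j => mu ^+ j / j`!%:R) kn).
    rewrite big_mkcond/=; apply: ler_sum => j _; case: ifP => // _.
    by rewrite divr_ge0// exprn_ge0// ltW.
  apply: (@le_trans _ _ (s mu n + theta ^+ n * s (mu / theta) k)); last first.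
    by rewrite lerD2l ler_wpM2l ?exprn_ge0 ?(ltW th0)// exp_partial_sum_le.
  rewrite /s (big_ord_widen _ (fun j => mu ^+ j / j`!%:R) (ltnW nk)).
  rewrite (bigID (fun j : 'I_k => j < n)%N)/= lerD2l mulr_sumr.
  rewrite big_mkcond/=; apply: ler_sum => j _; case: ifPn => [jn|_]; last first.
    by rewrite !mulr_ge0// ?exprn_ge0// ?invr_ge0// ltW.
  rewrite mulrA ler_wpM2r ?invr_ge0//.
  rewrite expr_div_n mulrCA ler_peMr// ?exprn_ge0 ?(ltW mu0)//.
  rewrite -leqNgt in jn; rewrite -(subnK jn) exprD invfM mulrCA.
  rewrite divff ?mulr1 ?expf_neq0 ?gt_eqF// -exprVn.
  by rewrite exprn_ege1// invf_ge1// ltW.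
have expl : expR mu <= s mu n + theta ^+ n * expR (mu / theta).
  rewrite /expR; apply: limr_le; first exact: is_cvg_series_exp_coeff.
  by near=> k; have := tail k; rewrite /series/= big_mkord.
have -> : \sum_(j < n) poisson_pmf mu j = s mu n * expR (- mu).
  by rewrite /s mulr_suml; apply: eq_bigr => j _; rewrite /poisson_pmf mu0.
have h : 1 <= s mu n * expR (- mu) + theta ^+ n * expR (mu / theta) * expR (- mu).
  by rewrite -mulrDl -[leLHS](expRxMexpNx_1 mu) ler_wpM2r ?expR_ge0.
rewrite lerBlDr (le_trans h)// lerD2l exprMn -mulrA ler_wpM2l ?exprn_ge0 ?(ltW th0)//.
rewrite -expRM_natl -expRD ler_expR.
have -> : mu / theta - mu = mu * (1 - theta) / theta by field; rewrite gt_eqF.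
rewrite ler_pdivrMr// (_ : n%:R * (1 - theta) * theta = theta * n%:R * (1 - theta)); last by ring.
by rewrite ler_wpM2r// subr_ge0 ltW.
Unshelve. all: by end_near. Qed.

Lemma mulr_expR_lt1 (theta : R) : 0 < theta < 1 -> theta * expR (1 - theta) < 1.
Proof.
move=> /andP[th0 th1].
have h : theta < expR (theta - 1).
  have t1 : theta - 1 != 0 by rewrite subr_eq0 lt_eqF.
  by have := expR_gt1Dx t1; rewrite addrC subrK.
rewrite -(opprB theta 1) expRN -(ltr_pdivlMr _ _ _) ?invr_gt0 ?expR_gt0//.
by rewrite invrK mul1r.
Qed.

(* [K] windows with [lambda * dt * K] slightly below [n] contain, up to a
   negligible proportion, the first [n] arrivals. *)
Lemma arrival_average_limit (lambda dt B C a tau H : R) (j0 Mb : nat) :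
  0 < lambda -> 0 < dt -> 0 <= B -> 0 <= C -> 0 <= a -> 0 <= tau -> 0 <= H ->
  (forall n K : nat, lambda * dt * (expR (- (lambda * dt)) *
      (\sum_(k < K) \sum_(j < n) poisson_pmf (lambda * (k.+1%:R * dt)) j) * B -
        C * a * (K + Mb)%:R) <= j0%:R * H + n%:R * tau) ->
  expR (- (lambda * dt)) * B - C * a <= tau.
Proof.
move=> l0 d0 B0 C0 a0 tau0 H0 hyp; rewrite leNgt; apply/negP => Dtau.
set ld := lambda * dt in hyp Dtau.
have ld0 : 0 < ld by rewrite mulr_gt0.
set D := _ - _ in Dtau; pose b := expR (- ld) * B.
have b0 : 0 <= b by rewrite mulr_ge0// expR_ge0.
have D0 : 0 < D by exact: le_lt_trans Dtau.
(* If [tau < D], three losses must fit into the gap: the factor [theta] in the number of windows,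
   the Poisson tail, and a final margin [e] per target that leads to the contradiction. *)
pose e := (D - tau) / 4.
have e0 : 0 < e by rewrite divr_gt0// subr_gt0.
pose theta := 1 - e / D.
have eD : e / D < 1.
  by rewrite ltr_pdivrMr// mul1r /e ltr_pdivrMr//; lra.
have th : 0 < theta < 1.
  by rewrite /theta subr_gt0 eD/= ltrBlDr ltrDl divr_gt0.
have thD : tau + e <= theta * (D - e).
  have -> : theta * (D - e) = D - 2 * e + e * (e / D).
    by rewrite /theta; field; rewrite gt_eqF.
  have : 0 <= e * (e / D) by apply: mulr_ge0; [exact: ltW|apply: divr_ge0; exact: ltW].
  have : e * 4 = D - tau by rewrite /e divfK.
  lra.
pose z := theta * expR (1 - theta).
have z0 : 0 <= z by case/andP: th => th0 _; rewrite mulr_ge0 ?expR_ge0 ?(ltW th0).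
have z1 : z < 1 by exact: mulr_expR_lt1.
have : (fun n => b * z ^+ n) @ \oo --> (b * 0 : R).
  by apply: cvgM; [exact: cvg_cst|apply: cvg_expr; rewrite ger0_norm].
rewrite mulr0 => /cvgrPdist_lt/(_ _ e0)[n1 _ n1P].
(* All that does not grow with [n]: the first [j0] targets, the rounding of [K], and the windows
   past the horizon. *)
pose const := j0%:R * H + ld * (D - e) + ld * (C * a * Mb%:R).
have bound n : (n1 <= n)%N -> n%:R * e <= const.
  move=> n1n; have := n1P n n1n; rewrite /= sub0r normrN ger0_norm; last first.
    by rewrite mulr_ge0// exprn_ge0.
  move=> /ltW bz.
  pose K := Num.truncn (theta * n%:R / ld).
  have [th0 th1] := andP th.
  have /andP[K1 K2] : K%:R <= theta * n%:R / ld < K.+1%:R.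
    by apply: truncn_itv; apply: divr_ge0; [apply: mulr_ge0 => //|]; exact: ltW.
  rewrite ler_pdivlMr// in K1; rewrite ltr_pdivrMr// -natr1 [ltRHS]mulrDl mul1r in K2.
  have sumK : K%:R * (1 - z ^+ n) <=
      \sum_(k < K) \sum_(j < n) poisson_pmf (lambda * (k.+1%:R * dt)) j.
    rewrite mulr_natl -[X in _ *+ X](card_ord K) -sumr_const; apply: ler_sum => k _.
    apply: poisson_tail_le => //; first by rewrite !mulr_gt0.
    rewrite mulrCA (le_trans _ K1)// ler_wpM2r ?(ltW ld0)//.
    by rewrite ler_nat.
  have := hyp n K; set SS := (X in expR _ * X * B) in sumK *.
  have hb : K%:R * (b - e) <= expR (- ld) * SS * B.
    apply: (@le_trans _ _ (b * (K%:R * (1 - z ^+ n)))).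
      have -> : b * (K%:R * (1 - z ^+ n)) = K%:R * (b - b * z ^+ n) by ring.
      by rewrite ler_wpM2l// lerB.
    by rewrite /b mulrAC ler_wpM2r// ler_wpM2l ?expR_ge0.
  rewrite natrD => h.
  have Db : D = b - C * a by [].
  have h2 : ld * (K%:R * (D - e) - C * a * Mb%:R) <= j0%:R * H + n%:R * tau.
    apply: le_trans h; rewrite ler_wpM2l ?(ltW ld0)// Db.
    have -> : C * a * (K%:R + Mb%:R) = K%:R * (C * a) + C * a * Mb%:R by ring.
    move: hb; lra.
  have De0 : 0 <= D - e.
    have : e * 4 = D - tau by rewrite /e divfK.
    lra.
  have h3 : (theta * n%:R - ld) * (D - e) <= ld * (K%:R * (D - e)).
    have -> : ld * (K%:R * (D - e)) = (K%:R * ld) * (D - e) by ring.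
    by rewrite ler_wpM2r//; lra.
  have h4 : n%:R * (tau + e) <= n%:R * (theta * (D - e)) by rewrite ler_wpM2l.
  rewrite /const.
  have -> : n%:R * e = n%:R * (tau + e) - n%:R * tau by ring.
  have h5 : (theta * n%:R - ld) * (D - e) = n%:R * (theta * (D - e)) - ld * (D - e) by ring.
  have h6 : ld * (K%:R * (D - e) - C * a * Mb%:R) =
      ld * (K%:R * (D - e)) - ld * (C * a * Mb%:R) by ring.
  lra.
pose n := maxn n1 (Num.truncn (const / e)).+1.
have := bound n (leq_maxl _ _); rewrite -ler_pdivlMr// leNgt => /negP; apply.
by apply: (lt_le_trans (truncnS_gt _)); rewrite ler_nat leq_maxr.
Qed.

End poisson_tail.

Section core_bound.
Context {R : realType} {m : nat} {Q : set (plane R)} {v r : R} {shares : rel 'I_m}.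
Context {pol : policy R m} {p : targets R -> paths R m}.
Context {d : measure_display} {Om : measurableType d}.
Context {P : probability Om R} {lambda : R} {phi : plane R -> R}.
Context {X : nat -> {RV P >-> (R * plane R)%type}}.
Context (lambda0 : 0 < lambda) (HX : target_process lambda Q phi X).
Context (r_gt0 : 0 < r) (v_gt0 : 0 < v) (mQ : measurable Q).
Context (adm : admissible Q v shares pol) (prod : produces Q r pol p).

Local Notation PL := (distribution P (location_rv (X := X))).

Lemma system_time_ge0 (c : targets R) (q : paths R m) j : (0 <= system_time c q j)%E.
Proof. by apply: le_ereal_inf_tmp => _ [s [s0 _] <-]; rewrite lee_fin. Qed.

(** The hypothesis on measurable lower bounds [g] is applied to [minorant], which does lie below the
    system time by the covering argument. *)
Lemma weighted_wait_bound (wt : plane R -> R) (Wb : R) (M : plane R -> nat)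
    (Mb N j0 : nat) (dt B C tau : R) :
  measurable_fun [set: plane R] wt -> (forall q, 0 <= wt q <= Wb) ->
  measurable_fun [set: plane R] M -> (forall q, (M q <= Mb)%N) ->
  (0 < N)%N -> 0 < dt -> 0 <= C -> 0 <= tau ->
  (\int[PL]_q (wt q * ((M q)%:R * dt))%:E = B%:E)%E ->
  (forall S, measurable S -> \int[PL]_(q in S)
     (wt q * ((\sum_(L < M q) L.+2)%N%:R * dt))%:E <= C%:E * area S)%E ->
  (forall j (g : Om -> R), (j0 <= j)%N -> measurable_fun [set: Om] g ->
     (forall w, 0 <= g w) ->
     (forall w, ((g w)%:E <= system_time (X ^~ w) (p (X ^~ w)) j)%E) ->
     (\int[P]_w (wt (X j w).2 * g w)%:E <= tau%:E)%E) ->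
  expR (- (lambda * dt)) * B - C * cover_area (m := m) (v := v) (r := r) dt N <= tau.
Proof.
move=> mwt wtP mM MMb N0 dt0 C0 tau0 BE CE hyp.
have wt0 q : 0 <= wt q by case/andP: (wtP q).
have Wb0 : 0 <= Wb by case/andP: (wtP point) => h1 h2; exact: le_trans h2.
pose G := cover_set (Q := Q) (v := v) (r := r) (p := p) dt N.
have mG k : measurable (G k) by exact: (measurable_cover_set mQ prod N dt0 k).
have aG k c : (area (xsection (G k) c) <= (cover_area (m := m) (v := v) (r := r) dt N)%:E)%E.
  exact: (area_cover_set_le r_gt0 v_gt0 adm prod dt0 N0).
have a0 : 0 <= cover_area (m := m) (v := v) (r := r) dt N.
  by have := le_trans (measure_ge0 _ _) (aG 0%N point); rewrite lee_fin.
have B0 : 0 <= B.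
  rewrite -lee_fin -BE; apply: integral_ge0 => q _.
  by rewrite lee_fin !mulr_ge0// ltW.
pose g K j := minorant (P := P) (Q := Q) (X := X) G M Mb dt K j.
have g_le K j w : ((g K j w)%:E <= system_time (X ^~ w) (p (X ^~ w)) j)%E.
  apply: (minorant_le dt0); first exact: system_time_ge0.
  move=> rw k jk.
  exact: (waiting_windows_le_system_time r_gt0 v_gt0 adm prod dt0 N0 _ _ rw jk).
have mg K j : measurable_fun [set: Om] (g K j) by exact: (measurable_minorant mQ mG Mb mM dt K j).
apply: (@arrival_average_limit _ lambda dt B C _ tau (Wb * (Mb%:R * dt)) j0 Mb) => //.
  by rewrite !mulr_ge0// ltW.
move=> n K.
have := window_estimate lambda0 HX mQ mG aG mwt wt0 mM MMb dt0 C0 BE CE n K.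
rewrite -lee_fin => /le_trans; apply.
(* The first [j0] targets, not governed by [tau], are bounded by the cap times the largest
   weight. *)
apply: (@le_trans _ _ (\sum_(j < n) ((if (j < j0)%N then Wb * (Mb%:R * dt) else 0) + tau)%:E)%E).
  apply: lee_sum => j _; case: ifPn => [jj0|]; last first.
    by rewrite -leqNgt add0r => jj0; apply: hyp => // w; exact: minorant_ge0.
  apply: (@le_trans _ _ (\int[P]_w (Wb * (Mb%:R * dt))%:E)%E); last first.
    rewrite integral_cst//.
    rewrite [X in (_ * X)%E](_ : _ = 1%E); last exact: probability_setT.
    by rewrite mule1 lee_fin lerDl.
  apply: ge0_le_integral => //.
  - by move=> w _; rewrite lee_fin mulr_ge0// minorant_ge0.
  - apply/measurable_EFinP/measurable_funM => //.
    exact: (measurableT_comp mwt (measurable_location_rv j)).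
  - move=> w _; rewrite lee_fin ler_pM// ?minorant_ge0//.
      by case/andP: (wtP (X j w).2).
    exact: minorant_le_cap.
rewrite sumEFin lee_fin big_split/= sumr_const card_ord -[tau *+ n]mulr_natl lerD2r.
have H0 : 0 <= Wb * (Mb%:R * dt) by rewrite !mulr_ge0// ltW.
rewrite -(big_mkord xpredT (fun j => if (j < j0)%N then Wb * (Mb%:R * dt) else 0)).
apply: (@le_trans _ _ (\sum_(0 <= j < j0) Wb * (Mb%:R * dt))); last first.
  by rewrite sumr_const_nat subn0 -[leLHS]mulr_natl.
have [nj|/ltnW jn] := leqP n j0.
  rewrite [leRHS](big_cat_nat (n := n))//= -[leLHS]addr0 lerD ?sumr_ge0//.
  by apply: ler_sum => j _; case: ifP.
rewrite [leLHS](big_cat_nat (n := j0))//= -[leRHS]addr0 lerD//.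
  by apply: ler_sum => j _; case: ifP.
by rewrite big_nat big1// => j /andP[j0j _]; rewrite ltnNge j0j.
Qed.

End core_bound.

(** * Locations with a density *)

(** The plane carries the product sigma-algebra, so an open set is written as a countable union of
    boxes with rational centres. *)
Lemma open_plane_measurable {R : realType} (U : set (plane R)) : open U -> measurable U.
Proof.
move=> oU.
pose box (k : rat * rat * nat) : set (plane R) :=
  ball (ratr k.1.1 : R) k.2.+1%:R^-1 `*` ball (ratr k.1.2 : R) k.2.+1%:R^-1.
rewrite (_ : U = \bigcup_(k in [set k | box k `<=` U]) box k); last first.
  apply/seteqP; split => [x Ux|x [k kU]]; last exact: kU.
  have /nbhs_ballP[e /= e0 exU] : nbhs x U by exact: open_nbhs_nbhs.
  have [n _ /(_ n (leqnn n)) ne] := near_infty_natSinv_lt (PosNum (divr_gt0 e0 (ltr0Sn R 1))).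
  have n0 : 0 < n.+1%:R^-1 :> R by rewrite invr_gt0.
  have rat_near (y : R) : exists a : rat, ball (ratr a : R) n.+1%:R^-1 y.
    have /rat_in_itvoo[a] : y < y + n.+1%:R^-1 by rewrite ltrDl.
    rewrite in_itv/= => /andP[ya ay]; exists a.
    by rewrite /ball/= gtr0_norm ?subr_gt0// ltrBlDl.
  have [[a xa] [b xb]] := (rat_near x.1, rat_near x.2).
  exists (a, b, n) => //= y [ya yb]; apply: exU.
  have half z (c : R) (u : R) : ball c n.+1%:R^-1 z -> ball c n.+1%:R^-1 u -> ball z e u.
    move=> cz cu; apply: (@le_ball _ _ z (n.+1%:R^-1 + n.+1%:R^-1)).
      by rewrite (splitr e) lerD// ltW.
    exact: (ball_triangle (ball_sym cz) cu).
  by split; [exact: half xa ya|exact: half xb yb].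
rewrite bigcup_mkcond; apply: countable_bigcupT_measurable; first exact: countableP.
by move=> k; case: ifPn => // _; apply: measurableX; exact: measurable_ball.
Qed.

Lemma compact_plane_measurable {R : realType} (Q : set (plane R)) : compact Q -> measurable Q.
Proof.
move=> cQ; have : closed Q by apply: compact_closed => //; exact: (@norm_hausdorff R).
move=> /closed_openC/open_plane_measurable.
by move=> /measurableC; rewrite setCK.
Qed.

Lemma lipschitz_plane_measurable {R : realType} (Q : set (plane R)) (f : plane R -> R) :
  measurable Q -> [lipschitz f q | q in Q] -> measurable_fun Q f.
Proof.
(* A constant that is positive and strictly beyond the threshold [N]. *)
move=> mQ [N [_ /(_ (Num.max N 0 + 1))]].
set L := Num.max N 0 + 1 => fL.
have L0 : 0 < L by rewrite ltr_wpDl// le_max lexx orbT.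
have {}fL x y : Q x -> Q y -> `|f x - f y| <= L * `|x - y|.
  by move=> Qx Qy; apply: (fL _ (x, y)) => //; rewrite ltr_pwDr// le_max lexx.
apply: (measurability _ (RGenInftyO.measurableE R)) => _ [_ [a ->] <-].
(* The sublevel set is the trace on [Q] of an open set: around [q], the Lipschitz bound keeps [f]
   below [a] within radius [(a - f q) / L]. *)
rewrite (_ : _ `&` _ = Q `&` \bigcup_(q in [set q | Q q /\ f q < a])
  ball q ((a - f q) / L)).
  apply: measurableI => //; apply: open_plane_measurable.
  by apply: bigcup_open => q [_ fq]; apply: ball_open; rewrite divr_gt0// subr_gt0.
apply/seteqP; split => q [Qq].
  rewrite /= in_itv/= => fq; split => //; exists q => //.
  by apply: ballxx; rewrite divr_gt0// subr_gt0.
move=> [q' [Qq' fq']]; rewrite -ball_normE/= => qq'; split => //.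
rewrite in_itv/= -(subrK (f q') (f q)) addrC -ltrBrDl.
apply: le_lt_trans (ler_norm _) _; apply: le_lt_trans (fL _ _ Qq Qq') _.
by rewrite distrC mulrC -ltr_pdivlMr.
Qed.

Import HBNNSimple.

(** From sets to simple functions, then by monotone convergence. The map [u] allows different
    measurable structures on the two sides; it will be an identity. *)
Lemma ge0_integral_density d d' (T : measurableType d) (T' : measurableType d')
    (R : realType) (mu : {measure set T -> \bar R}) (nu : {measure set T' -> \bar R})
    (u : T -> T') (g : T -> R) :
  measurable_fun [set: T] u -> measurable_fun [set: T] g -> (forall x, 0 <= g x) ->
  (forall A, measurable A -> nu A = \int[mu]_(x in u @^-1` A) (g x)%:E)%E ->
  forall f : T' -> R, measurable_fun [set: T'] f -> (forall y, 0 <= f y) ->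
  (\int[nu]_y (f y)%:E = \int[mu]_x (f (u x) * g x)%:E)%E.
Proof.
move=> mu' mg g0 nuE f mf f0.
have mf' : measurable_fun [set: T'] (EFin \o f) by exact/measurable_EFinP.
pose h := nnsfun_approx measurableT mf'.
have nd (x : T') a b : (a <= b)%N -> h a x <= h b x.
  by move=> ab; have /lefP := nd_nnsfun_approx measurableT mf' ab; exact.
have hf (x : T') : (fun n => (h n x)%:E) @ \oo --> (f x)%:E.
  by apply: (@cvg_nnsfun_approx _ _ _ _ measurableT _ mf') => // y _; rewrite lee_fin.
have mh n : measurable_fun [set: T'] (h n) by exact: measurable_funPT.
transitivity (limn (fun n => \int[nu]_x (h n x)%:E)%E).
  rewrite -monotone_convergence//.
  - by apply: eq_integral => x _; apply/esym/cvg_lim => //; exact: hf.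
  - by move=> n; exact/measurable_EFinP.
  - by move=> n x _; rewrite lee_fin.
  - by move=> x _ a b ab; rewrite lee_fin; exact: nd.
transitivity (limn (fun n => \int[mu]_x (h n (u x) * g x)%:E)%E); last first.
  rewrite -monotone_convergence//.
  - apply: eq_integral => x _; apply/cvg_lim => //.
    by under eq_fun do rewrite EFinM; rewrite EFinM; apply: cvgeZr => //; exact: hf.
  - by move=> n; apply/measurable_EFinP/measurable_funM => //; exact: measurableT_comp.
  - by move=> n x _; rewrite lee_fin mulr_ge0.
  - by move=> x _ a b ab; rewrite lee_fin ler_wpM2r// nd.
congr (limn _); apply/funext => n.
rewrite integralT_nnsfun sintegralE.
transitivity (\int[mu]_x (\sum_(y \in range (h n))
    (y * (\1_(h n @^-1` [set y]) (u x) * g x))%:E))%E; last first.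
  apply: eq_integral => x _; rewrite (fimfunE (h n) (u x)) EFinM -fsumEFin//.
  rewrite ge0_mule_fsuml; last by move=> y; exact: nnfun_muleindic_ge0.
  by apply: eq_fsbigr => y _; rewrite -EFinM mulrA.
have my y : measurable (h n @^-1` [set y]) by exact: measurable_funPTI.
have mind y : measurable_fun [set: T] (fun x => \1_(h n @^-1` [set y]) (u x) * g x).
  apply: measurable_funM => //.
  by apply: (@measurableT_comp _ _ _ _ _ _ (\1_(h n @^-1` [set y]) : T' -> R)).
rewrite ge0_integral_fsum//; last 2 first.
- by move=> y; apply/measurable_EFinP/measurable_funM.
- move=> y x _; rewrite mulrA EFinM mule_ge0 ?lee_fin//.
  by rewrite -lee_fin; exact: nnfun_muleindic_ge0.
apply: eq_fsbigr => y; rewrite inE => -[t _ <-].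
under eq_integral do rewrite EFinM.
rewrite ge0_integralZl//; last 3 first.
- exact/measurable_EFinP.
- by move=> x _; rewrite lee_fin mulr_ge0.
- by rewrite lee_fin.
congr (_ * _)%E; rewrite nuE// [LHS]integral_mkcond; apply: eq_integral => x _.
rewrite patchE indicE (_ : (x \in u @^-1` _) = (u x \in h n @^-1` [set h n t]))//.
by case: (u x \in _); rewrite ?mul1r ?mul0r.
Qed.

Section density_bound.
Context {R : realType} {m : nat} {Q : set (plane R)} {v r : R} {shares : rel 'I_m}.
Context {pol : policy R m} {p : targets R -> paths R m}.
Context {d : measure_display} {Om : measurableType d}.
Context {P : probability Om R} {lambda : R} {phi : plane R -> R}.
Context {X : nat -> {RV P >-> (R * plane R)%type}}.
Context (lambda0 : 0 < lambda) (HX : target_process lambda Q phi X).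
Context (r_gt0 : 0 < r) (v_gt0 : 0 < v) (mQ : measurable Q).
Context (mphi : measurable_fun Q phi) (phi_ge0 : forall q, Q q -> 0 <= phi q).
Context (phi1 : (\int[area]_(q in Q) (phi q)%:E = 1)%E).

Local Notation PL := (distribution P (location_rv (X := X))).

Lemma location_density (f : plane R -> R) :
  measurable_fun [set: plane R] f -> (forall q, 0 <= f q) ->
  (\int[PL]_q (f q)%:E = \int[area]_(q in Q) (f q * phi q)%:E)%E.
Proof.
move=> mf f0.
have mg : measurable_fun [set: plane R] (phi \_ Q).
  by apply/(measurable_restrictT _ mQ).
have g0 q : 0 <= (phi \_ Q) q by rewrite patchE; case: ifPn => // /[!inE]; exact: phi_ge0.
have gE (S : set (plane R)) : measurable S ->
    (PL S = \int[area]_(q in S) ((phi \_ Q) q)%:E)%E.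
  move=> mS; apply: (eq_trans (location_lawE HX mS)).
  have -> : (\int[area]_(q in S) ((phi \_ Q) q)%:E =
             \int[area]_(q in Q `&` S) (phi q)%:E)%E.
    rewrite setIC [RHS]integral_mkcondr; apply: eq_integral => q _.
    by rewrite /= !patchE; case: ifP.
  rewrite /Rintegral fineK// ge0_fin_numE; last first.
    by apply: integral_ge0 => q [Qq _]; rewrite lee_fin phi_ge0.
  apply: (@le_lt_trans _ _ 1%E); last exact: ltry.
  rewrite -phi1; apply: ge0_subset_integral => //.
  - exact: measurableI.
  - exact/measurable_EFinP.
transitivity (\int[area]_q (f q * (phi \_ Q) q)%:E)%E.
  (* The factors of [area] carry another measurable structure than [R]: it has
     the same measurable sets, but another display. *)
  pose plane' := (g_sigma_algebraType (R.-ocitv.-measurable) *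
    g_sigma_algebraType (R.-ocitv.-measurable))%type.
  pose u : plane' -> plane R := id.
  have mu : measurable_fun [set: plane'] u by move=> _ Y mY; rewrite setTI.
  by apply: (ge0_integral_density mu _ g0 _ mf f0) => //; exact: gE.
rewrite [RHS]integral_mkcond.
apply: eq_integral => q _; rewrite !patchE; case: ifP => // _.
by rewrite mulr0.
Qed.

Context (adm : admissible Q v shares pol) (prod : produces Q r pol p).

(** The cap [kappa * sigma] is rounded down to [M] windows; [beta] controls the lower-order part of
    the charge, and the lone [dt] is the loss by rounding. *)
Lemma density_wait_bound (wt sigma : plane R -> R) (Wb Sb alpha beta gamma : R)
    (kappa dt tau : R) (N j0 : nat) :
  measurable_fun [set: plane R] wt -> (forall q, 0 <= wt q <= Wb) ->
  measurable_fun [set: plane R] sigma -> (forall q, 0 <= sigma q <= Sb) ->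
  0 <= alpha -> 0 <= beta ->
  (forall q, Q q -> wt q * phi q * sigma q ^+ 2 <= alpha) ->
  (forall q, Q q -> wt q * phi q * sigma q <= beta) ->
  (\int[area]_(q in Q) (wt q * phi q)%:E <= 1)%E ->
  (\int[area]_(q in Q) (wt q * sigma q * phi q)%:E = gamma%:E)%E ->
  0 <= kappa -> 0 < dt -> (0 < N)%N -> 0 <= tau ->
  (forall j (g : Om -> R), (j0 <= j)%N -> measurable_fun [set: Om] g ->
     (forall w, 0 <= g w) ->
     (forall w, ((g w)%:E <= system_time (X ^~ w) (p (X ^~ w)) j)%E) ->
     (\int[P]_w (wt (X j w).2 * g w)%:E <= tau%:E)%E) ->
  expR (- (lambda * dt)) * (kappa * gamma - dt) -
    (kappa ^+ 2 * alpha + 3 * kappa * dt * beta) / (2 * dt) *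
    cover_area (m := m) (v := v) (r := r) dt N <= tau.
Proof.
move=> mwt wtP msg sgP al0 be0 al be wt1 gaE ka0 dt0 N0 tau0 hyp.
have wt0 q : 0 <= wt q by case/andP: (wtP q).
have sg0 q : 0 <= sigma q by case/andP: (sgP q).
have Wb0 : 0 <= Wb by case/andP: (wtP point) => h1 h2; exact: le_trans h2.
pose M q := Num.truncn (kappa * sigma q / dt).
pose Mb := Num.truncn (kappa * Sb / dt).
have x0 q : 0 <= kappa * sigma q / dt by rewrite divr_ge0 ?mulr_ge0// ltW.
have M_le q : (M q)%:R * dt <= kappa * sigma q.
  by rewrite -ler_pdivlMr//; have /andP[] := truncn_itv (x0 q).
have M_ge q : kappa * sigma q <= (M q)%:R * dt + dt.
  rewrite -[X in _ + X]mul1r -mulrDl -ler_pdivrMr// natr1 ltW//.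
  by have /andP[] := truncn_itv (x0 q).
have MMb q : (M q <= Mb)%N.
  apply: le_truncn; rewrite ler_pM2r ?invr_gt0// ler_wpM2l//.
  by case/andP: (sgP q).
have mM : measurable_fun [set: plane R] M.
  have mks : measurable_fun [set: plane R] (fun q => kappa * sigma q / dt).
    by apply: measurable_funM => //; exact: measurable_funM.
  move=> _ Y _; rewrite setTI (_ : M @^-1` Y = \bigcup_(n in Y)
      (fun q => kappa * sigma q / dt) @^-1` `[n%:R, n.+1%:R[); last first.
    apply/seteqP; split => [q Yq|q [n Yn]]; rewrite /= ?in_itv/=.
      by exists (M q) => //; rewrite /= in_itv/=; exact: truncn_itv.
    by move=> nq; rewrite /preimage/= (_ : M q = n)//; exact: truncn_def.
  apply: bigcup_measurable => n _; rewrite -[X in measurable X]setTI.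
  exact: mks.
set C := (_ / (2 * dt)).
have C0 : 0 <= C.
  apply: divr_ge0; last by rewrite mulr_ge0// ltW.
  by rewrite addr_ge0// !mulr_ge0 ?sqr_ge0// ltW.
have mMR : measurable_fun [set: plane R] (fun q => (M q)%:R : R).
  exact: (@measurableT_comp _ _ _ _ _ _ (fun n : nat => n%:R : R)).
pose F q := wt q * ((M q)%:R * dt).
have F0 q : 0 <= F q by rewrite !mulr_ge0// ltW.
have mF : measurable_fun [set: plane R] F.
  by apply: measurable_funM => //; exact: measurable_funM.
have mwphi : measurable_fun Q (fun q => wt q * phi q).
  by apply: measurable_funM => //; exact: measurable_funTS.
have mwsp : measurable_fun Q (fun q => wt q * sigma q * phi q).
  by apply: measurable_funM => //; apply: measurable_funTS; exact: measurable_funM.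
have mFp : measurable_fun Q (fun q => F q * phi q).
  by apply: measurable_funM => //; exact: measurable_funTS.
have FE := location_density mF F0.
have F_le : (\int[PL]_q (F q)%:E <= (kappa * gamma)%:E)%E.
  rewrite FE EFinM -gaE -ge0_integralZl//.
  - apply: ge0_le_integral => //.
    + by move=> q Qq; rewrite lee_fin mulr_ge0// phi_ge0.
    + exact/measurable_EFinP.
    + by apply: measurable_funeM; exact/measurable_EFinP.
    + move=> q Qq; rewrite -EFinM lee_fin mulrA ler_wpM2r ?phi_ge0//.
      by rewrite mulrCA ler_wpM2l.
  - exact/measurable_EFinP.
  - by move=> q Qq; rewrite lee_fin !mulr_ge0// phi_ge0.
have BE : (\int[PL]_q (F q)%:E = (fine (\int[PL]_q (F q)%:E))%:E)%E.
  rewrite fineK// ge0_fin_numE; first exact: le_lt_trans F_le (ltry _).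
  by apply: integral_ge0 => q _; rewrite lee_fin.
(* Rounding loses at most [dt] at each location, hence at most [dt] on average since [wt * phi] has
   integral at most 1. *)
have B_ge : kappa * gamma - dt <= fine (\int[PL]_q (F q)%:E)%E.
  rewrite lerBlDr -lee_fin EFinD -BE FE EFinM -gaE -ge0_integralZl//.
  have dt1 : (\int[area]_(q in Q) (dt * (wt q * phi q))%:E <= dt%:E)%E.
    under eq_integral do rewrite EFinM.
    rewrite ge0_integralZl//.
    - by rewrite -[leRHS]mule1; apply: lee_wpmul2l; rewrite // lee_fin ltW.
    - exact/measurable_EFinP.
    - by move=> q Qq; rewrite lee_fin mulr_ge0// phi_ge0.
    - by rewrite lee_fin ltW.
  apply: le_trans (leeD2l _ dt1).
  rewrite -ge0_integralD//.
  - apply: ge0_le_integral => //.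
    + by move=> q Qq; rewrite mule_ge0 ?lee_fin ?mulr_ge0// phi_ge0.
    + by apply: measurable_funeM; exact/measurable_EFinP.
    + by apply: emeasurable_funD; apply/measurable_EFinP => //; exact: measurable_funM.
    + move=> q Qq; rewrite -EFinM -EFinD lee_fin /F.
      rewrite [leLHS](_ : _ = wt q * phi q * (kappa * sigma q)); last by ring.
      rewrite [leRHS](_ : _ = wt q * phi q * ((M q)%:R * dt + dt)); last by ring.
      by rewrite ler_wpM2l// mulr_ge0// phi_ge0.
  - by move=> q Qq; rewrite lee_fin mulr_ge0// phi_ge0.
  - exact/measurable_EFinP.
  - by move=> q Qq; rewrite lee_fin !mulr_ge0// ?phi_ge0// ltW.
  - by apply/measurable_EFinP; exact: measurable_funM.
  - exact/measurable_EFinP.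
  - by move=> q Qq; rewrite lee_fin !mulr_ge0// phi_ge0.
apply: (@le_trans _ _ (expR (- (lambda * dt)) * fine (\int[PL]_q (F q)%:E)%E -
    C * cover_area (m := m) (v := v) (r := r) dt N)).
  by rewrite lerD2r ler_wpM2l// expR_ge0.
apply: (weighted_wait_bound lambda0 HX r_gt0 v_gt0 mQ adm prod mwt wtP mM MMb N0 dt0 C0
  tau0 BE) hyp.
move=> S mS.
pose G q : R := wt q * ((\sum_(L < M q) L.+2)%N%:R * dt).
have G0 q : 0 <= G q by rewrite !mulr_ge0// ltW.
have mG : measurable_fun [set: plane R] G.
  apply: measurable_funM => //; apply: measurable_funM => //.
  exact: (@measurableT_comp _ _ _ _ _ _ (fun n : nat => (\sum_(L < n) L.+2)%N%:R : R)).
have GC q : Q q -> G q * phi q <= C.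
  (* The summand 3 produces the term [3 * kappa * dt * beta] in [C], and the 2 its denominator
     [2 * dt]. *)
  move=> Qq; have sumE n : (\sum_(L < n) L.+2)%N%:R * 2 = n%:R * (n%:R + 3) :> R.
    elim: n => [|n IH]; first by rewrite big_ord0 !mul0r.
    by rewrite big_ord_recr/= natrD mulrDl IH -[n.+2%:R]natr1 -!natr1; ring.
  rewrite /C ler_pdivlMr ?mulr_gt0// /G.
  rewrite [leLHS](_ : _ = wt q * phi q * (((M q)%:R * dt) * ((M q)%:R * dt) +
    3 * dt * ((M q)%:R * dt))); last first.
    transitivity (wt q * phi q * dt ^+ 2 * ((\sum_(L < M q) L.+2)%N%:R * 2)); first by ring.
    by rewrite sumE; ring.
  apply: (@le_trans _ _ (kappa ^+ 2 * (wt q * phi q * sigma q ^+ 2) +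
      3 * kappa * dt * (wt q * phi q * sigma q))); last first.
    apply: lerD; apply: ler_wpM2l; rewrite ?sqr_ge0 ?mulr_ge0 ?(ltW dt0)//.
    - exact: al.
    - exact: be.
  rewrite [leRHS](_ : _ = wt q * phi q * ((kappa * sigma q) * (kappa * sigma q) +
    3 * dt * (kappa * sigma q))); last by ring.
  rewrite ler_wpM2l ?mulr_ge0 ?phi_ge0// lerD//.
    by rewrite ler_pM// mulr_ge0// ltW.
  by rewrite ler_wpM2l// mulr_ge0// ltW.
rewrite integral_mkcond.
rewrite [X in (X <= _)%E](_ : _ = \int[PL]_q (G q * \1_S q)%:E)%E; last first.
  apply: eq_integral => q _; rewrite patchE indicE.
  by case: (q \in S); rewrite ?mulr1 ?mulr0.
rewrite location_density//; last 2 first.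
- by apply: measurable_funM => //; exact: measurable_indic.
- by move=> q; rewrite mulr_ge0.
apply: (@le_trans _ _ (\int[area]_(q in Q) (C * \1_S q)%:E)%E).
  have mS1 : measurable_fun [set: plane R] (\1_S : plane R -> R).
    exact: measurable_indic.
  apply: ge0_le_integral => //.
  - by move=> q Qq; rewrite lee_fin; apply: mulr_ge0; [exact: mulr_ge0|exact: phi_ge0].
  - apply/measurable_EFinP/measurable_funM => //; apply: measurable_funTS.
    exact: measurable_funM.
  - apply/measurable_EFinP/measurable_funM => //; exact: measurable_funTS.
  - by move=> q Qq; rewrite lee_fin mulrAC ler_wpM2r ?GC// indicE ler0n.
under eq_integral do rewrite EFinM.
rewrite ge0_integralZl//.
- rewrite lee_wpmul2l ?lee_fin// integral_indic//.
  by apply: le_measure; rewrite ?inE//; exact: measurableI.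
- by apply/measurable_EFinP; exact: measurable_indic.
Qed.

End density_bound.

(** * Choice of the parameters *)

(** Here [y] is the square root of [r], equal to [dt]; multiplied by [r], the terms [kappa * gamma],
    [kappa ^ 2 * alpha] and [3 * kappa * dt * beta] of the wait bound turn into [a], [b] and [c]
    with powers of [y]. The error is linear in [y]. *)
Lemma perturbation_bound {R : realFieldType} (lambda v m a b c y : R) :
  0 <= lambda -> 0 <= v -> 0 <= m -> 0 <= a -> 0 <= b -> 0 <= c -> 0 <= y <= 1 ->
  a - m * v * b - y * (lambda * a + 1 + m / 2 * (16 * b + 2 * v * b + c * (16 + 4 * v))) <=
  (1 - lambda * y) * (a - y ^+ 3) -
    m / 2 * (b + c * y ^+ 3) * (4 * y * (1 + y) ^+ 2 + 2 * v * (1 + y)).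
Proof.
move=> la0 v0 m0 a0 b0 c0 /andP[y0 y1].
have y2 : y ^+ 2 <= y by rewrite expr2 ler_piMl.
have y3 : y ^+ 3 <= y by rewrite exprSr (le_trans _ y2)// expr2 ler_wpM2r.
have h1 : a - y * (lambda * a + 1) <= (1 - lambda * y) * (a - y ^+ 3).
  have : 0 <= lambda * y * y ^+ 3 by rewrite !mulr_ge0// exprn_ge0.
  by move: y3; set z := y ^+ 3 => y3 h; lra.
have h2 : b + c * y ^+ 3 <= b + c * y by rewrite lerD2l ler_wpM2l.
have h3 : 4 * y * (1 + y) ^+ 2 + 2 * v * (1 + y) <= 16 * y + 2 * v + 2 * v * y.
  have : 4 * y * (1 + y) ^+ 2 <= 4 * y * 4.
    rewrite ler_wpM2l ?mulr_ge0// (_ : 4 = 2 ^+ 2); last by rewrite -natrX.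
    by rewrite lerXn2r ?nnegrE ?addr_ge0// -[2]/(1 + 1) lerD2l.
  by move: (_ ^+ 2) => z ?; lra.
have h4 : (b + c * y ^+ 3) * (4 * y * (1 + y) ^+ 2 + 2 * v * (1 + y)) <=
    (b + c * y) * (16 * y + 2 * v + 2 * v * y).
  by rewrite ler_pM// !(addr_ge0, mulr_ge0, exprn_ge0).
have h5 : (b + c * y) * (16 * y + 2 * v + 2 * v * y) <=
    2 * v * b + y * (16 * b + 2 * v * b + c * (16 + 4 * v)).
  have : c * (16 + 2 * v) * y ^+ 2 <= c * (16 + 2 * v) * y.
    by rewrite ler_wpM2l// mulr_ge0// addr_ge0// mulr_ge0.
  by rewrite expr2; nra.
have h6 := ler_wpM2l (divr_ge0 m0 (ler0n R 2)) (le_trans h4 h5).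
rewrite mulrA in h6.
by move: h1 h6; set A1 := (_ * (a - _)); set A2 := (m / 2 * _ * _) => h1 h6; lra.
Qed.

Lemma small_radius_parameters {R : realType} (m : nat) (lambda v alpha beta gamma e : R) :
  (0 < m)%N -> 0 <= lambda -> 0 < v -> 0 < alpha -> 0 <= beta -> 0 < gamma -> 0 < e ->
  exists2 r0, 0 < r0 & forall r, 0 < r < r0 ->
    exists kappa dt : R, exists N : nat, [/\ 0 <= kappa, 0 < dt, (0 < N)%N &
      gamma ^+ 2 / (4 * m%:R * v * alpha) - e <=
      (expR (- (lambda * dt)) * (kappa * gamma - dt) -
        (kappa ^+ 2 * alpha + 3 * kappa * dt * beta) / (2 * dt) *
        cover_area (m := m) (v := v) (r := r) dt N) * r].
Proof.
move=> m_gt0 la0 v0 al0 be0 ga0 e0.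
have m0 : 0 < m%:R :> R by rewrite ltr0n.
(* The value of [r * kappa] that is optimal in the limit. *)
pose g := gamma / (2 * m%:R * v * alpha).
have g0 : 0 < g by rewrite divr_gt0// !mulr_gt0.
pose a := g * gamma; pose b := g ^+ 2 * alpha; pose c := 3 * beta * g.
have a0 : 0 < a by rewrite mulr_gt0.
have b0 : 0 < b by rewrite mulr_gt0// exprn_gt0.
have c0 : 0 <= c by apply: mulr_ge0; [exact: mulr_ge0|exact: ltW].
pose K := lambda * a + 1 + m%:R / 2 * (16 * b + 2 * v * b + c * (16 + 4 * v)).
have K0 : 0 < K.
  have h1 := mulr_ge0 la0 (ltW a0).
  have h2 := mulr_ge0 (ltW v0) (ltW b0); have h3 := mulr_ge0 c0 (ltW v0).
  have h4 : 0 <= 16 * b + 2 * v * b + c * (16 + 4 * v) by nra.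
  have := mulr_ge0 (divr_ge0 (ltW m0) (ler0n R 2)) h4.
  by rewrite /K; set z := m%:R / 2 * _ => h5; lra.
(* [y <= 1] tames the powers of [y]; [y <= a] makes [kappa * gamma - dt] nonnegative, so that the
   exponential may be replaced by [1 - lambda * y]; [y <= e / K] bounds the error. *)
pose y0 := Num.min 1 (Num.min a (e / K)).
have y00 : 0 < y0 by rewrite !lt_min ltr01 a0 divr_gt0.
exists (y0 ^+ 2); first by rewrite exprn_gt0.
move=> r /andP[r0 rr]; pose y := Num.sqrt r.
have y_gt0 : 0 < y by rewrite sqrtr_gt0.
have rE : r = y ^+ 2 by rewrite sqr_sqrtr// ltW.
have yy0 : y <= y0.
  by rewrite -(ler_pXn2r (n := 2))// ?nnegrE ?(ltW y_gt0) ?(ltW y00)// -rE ltW.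
move: yy0; rewrite !le_min => /and3P[y1 ya ye].
(* With [v / N <= r], sampling enlarges the sensing radius only to [r * (1 + y)]. *)
pose N := (Num.truncn (v / r)).+1.
exists (g / r), y, N; split => //; first by rewrite divr_ge0// ltW.
have gE : gamma ^+ 2 / (4 * m%:R * v * alpha) = a - m%:R * v * b.
  by rewrite /a /b /g; field; rewrite !gt_eqF.
have K_le : y * K <= e by rewrite -ler_pdivlMr.
have y01 : 0 <= y <= 1 by rewrite ltW.
have := perturbation_bound la0 (ltW v0) (ltW m0) (ltW a0) (ltW b0) c0 y01.
rewrite -/K -gE => main.
apply: le_trans (_ : _ <= gamma ^+ 2 / (4 * m%:R * v * alpha) - y * K) _.
  by rewrite lerD2l lerN2.
apply: le_trans main _.
have cr : cover_radius (v := v) (r := r) y N <= y ^+ 2 * (1 + y).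
  rewrite /cover_radius mulrDr mulr1 -rE lerD2l mulrCA mulrC ler_wpM2r ?(ltW y_gt0)//.
  rewrite ler_pdivrMr ?ltr0n// mulrC -ler_pdivrMr// ltW//.
  exact: truncnS_gt.
have cr0 : 0 <= cover_radius (v := v) (r := r) y N.
  by rewrite addr_ge0 ?(ltW r0)// mulr_ge0 ?(ltW v0)// divr_ge0 ?(ltW y_gt0).
have ca : cover_area (m := m) (v := v) (r := r) y N <=
    y ^+ 3 * (m%:R * (4 * y * (1 + y) ^+ 2 + 2 * v * (1 + y))).
  rewrite [leRHS](_ : _ = m%:R * (4 * (y ^+ 2 * (1 + y)) ^+ 2 + 2 * (y ^+ 2 * (1 + y)) * v * y));
    last by ring.
  rewrite /cover_area ler_wpM2l// lerD//.
    by rewrite ler_wpM2l// lerXn2r ?nnegrE// (le_trans cr0).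
  by rewrite !ler_wpM2r ?(ltW v0) ?(ltW y_gt0)// ler_wpM2l.
rewrite [leRHS]mulrBl; apply: lerB.
  rewrite (_ : a - y ^+ 3 = (g / r * gamma - y) * r); last first.
    by rewrite mulrBl rE /a; field; rewrite gt_eqF.
  rewrite mulrA ler_wpM2r ?(ltW r0)// ler_wpM2r//; last first.
    by rewrite -mulNr -?[- _ * _]mulNr; have := expR_ge1Dx (- (lambda * y)); rewrite mulNr.
  rewrite subr_ge0 mulrAC ler_pdivlMr// rE (le_trans _ ya)// -exprS.
  by rewrite exprSr ler_piMl ?exprn_ile1 ?(ltW y_gt0).
rewrite [leRHS](_ : _ = m%:R * (4 * y * (1 + y) ^+ 2 + 2 * v * (1 + y)) * y ^+ 3 *
  ((b + c * y ^+ 3) / (2 * y ^+ 3))); last by field; rewrite gt_eqF.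
rewrite mulrAC [leLHS]mulrC.
have gr0 : 0 <= g / r by rewrite divr_ge0// ltW.
apply: ler_pM; last 2 first.
- by rewrite mulrC.
- by rewrite rE /b /c le_eqVlt; apply/orP; left; apply/eqP; field; rewrite gt_eqF.
- apply: mulr_ge0 => //; apply: addr_ge0; first by rewrite mulr_ge0// sqr_ge0.
  by apply: mulr_ge0 (ltW y_gt0); apply: mulr_ge0 (ltW v0); exact: mulr_ge0.
- apply: mulr_ge0; last exact: ltW.
  apply: divr_ge0; last by rewrite mulr_ge0// ltW.
  apply: addr_ge0; first by rewrite mulr_ge0 ?sqr_ge0// ltW.
  by apply: mulr_ge0 => //; apply: mulr_ge0 (ltW y_gt0); exact: mulr_ge0.
Qed.

(** The integral of a nonnegative function is a supremum over the simple functions below it, so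
    monotonicity also covers nonmeasurable system times. *)
Lemma le_integral_ge0 d (T : measurableType d) (R : realType)
    (mu : {measure set T -> \bar R}) (D D' : set T) (f1 f2 : T -> \bar R) :
  D `<=` D' -> (forall x, 0 <= f1 x)%E -> (forall x, D x -> f1 x <= f2 x)%E ->
  (forall x, 0 <= f2 x)%E ->
  (\int[mu]_(x in D) f1 x <= \int[mu]_(x in D') f2 x)%E.
Proof.
move=> DD' f10 f12 f20; rewrite !ge0_integralE//.
apply: ereal_sup_le => _ [h hf <-]; exists h => // x; apply: le_trans (hf x) _.
rewrite !patchE; case: ifPn => [/[!inE] Dx|_]; last by case: ifP.
by rewrite mem_set; [exact: f12|exact: DD'].
Qed.

(** * The limit of small radii *)

Section small_radius.
Context {R : realType} {m : nat} {Q : set (plane R)} {v : R} {shares : rel 'I_m}.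
Context {d : measure_display} {Om : measurableType d}.
Context {P : probability Om R} {lambda : R} {phi : plane R -> R}.
Context {X : nat -> {RV P >-> (R * plane R)%type}}.
Context (m_gt0 : (0 < m)%N) (lambda0 : 0 < lambda) (HX : target_process lambda Q phi X).
Context (v_gt0 : 0 < v) (mQ : measurable Q).
Context (mphi : measurable_fun Q phi) (phi_ge0 : forall q, Q q -> 0 <= phi q).
Context (phi1 : (\int[area]_(q in Q) (phi q)%:E = 1)%E).

(* [tau] eventually bounds the mean system time when targets are weighted by
   [wt]; lower bounds [g] are used because system times need not be measurable. *)
Definition weighted_wait_le (p : targets R -> paths R m) (wt : plane R -> R) (tau : R) :=
  exists j0, forall j (g : Om -> R), (j0 <= j)%N -> measurable_fun [set: Om] g ->
     (forall w, 0 <= g w) ->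
     (forall w, ((g w)%:E <= system_time (X ^~ w) (p (X ^~ w)) j)%E) ->
     (\int[P]_w (wt (X j w).2 * g w)%:E <= tau%:E)%E.

Lemma small_radius_wait (wt sigma : plane R -> R) (Wb Sb alpha beta gamma e : R) :
  measurable_fun [set: plane R] wt -> (forall q, 0 <= wt q <= Wb) ->
  measurable_fun [set: plane R] sigma -> (forall q, 0 <= sigma q <= Sb) ->
  0 < alpha -> 0 <= beta -> 0 < gamma -> 0 < e ->
  (forall q, Q q -> wt q * phi q * sigma q ^+ 2 <= alpha) ->
  (forall q, Q q -> wt q * phi q * sigma q <= beta) ->
  (\int[area]_(q in Q) (wt q * phi q)%:E <= 1)%E ->
  (\int[area]_(q in Q) (wt q * sigma q * phi q)%:E = gamma%:E)%E ->
  exists2 r0, 0 < r0 & forall r, 0 < r < r0 -> forall (pol : policy R m) p,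
    admissible Q v shares pol -> produces Q r pol p -> forall tau : R, 0 <= tau ->
    weighted_wait_le p wt tau ->
    gamma ^+ 2 / (4 * m%:R * v * alpha) - e <= tau * r.
Proof.
move=> mwt wtP msg sgP al0 be0 ga0 e0 al be wt1 gaE.
have [r0 r00 small] := small_radius_parameters m_gt0 (ltW lambda0) v_gt0 al0 be0 ga0 e0.
exists r0 => // r rr pol p adm prod tau tau0 [j0 hyp].
have [kappa [dt [N [ka0 dt0 N0 /le_trans]]]] := small r rr; apply.
case/andP: rr => r_gt0 _; rewrite ler_pM2r//.
exact: (density_wait_bound lambda0 HX r_gt0 v_gt0 mQ mphi phi_ge0 phi1 adm prod
  mwt wtP msg sgP (ltW al0) be0 al be wt1 gaE ka0 dt0 N0 tau0 hyp).
Qed.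

(** The radius [r0] is uniform over policies, so the bound survives the infimum over them and then
    the lower limit. Policies with infinite mean system time satisfy it trivially. *)
Lemma optimal_system_time_limit (G : R) (C : (targets R -> paths R m) -> Prop) :
  (forall e, 0 < e -> exists2 r0, 0 < r0 & forall r, 0 < r < r0 ->
     forall (pol : policy R m) p, admissible Q v shares pol -> produces Q r pol p ->
     C p -> forall tau : R, 0 <= tau -> mean_system_time X p @ \oo --> tau%:E ->
     G - e <= tau * r) ->
  (G%:E <= limf_einf (fun r : R => optimal_system_time X Q v r shares C * r%:E) 0^'+)%E.
Proof.
move=> bound; apply/lee_addgt0Pr => e e0; have [r0 r00 hr] := bound e e0.
rewrite -leeBlDr// -EFinB limf_einfE.
pose V := [set r : R | 0 < r < r0].
apply: (@le_trans _ _ (ereal_inf [set (optimal_system_time X Q v r shares C * r%:E)%E |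
    r in V])); last first.
  apply: ereal_sup_ubound; exists V => //.
  near=> r; apply/andP; split; near: r; [exact: nbhs_right_gt|exact: nbhs_right_lt].
apply: le_ereal_inf_tmp => _ [r rr <-]; have /andP[r_gt0 _] := rr.
rewrite -lee_pdivrMr//; apply: le_ereal_inf_tmp => tau [pol [p [adm prod _ Cp cv]]].
have tau0 : (0 <= tau)%E.
  apply: cvge_to_ge cv _; apply: nearW => j; apply: integral_ge0 => w _.
  exact: system_time_ge0.
case: tau tau0 cv => [t t0 cv||//]; last by move=> _ _; rewrite leey.
rewrite -EFinM lee_fin ler_pdivrMr//.
exact: (hr r rr pol p adm prod Cp t).
Unshelve. all: by end_near. Qed.

Lemma eventually_mean_system_time_le (u : nat -> \bar R) (tau e : R) :
  u @ \oo --> tau%:E -> 0 < e -> \forall j \near \oo, (u j <= (tau + e)%:E)%E.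
Proof.
move=> cv e0.
have h : \forall x \near nbhs tau%:E, (x < (tau + e)%:E)%E.
  by apply: open_ereal_lt'; rewrite lte_fin ltrDl.
have : \forall j \near \oo, (u j < (tau + e)%:E)%E by exact: cv _ h.
by apply: filterS => j /ltW.
Qed.

End small_radius.

(** * From mean system times to weighted waits *)

Section weighted_waits.
Context {R : realType} {m : nat} {Q : set (plane R)}.
Context {d : measure_display} {Om : measurableType d}.
Context {P : probability Om R} {lambda : R} {phi : plane R -> R}.
Context {X : nat -> {RV P >-> (R * plane R)%type}}.
Context (HX : target_process lambda Q phi X) (mQ : measurable Q).
Context (mphi : measurable_fun Q phi) (phi1 : (\int[area]_(q in Q) (phi q)%:E = 1)%E).
Implicit Types p : targets R -> paths R m.

Lemma unweighted_wait_le p (tau e : R) : mean_system_time X p @ \oo --> tau%:E ->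
  0 < e -> weighted_wait_le (P := P) (X := X) p (cst 1) (tau + e).
Proof.
move=> cv e0; have [j0 _ hj] := eventually_mean_system_time_le cv e0.
exists j0 => j g jj mg g0 g_le; apply: le_trans (hj j jj).
apply: le_integral_ge0 => // [w|w _|w]; first by rewrite mul1r lee_fin.
  by rewrite mul1r.
exact: system_time_ge0.
Qed.

Context {lo hi A : R} (lo_gt0 : 0 < lo).
Context (phi_bounds : forall q, Q q -> lo <= phi q <= hi).
Context (areaQ : area Q = A%:E) (A_gt0 : 0 < A).

Lemma mean_system_time_in_le p j :
  (mean_system_time_in X p Q j <= mean_system_time X p j)%E.
Proof.
rewrite /mean_system_time_in.
have -> : P [set w | Q (X j w).2] = 1%E.
  by apply: (eq_trans (location_law HX j mQ)); rewrite setIid /Rintegral phi1.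
rewrite invr1 mule1; apply: le_integral_ge0 => // w; exact: system_time_ge0.
Qed.

(** On a level set where [phi] varies by a factor at most [1 + e], the weighted wait is about
    [1 / (A * phi)] times the probability times the common wait, hence about [area / A] times that
    wait. The areas add up to [A]. *)
Lemma uniform_wait_le p (tau e : R) : 0 <= tau -> mean_system_time X p @ \oo --> tau%:E ->
  spatially_unbiased X Q p -> 0 < e ->
  weighted_wait_le (P := P) (X := X) p ((fun q => (A * phi q)^-1) \_ Q)
    ((1 + e) * (tau + e)).
Proof.
move=> tau0 cv [tau' cv'] e0.
(* [Q] itself is a region, and conditioning on it is trivial. *)
have tau'_le : (tau' <= tau%:E)%E.
  have cvQ := cv' Q mQ (fun q h => h); rewrite areaQ lte_fin in cvQ.
  have := lee_lim (cvgP _ (cvQ A_gt0)) (cvgP _ cv).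
  rewrite (cvg_lim _ (cvQ A_gt0))// (cvg_lim _ cv)//; apply.
  by apply: nearW => j; exact: mean_system_time_in_le.
have te : (tau' < (tau + e)%:E)%E by apply: le_lt_trans tau'_le _; rewrite lte_fin ltrDl.
(* A step of [lo * e] is at most [e] times the lower end of any level. There are finitely many
   levels, so a single [j0] serves them all. *)
pose dl := lo * e; have dl0 : 0 < dl by rewrite mulr_gt0.
pose S (k : nat) := Q `&` phi @^-1` `[lo + k%:R * dl, lo + k.+1%:R * dl[.
have mS k : measurable (S k) by exact: mphi.
pose n := (Num.truncn ((hi - lo) / dl)).+1.
have hS (k : 'I_n) : \forall j \near \oo, (0 < area (S k))%E ->
    (mean_system_time_in X p (S k) j <= (tau + e)%:E)%E.
  have [a0|] := pselect (0 < area (S k))%E; last by move=> na; apply: nearW => j /na.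
  have : \forall j \near \oo, (mean_system_time_in X p (S k) j < (tau + e)%:E)%E.
    have near_tau' : \forall x \near nbhs tau', (x < (tau + e)%:E)%E.
      exact: open_ereal_lt'.
    exact: (cv' (S k) (mS k) (@subIsetl _ _ _) a0 _ near_tau').
  by apply: filterS => j /ltW h _.
have [j0 _ hj] : \forall j \near \oo, forall k : 'I_n, (0 < area (S k))%E ->
    (mean_system_time_in X p (S k) j <= (tau + e)%:E)%E by exact: filter_forall.
exists j0 => j g jj mg g0 g_le.
pose inS k := [set w | S k (X j w).2].
have minS k : measurable (inS k).
  by rewrite -[inS k]setTI; exact: (measurable_location_rv j).
pose c k := (A * (lo + k%:R * dl))^-1.
have lok k : 0 < lo + k%:R * dl by rewrite ltr_pwDl// mulr_ge0// ltW.
have c0 k : 0 <= c k by rewrite invr_ge0 mulr_ge0// ltW.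
have PS k : P (inS k) = (\int[area]_(q in S k) phi q)%:E.
  by apply: (eq_trans (location_law HX j (mS k))); rewrite setIA setIid.
have aS k : (area (S k) <= A%:E)%E.
  rewrite -areaQ; apply: le_measure.
  - exact: mem_set (mS k).
  - exact: mem_set mQ.
  - exact: subIsetl.
pose a k := fine (area (S k)).
have aE k : area (S k) = (a k)%:E.
  by rewrite fineK// ge0_fin_numE//; exact: le_lt_trans (aS k) (ltry _).
have phi0 q : Q q -> 0 <= phi q.
  by move=> Qq; case/andP: (phi_bounds Qq) => /(le_trans (ltW lo_gt0)).
have a_ge0 k : 0 <= a k by exact: fine_ge0 (measure_ge0 _ _).
have P_le k : (P (inS k) <= ((lo + k.+1%:R * dl) * a k)%:E)%E.
  have int_phi : (\int[area]_(q in S k) (phi q)%:E <= ((lo + k.+1%:R * dl) * a k)%:E)%E.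
    rewrite EFinM -aE -(integral_cst area (mS k)); apply: ge0_le_integral => //.
    - exact: mS.
    - by move=> q [Qq _]; rewrite lee_fin; exact: phi0.
    - by apply/measurable_EFinP; apply: measurable_funS mphi => //; exact: subIsetl.
    - by move=> q [_ /=]; rewrite in_itv/= lee_fin => /andP[_ /ltW].
  rewrite PS /Rintegral fineK// ge0_fin_numE; first exact: le_lt_trans int_phi (ltry _).
  by apply: integral_ge0 => q [Qq _]; rewrite lee_fin phi0.
have int_le (k : 'I_n) : (\int[P]_(w in inS k) (g w)%:E <= P (inS k) * (tau + e)%:E)%E.
  (* On a null level set the conditional mean says nothing, but the integral vanishes. *)
  have [P0|] := eqVneq (P (inS k)) 0%E.
    have mg' : measurable_fun (inS k) (EFin \o g).
      by apply/measurable_EFinP; exact: measurable_funTS.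
    rewrite P0 mul0e -(integral_abs_eq0 (minS k) mg' P0).
    by apply: le_integral_ge0 => // w; rewrite /= lee_fin// ler_norm.
  rewrite neq_lt ltNge measure_ge0/= => P0.
  have a0 : (0 < area (S k))%E.
    rewrite lt_def measure_ge0 andbT; apply/eqP => a0.
    have := P_le k; rewrite /a a0/= mulr0 => h; have := lt_le_trans P0 h.
    by rewrite ltxx.
  have PE : P (inS k) = (fine (P (inS k)))%:E.
    by rewrite fineK// PS.
  have := hj j jj k a0; rewrite /mean_system_time_in -/(inS k) PE muleC.
  rewrite lee_pdivrMl -?lte_fin -?PE// => h; apply: le_trans h.
  by apply: le_integral_ge0 => // w; exact: system_time_ge0.
have mg1 k : measurable_fun [set: Om] (fun w => \1_(inS k) w * g w).
  by apply: measurable_funM => //; exact: measurable_indic.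
apply: (@le_trans _ _ (\int[P]_w \sum_(k < n) (c k * (\1_(inS k) w * g w))%:E)%E).
  apply: le_integral_ge0 => // w.
  - rewrite lee_fin mulr_ge0// patchE; case: ifPn => // /[!inE] Qx.
    by rewrite invr_ge0 mulr_ge0 ?phi0// ltW.
  - move=> _; rewrite sumEFin lee_fin patchE; case: ifPn => [/[!inE] Qx|_]; last first.
      by rewrite mul0r sumr_ge0// => k _; rewrite !mulr_ge0// indicE ler0n.
    have /andP[lo_x x_hi] := phi_bounds Qx.
    have x0 : 0 <= (phi (X j w).2 - lo) / dl by rewrite divr_ge0 ?subr_ge0// ltW.
    have kn : (Num.truncn ((phi (X j w).2 - lo) / dl) < n)%N.
      by rewrite ltnS; apply: le_truncn; rewrite ler_pM2r ?invr_gt0// lerD2r.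
    have /andP[] := truncn_itv x0; rewrite ler_pdivlMr// ltr_pdivrMr// => k1 k2.
    have Sx : inS (Ordinal kn) w.
      by split => //=; rewrite in_itv/= -lerBrDl -ltrBlDl k1 k2.
    rewrite (bigD1 (Ordinal kn))//= [\1__ _]indicE (mem_set Sx) mul1r.
    apply: ler_wpDr.
      by apply: sumr_ge0 => k _; rewrite !mulr_ge0// indicE ler0n.
    have phi_x : 0 < phi (X j w).2 by exact: lt_le_trans lo_x.
    rewrite ler_wpM2r// /c lef_pV2 ?posrE ?mulr_gt0//.
    by rewrite ler_pM2l// -lerBrDl.
  - rewrite sumEFin lee_fin; apply: sumr_ge0 => k _.
    by rewrite !mulr_ge0// indicE ler0n.
rewrite ge0_integral_sum//; last 2 first.
- by move=> k; apply/measurable_EFinP/measurable_funM.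
- by move=> k w _; rewrite lee_fin !mulr_ge0// indicE ler0n.
apply: (@le_trans _ _ (\sum_(k < n) ((1 + e) / A * a k * (tau + e))%:E)%E).
  apply: lee_sum => k _.
  under eq_integral do rewrite EFinM.
  rewrite ge0_integralZl//; last 3 first.
  - exact/measurable_EFinP.
  - by move=> w _; rewrite lee_fin mulr_ge0// indicE ler0n.
  - by rewrite lee_fin.
  have -> : (\int[P]_w (\1_(inS k) w * g w)%:E = \int[P]_(w in inS k) (g w)%:E)%E.
    rewrite [RHS]integral_mkcond; apply: eq_integral => w _.
    by rewrite patchE indicE; case: (w \in _); rewrite ?mul1r ?mul0r.
  apply: (@le_trans _ _ ((c k)%:E * (((lo + k.+1%:R * dl) * a k)%:E * (tau + e)%:E))%E).
    rewrite lee_wpmul2l ?lee_fin//; apply: le_trans (int_le k) _.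
    by rewrite lee_wpmul2r ?P_le// lee_fin addr_ge0// ltW.
  rewrite -!EFinM lee_fin mulrA ler_wpM2r ?addr_ge0 ?(ltW e0)// mulrA ler_wpM2r//.
  rewrite /c mulrC ler_pdivrMr ?mulr_gt0// [leRHS]mulrA divfK ?gt_eqF//.
  apply: (@le_trans _ _ (lo + k%:R * dl + lo * e)).
    by rewrite -natr1 mulrDl mul1r addrA.
  rewrite [leRHS]mulrDl mul1r lerD2l [leRHS]mulrC ler_pM2r// lerDl.
  by rewrite mulr_ge0// ltW.
rewrite sumEFin lee_fin -mulr_suml -mulr_sumr ler_wpM2r ?addr_ge0// ?(ltW e0)//.
rewrite mulrAC ler_pdivrMr// ler_wpM2l ?addr_ge0 ?(ltW e0)//.
rewrite -lee_fin -sumEFin -areaQ; under eq_bigr do rewrite -aE.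
have tS : trivIset [set: nat] S.
  apply: ltn_trivIset => k l kl; apply/seteqP; split => // q [[_ +] [_ +]].
  rewrite /= !in_itv/= => /andP[_ hi_l] /andP[lo_k _].
  have := le_lt_trans lo_k hi_l; rewrite ltrD2l ltr_pM2r// ltr_nat.
  by rewrite ltnS leqNgt kl.
have := @measure_bigsetU _ R _ area S mS tS n.
move=> <-; apply: le_measure.
- by apply: mem_set; apply: bigsetU_measurable => k _; exact: mS.
- exact: mem_set mQ.
- by rewrite -bigcup_mkord => q [k _ []].
Qed.

End weighted_waits.

Lemma measurable_fun_inv_pos d (T : measurableType d) (R : realType) (D : set T)
    (f : T -> R) : measurable_fun D f -> (forall x, D x -> 0 < f x) ->
  measurable_fun D (fun x => (f x)^-1).
Proof.
move=> mf f0; pose D' : set R := `]0, +oo[%classic.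
apply: (@measurable_comp _ _ _ _ _ _ D' (fun y : R => y^-1) D f) mf => //.
- exact: measurable_itv.
- by move=> _ [x Dx <-]; rewrite /D'/= in_itv/= andbT f0.
apply: open_continuous_measurable_fun; first exact: interval_open.
by move=> x; rewrite inE /D'/= in_itv/= andbT => x0; apply: inv_continuous; rewrite gt_eqF.
Qed.

Lemma measurable_fun_sqrt d (T : measurableType d) (R : realType) (D : set T)
    (f : T -> R) : measurable_fun D f -> measurable_fun D (fun x => Num.sqrt (f x)).
Proof.
move=> mf; apply: (@measurableT_comp _ _ _ _ _ _ (fun y : R => Num.sqrt y)) mf.
by apply: continuous_measurable_fun; exact: sqrt_continuous.
Qed.

(** * Weights and caps for the two classes *)

Section optimal_bounds.
Context {R : realType} {m : nat} {Q : set (plane R)} {A v lambda lo hi : R} {shares : rel 'I_m}.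
Context {d : measure_display} {Om : measurableType d}.
Context {P : probability Om R} {phi : plane R -> R}.
Context {X : nat -> {RV P >-> (R * plane R)%type}}.
Context (m_gt0 : (0 < m)%N) (lambda0 : 0 < lambda) (v_gt0 : 0 < v).
Context (HX : target_process lambda Q phi X) (mQ : measurable Q) (areaQ : area Q = A%:E).
Context (mphi : measurable_fun Q phi) (phi1 : (\int[area]_(q in Q) (phi q)%:E = 1)%E).
Context (lo_gt0 : 0 < lo) (phi_bounds : forall q, Q q -> lo <= phi q <= hi).

Let phi_gt0 q : Q q -> 0 < phi q.
Proof. by move=> /phi_bounds/andP[h _]; exact: lt_le_trans h. Qed.

Let phi_ge0 q : Q q -> 0 <= phi q.
Proof. by move=> /phi_gt0/ltW. Qed.

Let phi_le q : Q q -> phi q <= hi.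
Proof. by move=> /phi_bounds/andP[]. Qed.

Let A_gt0 : 0 < A.
Proof.
have A_ge0 : 0 <= A by rewrite -lee_fin -areaQ measure_ge0.
rewrite lt_def A_ge0 andbT; apply/eqP => A0.
have : (\int[area]_(q in Q) (phi q)%:E <= \int[area]_(q in Q) hi%:E)%E.
  apply: ge0_le_integral => //.
  exact/measurable_EFinP.
by rewrite phi1 integral_cst// [X in (_ * X)%E]areaQ A0 mule0 lee_fin ler10.
Qed.

Let hi_gt0 : 0 < hi.
Proof.
have [q Qq] : Q !=set0.
  apply/set0P/eqP => Q0; have := areaQ; rewrite Q0 measure0 => -[A0].
  by have := A_gt0; rewrite -A0 ltxx.
exact: lt_le_trans (phi_gt0 Qq) (phi_le Qq).
Qed.

(** With [wt * phi = 1 / A] and [sigma = 1] one has [alpha = beta = 1 / A] and [gamma = 1]. *)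
Lemma unbiased_optimal_limit :
  ((A / (4 * m%:R * v))%:E <= limf_einf (fun r : R =>
     optimal_system_time X Q v r shares (spatially_unbiased X Q) * r%:E) 0^'+)%E.
Proof.
apply: optimal_system_time_limit => e e0.
pose wt := (fun q => (A * phi q)^-1) \_ Q.
have wtE q : Q q -> wt q = (A * phi q)^-1 by move=> Qq; rewrite /wt patchE mem_set.
have wt_phi q : Q q -> wt q * phi q = A^-1.
  by move=> Qq; rewrite wtE// invfM mulfVK// gt_eqF ?phi_gt0.
have mwt : measurable_fun [set: plane R] wt.
  apply/(measurable_restrictT _ mQ)/measurable_fun_inv_pos; first exact: measurable_funM.
  by move=> q Qq; rewrite mulr_gt0 ?phi_gt0.
have wtP q : 0 <= wt q <= (A * lo)^-1.
  rewrite /wt patchE; case: ifPn => [/[!inE] Qq|_]; last first.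
    by rewrite lexx invr_ge0 mulr_ge0// ltW.
  rewrite invr_ge0 mulr_ge0 ?phi_ge0 ?(ltW A_gt0)//= lef_pV2 ?posrE ?mulr_gt0 ?phi_gt0//.
  by rewrite ler_pM2l//; case/andP: (phi_bounds Qq).
have int_wt : (\int[area]_(q in Q) (wt q * phi q)%:E = 1)%E.
  rewrite (eq_integral (fun=> A^-1%:E)); last by move=> q /[!inE] Qq; rewrite wt_phi.
  by rewrite integral_cst// [X in (_ * X)%E]areaQ -EFinM mulVf// gt_eqF.
have A1 : 0 < A^-1 by rewrite invr_gt0.
have one01 (q : plane R) : 0 <= (cst 1 : plane R -> R) q <= 1 by rewrite /= ler01 lexx.
have [||||r0 r00 small] := small_radius_wait (shares := shares) (sigma := cst 1)
    m_gt0 lambda0 HX v_gt0 mQ mphi phi_ge0 phi1 mwt wtP (measurable_cst _) one01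
    A1 (ltW A1) ltr01 e0.
- by move=> q Qq; rewrite expr1n mulr1 wt_phi.
- by move=> q Qq; rewrite mulr1 wt_phi.
- by rewrite int_wt.
- by rewrite -[RHS]int_wt; apply: eq_integral => q _; rewrite mulr1.
exists r0 => // r rr pol p adm prod unb tau tau0 cv; have /andP[r_gt0 _] := rr.
apply/ler_addgt0Pr => x x0.
(* Since [e' <= 1], [(1 + e') * (tau + e')] is at most [tau + e' * (tau + 2)], and the second bound
   turns the excess times [r] into at most [x]. *)
pose e' := Num.min 1 (x / ((tau + 2) * r)).
have tr0 : 0 < (tau + 2) * r by rewrite mulr_gt0// ltr_wpDl.
have e'0 : 0 < e' by rewrite lt_min ltr01 divr_gt0.
have e'1 : e' <= 1 by rewrite ge_min lexx.
have e'x : e' * ((tau + 2) * r) <= x by rewrite -ler_pdivlMr// ge_min lexx orbT.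
have hyp := uniform_wait_le HX mQ mphi phi1 lo_gt0 phi_bounds areaQ A_gt0 tau0 cv unb e'0.
have tau'0 : 0 <= (1 + e') * (tau + e') by rewrite mulr_ge0// addr_ge0// ltW.
have := small r rr pol p adm prod _ tau'0 hyp.
rewrite expr1n div1r -[_ * A^-1]/(_ / A) invf_div => /le_trans; apply.
apply: (@le_trans _ _ ((tau + e' * (tau + 2)) * r)).
  rewrite ler_wpM2r ?(ltW r_gt0)//.
  have : e' * e' <= e' by rewrite ler_piMl// ltW.
  by move=> ?; lra.
by rewrite mulrDl lerD2l -mulrA.
Qed.

(** With [sigma = 1 / sqrt phi] the charge [phi * sigma ^ 2] is constant, so [alpha = 1] is attained
    at every point of [Q] and no search region is cheaper than another; [gamma] becomes the integral
    of [sqrt phi]. *)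
Lemma biased_optimal_limit :
  ((1 / (4 * m%:R * v) * (\int[area]_(q in Q) Num.sqrt (phi q)) ^+ 2)%:E <=
   limf_einf (fun r : R => optimal_system_time X Q v r shares (fun=> True) * r%:E) 0^'+)%E.
Proof.
apply: optimal_system_time_limit => e e0.
pose gamma := \int[area]_(q in Q) Num.sqrt (phi q).
pose sigma := (fun q => (Num.sqrt (phi q))^-1) \_ Q.
have sqrt_gt0 q : Q q -> 0 < Num.sqrt (phi q) by move=> Qq; rewrite sqrtr_gt0 phi_gt0.
have sigmaE q : Q q -> sigma q = (Num.sqrt (phi q))^-1.
  by move=> Qq; rewrite /sigma patchE mem_set.
have phiE q : Q q -> phi q = Num.sqrt (phi q) * Num.sqrt (phi q).
  by move=> Qq; rewrite -expr2 sqr_sqrtr// phi_ge0.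
have phi_sigma q : Q q -> phi q * sigma q = Num.sqrt (phi q).
  by move=> Qq; rewrite sigmaE// {1}phiE// mulfK// gt_eqF// sqrt_gt0.
have msqrt : measurable_fun Q (fun q => Num.sqrt (phi q)) by exact: measurable_fun_sqrt.
have msigma : measurable_fun [set: plane R] sigma.
  by apply/(measurable_restrictT _ mQ); exact: measurable_fun_inv_pos.
have sigmaP q : 0 <= sigma q <= (Num.sqrt lo)^-1.
  rewrite /sigma patchE; case: ifPn => [/[!inE] Qq|_]; last by rewrite lexx invr_ge0 sqrtr_ge0.
  rewrite invr_ge0 sqrtr_ge0/= lef_pV2 ?posrE ?sqrt_gt0 ?sqrtr_gt0//.
  by rewrite ler_wsqrtr//; case/andP: (phi_bounds Qq).
have mphi' : measurable_fun Q (EFin \o phi) by exact/measurable_EFinP.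
have int_ge0 : (0 <= \int[area]_(q in Q) (Num.sqrt (phi q))%:E)%E.
  by apply: integral_ge0 => q _; rewrite lee_fin sqrtr_ge0.
have int_le : (\int[area]_(q in Q) (Num.sqrt (phi q))%:E <= ((Num.sqrt lo)^-1)%:E)%E.
  rewrite -[leRHS]mule1 -phi1 -ge0_integralZl//.
  apply: ge0_le_integral => //.
  - exact/measurable_EFinP.
  - exact: measurable_funeM.
  - move=> q Qq; rewrite -EFinM lee_fin ler_pdivlMl ?sqrtr_gt0//.
    rewrite {2}phiE// ler_wpM2r ?sqrtr_ge0// ler_wsqrtr//.
    by case/andP: (phi_bounds Qq).
have gammaE : (\int[area]_(q in Q) (Num.sqrt (phi q))%:E = gamma%:E)%E.
  by rewrite /gamma /Rintegral fineK// ge0_fin_numE//; exact: le_lt_trans int_le (ltry _).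
have gamma0 : 0 < gamma.
  have : ((Num.sqrt hi)^-1%:E <= gamma%:E)%E.
    rewrite -gammaE -[leLHS]mule1 -phi1 -ge0_integralZl//.
    apply: ge0_le_integral => //.
    - by move=> q Qq; rewrite mule_ge0 ?lee_fin ?invr_ge0 ?sqrtr_ge0 ?phi_ge0.
    - exact: measurable_funeM.
    - exact/measurable_EFinP.
    - move=> q Qq; rewrite -EFinM lee_fin ler_pdivrMl ?sqrtr_gt0//.
      by rewrite {1}phiE// ler_wpM2r ?sqrtr_ge0// ler_wsqrtr// phi_le.
  by rewrite lee_fin; apply: lt_le_trans; rewrite invr_gt0 sqrtr_gt0.
have one01 (q : plane R) : 0 <= (cst 1 : plane R -> R) q <= 1 by rewrite /= ler01 lexx.
have [||||r0 r00 small] := small_radius_wait (shares := shares) (wt := cst 1)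
    (beta := Num.sqrt hi)
    m_gt0 lambda0 HX v_gt0 mQ mphi phi_ge0 phi1 (measurable_cst _) one01 msigma sigmaP
    ltr01 (sqrtr_ge0 _) gamma0 e0.
- move=> q Qq; rewrite mul1r expr2 mulrA phi_sigma// sigmaE// mulfV// gt_eqF// sqrt_gt0//.
- by move=> q Qq; rewrite mul1r phi_sigma// ler_wsqrtr// phi_le.
- by rewrite -phi1 le_eqVlt; apply/orP; left; apply/eqP/eq_integral => q _; rewrite mul1r.
- rewrite -gammaE; apply: eq_integral => q /[!inE] Qq.
  by rewrite mul1r mulrC phi_sigma.
exists r0 => // r rr pol p adm prod _ tau tau0 cv; have /andP[r_gt0 _] := rr.
apply/ler_addgt0Pr => x x0.
have hyp := unweighted_wait_le cv (divr_gt0 x0 r_gt0).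
have tau'0 : 0 <= tau + x / r by rewrite addr_ge0// divr_ge0// ltW.
have := small r rr pol p adm prod _ tau'0 hyp.
rewrite mulr1 [leRHS]mulrDl divfK ?gt_eqF//.
by rewrite div1r [_^-1 * _]mulrC.
Qed.

End optimal_bounds.

Theorem theorem2 (R : realType) (m : nat) (Q : set (plane R)) (A : R)
    (phi : plane R -> R) (lambda v : R) (shares : rel 'I_m)
    (d : measure_display) (Om : measurableType d) (P : probability Om R)
    (X : nat -> {RV P >-> (R * plane R)%type})
    (m_gt0 : (0 < m)%N)
    (Q_convex : convex_set (Q : set (convex_lmodType (plane R))))
    (Q_compact : compact Q)
    (Q_interior : interior Q !=set0)
    (Q_area : area Q = A%:E)
    (phi_lipschitz : [lipschitz phi q | q in Q])
    (phi_bounds : exists lo hi : R,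
       0 < lo /\ forall q, Q q -> lo <= phi q <= hi)
    (phi_density : (\int[area]_(q in Q) (phi q)%:E)%E = 1%E)
    (lambda_gt0 : 0 < lambda)
    (v_gt0 : 0 < v)
    (shares_refl : reflexive shares)
    (X_targets : target_process lambda Q phi X) :
  ((A / (4 * m%:R * v))%:E <=
     limf_einf (fun r : R =>
       optimal_system_time X Q v r shares (spatially_unbiased X Q) * r%:E)
       0^'+)%E /\
  ((1 / (4 * m%:R * v) * (\int[area]_(q in Q) Num.sqrt (phi q)) ^+ 2)%:E <=
     limf_einf (fun r : R =>
       optimal_system_time X Q v r shares (fun=> True) * r%:E)
       0^'+)%E.
Proof.
have [lo [hi [lo_gt0 bounds]]] := phi_bounds.
have mQ := compact_plane_measurable Q_compact.
have mphi := lipschitz_plane_measurable mQ phi_lipschitz.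
split.
  exact: (unbiased_optimal_limit m_gt0 lambda_gt0 v_gt0 X_targets mQ Q_area mphi
    phi_density lo_gt0 bounds).
exact: (biased_optimal_limit m_gt0 lambda_gt0 v_gt0 X_targets mQ Q_area mphi
  phi_density lo_gt0 bounds).
Qed.
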